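(* Let $\mathbf k$ be a commutative $\mathbb Q$-algebra. There exists a unique group morphism $GRT_1(\mathbf k)\to GRT_1^{ell}(\mathbf k)$ given by $g\mapsto(g,u_+^g,u_-^g)$. It is compatible with the actions of $\mathbf k^\times$, hence extends to a group morphism $GRT(\mathbf k)\to GRT_{ell}(\mathbf k)$, which is a section of the projection $GRT_{ell}(\mathbf k)\to GRT(\mathbf k)$, and fits in a commutative square $$\begin{matrix}GRT(-)&\to&GRT_{ell}(-)\\ \downarrow&&\downarrow\\ \mathbb G_m&\to&GL_2\end{matrix}$$ whose bottom morphism is $c\mapsto\begin{pmatrix}1&0\\ 0&c\end{pmatrix}$.
   Context: $\mathfrak t_n^{\mathbf k}$: generators $t_{ij}=t_{ji}$ ($1\le i\ne j\le n$), relations $[t_{ij},t_{ik}+t_{jk}]=0$, $[t_{ij},t_{kl}]=0$ for distinct indices. $\mathfrak t_{1,n}^{\mathbf k}$: generators $x_i^\pm$, relations $\sum_ix_i^\pm=0$, $[x_i^\pm,x_j^\pm]=0$ and $[x_i^+,x_j^-]=[x_j^+,x_i^-]$ ($i\ne j$), $[x_k^\pm,[x_i^+,x_j^-]]=0$ ($i,j,k$ distinct). Write $x_i=x_i^+,y_i=x_i^-$. Hats are degree completions. There is a morphism $\mathfrak t_n\to\mathfrak t_{1,n}$, $t_{ij}\mapsto[x_i^+,x_j^-]=:t_{ij}$, by which elements of $\exp(\hat{\mathfrak t}_n)$ act on $\hat{\mathfrak t}_{1,n}$. For disjoint $I_1,\dots,I_n\subset\{1,\dots,p\}$, $x\mapsto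 x^{I_1,\dots,I_n}$ is $\mathfrak t_n\to\mathfrak t_p$, $t_{ij}\mapsto\sum_{a\in I_i,b\in I_j}t_{ab}$, and, when the $I_i$ partition $\{1,\dots,p\}$, $\mathfrak t_{1,n}\to\mathfrak t_{1,p}$, $x_i^\pm\mapsto\sum_{a\in I_i}x_a^\pm$. $\hat{\mathfrak f}_2^{\mathbf k}$ is the completed free Lie algebra on $A,B$, embedded in $\hat{\mathfrak t}_3^{\mathbf k}$ by $A\mapsto t_{12},B\mapsto t_{23}$. $\mathfrak t_{1,2}^{\mathbf k}$ is free on $x_1,y_1$. $GRT_1(\mathbf k)$: set of $g\in\exp(\hat{\mathfrak f}_2^{\mathbf k})$ with $g^{3,2,1}=g^{-1}$, $g^{3,1,2}g^{2,3,1}g^{1,2,3}=1$, $t_{12}+\mathrm{Ad}(g^{1,2,3})^{-1}(t_{23})+\mathrm{Ad}(g^{2,1,3})^{-1}(t_{13})=t_{12}+t_{13}+t_{23}$, $g^{2,3,4}g^{1,23,4}g^{1,2,3}=g^{1,2,34}g^{12,3,4}$; product $(g_1*g_2)(A,B)=g_1(\mathrm{Ad}(g_2(A,B))(A),B)g_2(A,B)$. $\mathbf k^\times$ acts by $(c\cdot g)(A,B)=g(c^{-1}A,c^{-1}B)$; $GRT(\mathbf k)=GRT_1(\mathbf k)\rtimes\mathbf k^\times$, and $GRT(-)\to\mathbb G_m$ is the projection. $GRT_1^{ell}(\mathbf k)$: set of $(g,u_+,u_-)$, $g\in GRT_1(\mathbf k)$, $u_\pm\in\hat{\mathfrak t}_{1,2}^{\mathbf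 k}$, such that in $\hat{\mathfrak t}_{1,3}^{\mathbf k}$: $\mathrm{Ad}(g^{1,2,3})^{-1}(u_\pm^{1,23})+\mathrm{Ad}(g^{2,1,3})^{-1}(u_\pm^{2,13})+u_\pm^{3,12}=0$; $[\mathrm{Ad}(g^{1,2,3})^{-1}(u_\pm^{1,23}),u_\pm^{3,12}]=0$; $[\mathrm{Ad}(g^{1,2,3})^{-1}(u_+^{1,23}),\mathrm{Ad}(g^{2,1,3})^{-1}(u_-^{2,13})]=t_{12}$. It is a group with law $(g_1,u^1_\pm)*(g_2,u^2_\pm)=(g_1*g_2,u_\pm)$, $u_\pm(x_1,y_1)=u^1_\pm(u^2_+(x_1,y_1),u^2_-(x_1,y_1))$. $\mathbf k^\times$ acts by $c\cdot(g,u_\pm)=(c\cdot g,c\cdot u_\pm)$, $(c\cdot u_+)(x_1,y_1)=u_+(x_1,c^{-1}y_1)$, $(c\cdot u_-)(x_1,y_1)=c\,u_-(x_1,c^{-1}y_1)$; $GRT_{ell}(\mathbf k)=GRT_1^{ell}(\mathbf k)\rtimes\mathbf k^\times$. The projection $GRT_{ell}\to GRT$ is $(g,u_\pm)\mapsto g$, extended by the identity on $\mathbf k^\times$. The morphism $GRT_{ell}(-)\to GL_2$ sends $(g,u_\pm)\in GRT_1^{ell}(\mathbf k)$ to $\begin{pmatrix}a_+&b_+\\ a_-&b_-\end{pmatrix}$, where $u_\pm\equiv a_\pm x_1+b_\pm y_1$ modulo brackets, and $c\in\mathbf k^\times$ to $\mathrm{diag}(1,c)$. Set $t_{0i}:=-\frac{\mathrm{ad}x_i}{e^{\mathrm{ad}x_i}-1}(y_i)\in\hat{\mathfrak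 t}_{1,2}^{\mathbf k}$ ($i=1,2$), $g^{0,1,2}:=g(t_{01},t_{12})$, $g^{0,2,1}:=g(t_{02},t_{21})$. Since $\hat{\mathfrak t}_{1,2}^{\mathbf k}$ is topologically freely generated by $x_1$ and $t_{01}$, there is a unique $\alpha_g\in\mathrm{Aut}(\hat{\mathfrak t}_{1,2}^{\mathbf k})$ with $\alpha_g(x_1)=\log(g^{0,2,1}e^{x_1}(g^{0,1,2})^{-1})$, $\alpha_g(t_{01})=g^{0,1,2}t_{01}(g^{0,1,2})^{-1}$; set $(u_+^g,u_-^g):=(\alpha_g(x_1),\alpha_g(y_1))$. *)

(* Defs.v *)
From HB Require Import structures.
From mathcomp Require Import all_boot all_order all_algebra.
From mathcomp Require Import boolp classical_sets.

Set Implicit Arguments.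
Unset Strict Implicit.
Unset Printing Implicit Defensive.

Import GRing.Theory.
Local Open Scope quotient_scope.
Local Open Scope classical_set_scope.
Local Open Scope ring_scope.

(* [comAlgType rat] would exclude the zero ring. *)
HB.mixin Record ComPzRing_isQAlgebra k of GRing.ComPzRing k := {
  ofQ : {rmorphism rat -> k}
}.
#[short(type="qalgType")]
HB.structure Definition QAlgebra :=
  {k of GRing.ComPzRing k & ComPzRing_isQAlgebra k}.

(* [fil n] is F^n L, for a complete separated filtration
   L = F^1 L >= F^2 L >= ... *)
HB.mixin Record Lmodule_isCompleteLie (k : qalgType) L
    of GRing.Lmodule k L := {
  lbr : L -> L -> L;
  fil : nat -> set L;
  lbrDl : forall x y z, lbr (x + y) z = lbr x z + lbr y z;
  lbrDr : forall x y z, lbr x (y + z) = lbr x y + lbr x z;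
  lbrZl : forall (a : k) x y, lbr (a *: x) y = a *: lbr x y;
  lbrZr : forall (a : k) x y, lbr x (a *: y) = a *: lbr x y;
  lbrxx : forall x, lbr x x = 0;
  jacobi : forall x y z,
    lbr x (lbr y z) + lbr y (lbr z x) + lbr z (lbr x y) = 0;
  fil_1 : forall x, fil 1%N x;
  fil_0 : forall n, fil n 0;
  fil_D : forall n x y, fil n x -> fil n y -> fil n (x + y);
  fil_Z : forall n (a : k) x, fil n x -> fil n (a *: x);
  fil_le : forall m n x, (m <= n)%N -> fil n x -> fil m x;
  fil_lbr : forall m n x y, fil m x -> fil n y -> fil (m + n)%N (lbr x y);
  fil_sep : forall x, (forall n, fil n x) -> x = 0;
  fil_complete : forall s : nat -> L, (forall n, fil n (s n.+1 - s n)) ->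
    exists x, forall n, fil n (x - s n)
}.
#[short(type="clieType")]
HB.structure Definition CompleteLie (k : qalgType) :=
  {L of GRing.Lmodule k L & Lmodule_isCompleteLie k L}.

Notation "[l: x , y ]" := (lbr x y) (at level 0, x, y at level 99,
  format "[l:  x ,  y ]") : ring_scope.

(* Continuous morphisms, semilinear along phi; Lie algebra morphisms over k
   are the case phi = id. *)
Definition clie_morph (k k' : qalgType) (phi : k -> k')
    (L : clieType k) (L' : clieType k') (f : L -> L') : Prop :=
  [/\ forall x y, f (x + y) = f x + f y,
      forall a x, f (a *: x) = phi a *: f x,
      forall x y, f [l: x, y] = [l: f x, f y] &
      forall n, exists m, forall x, fil m x -> fil n (f x)].

Definition clie_aut (k : qalgType) (L : clieType k) (f : L -> L) : Prop :=
  clie_morph idfun f /\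
  exists h : L -> L, [/\ clie_morph idfun h, cancel f h & cancel h f].

Inductive lterm (k X : Type) : Type :=
| LGen of X
| LZero
| LAdd of lterm k X & lterm k X
| LScale of k & lterm k X
| LBr of lterm k X & lterm k X.

Arguments LGen {k X}.
Arguments LZero {k X}.

(* a lower bound for the degree, exact on bracket monomials *)
Fixpoint ldeg (k X : Type) (t : lterm k X) : nat :=
  match t with
  | LGen _ => 1%N
  | LBr a b => (ldeg a + ldeg b)%N
  | _ => 0%N
  end.

(* All generators have degree 1; [lcong rel n] is equality in the Lie algebra
   presented by the generators X and the relators rel, modulo the ideal of
   elements of degree >= n. *)
Inductive lcong (k : qalgType) (X : Type) (rel : lterm k X -> Prop) (n : nat) :
  lterm k X -> lterm k X -> Prop :=
| LC_refl t : lcong rel n t t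
| LC_sym t u : lcong rel n t u -> lcong rel n u t
| LC_trans t u v : lcong rel n t u -> lcong rel n u v -> lcong rel n t v
| LC_add t t' u u' : lcong rel n t t' -> lcong rel n u u' ->
    lcong rel n (LAdd t u) (LAdd t' u')
| LC_scale a t t' : lcong rel n t t' -> lcong rel n (LScale a t) (LScale a t')
| LC_br t t' u u' : lcong rel n t t' -> lcong rel n u u' ->
    lcong rel n (LBr t u) (LBr t' u')
| LC_addA t u v : lcong rel n (LAdd t (LAdd u v)) (LAdd (LAdd t u) v)
| LC_addC t u : lcong rel n (LAdd t u) (LAdd u t)
| LC_add0 t : lcong rel n (LAdd LZero t) t
| LC_addN t : lcong rel n (LAdd (LScale (-1) t) t) LZero
| LC_scaleA a b t : lcong rel n (LScale a (LScale b t)) (LScale (a * b) t)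
| LC_scale1 t : lcong rel n (LScale 1 t) t
| LC_scaleDr a t u :
    lcong rel n (LScale a (LAdd t u)) (LAdd (LScale a t) (LScale a u))
| LC_scaleDl a b t :
    lcong rel n (LScale (a + b) t) (LAdd (LScale a t) (LScale b t))
| LC_brDl t u v : lcong rel n (LBr (LAdd t u) v) (LAdd (LBr t v) (LBr u v))
| LC_brDr t u v : lcong rel n (LBr t (LAdd u v)) (LAdd (LBr t u) (LBr t v))
| LC_brZl a t u : lcong rel n (LBr (LScale a t) u) (LScale a (LBr t u))
| LC_brZr a t u : lcong rel n (LBr t (LScale a u)) (LScale a (LBr t u))
| LC_brxx t : lcong rel n (LBr t t) LZero
| LC_jacobi t u v : lcong rel n
    (LAdd (LAdd (LBr t (LBr u v)) (LBr u (LBr v t))) (LBr v (LBr t u))) LZero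
| LC_rel t : rel t -> lcong rel n t LZero
| LC_deg t : (n <= ldeg t)%N -> lcong rel n t LZero.

Section Hat.
Variables (k : qalgType) (X : Type) (rel : lterm k X -> Prop).

Local Notation term := (lterm k X).
Local Notation "t ~[ n ] u" := (lcong rel n t u)
  (at level 70, n at level 0, format "t  ~[ n ]  u").

Lemma lcong_le m n t u : (m <= n)%N -> t ~[n] u -> t ~[m] u.
Proof.
move=> mn; elim; try by move=> *; constructor.
- by move=> t1 u1 v1 _ h1 _ h2; apply: LC_trans h1 h2.
- by move=> t1 le; apply/LC_deg/(leq_trans mn).
Qed.

(* Compatible families in the tower of the quotients modulo degree >= n. *)
Record cseq := CSeq {
  cseq_val :> nat -> term;
  cseqP : forall n, cseq_val n ~[n] cseq_val n.+1
}.
HB.instance Definition _ := gen_eqMixin cseq.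
HB.instance Definition _ := gen_choiceMixin cseq.

Definition cseq_eq (s t : cseq) : bool := `[< forall n, s n ~[n] t n >].

Lemma cseq_eq_refl : reflexive cseq_eq.
Proof. by move=> s; apply/asboolP => n; apply: LC_refl. Qed.
Lemma cseq_eq_sym : symmetric cseq_eq.
Proof.
by move=> s t; apply/asboolP/asboolP => h n; apply: LC_sym.
Qed.
Lemma cseq_eq_trans : transitive cseq_eq.
Proof.
move=> t s u /asboolP h1 /asboolP h2; apply/asboolP => n.
exact: LC_trans (h1 n) (h2 n).
Qed.
Canonical cseq_equiv :=
  EquivRel cseq_eq cseq_eq_refl cseq_eq_sym cseq_eq_trans.

Definition hat : Type := {eq_quot cseq_eq}.
HB.instance Definition _ := Choice.on hat.
HB.instance Definition _ := EqQuotient.on hat.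

Lemma hatP (s t : cseq) : (\pi_hat s = \pi_hat t) <-> (forall n, s n ~[n] t n).
Proof. by split=> [/eqmodP /asboolP|h]; last by apply/eqmodP/asboolP. Qed.

Lemma hat_ind (P : hat -> Prop) : (forall s, P (\pi_hat s)) -> forall x, P x.
Proof. by move=> h x; rewrite -[x]reprK. Qed.

Lemma hat_repr (s : cseq) n : repr (\pi_hat s) n ~[n] s n.
Proof. by have /hatP := reprK (\pi_hat s); apply. Qed.

Definition cconst (t : term) : cseq := @CSeq (fun=> t) (fun n => LC_refl rel n t).

Lemma cadd_subproof (s t : cseq) n :
  LAdd (s n) (t n) ~[n] LAdd (s n.+1) (t n.+1).
Proof. by apply: LC_add; apply: cseqP. Qed.
Definition cadd s t := CSeq (cadd_subproof s t).

Lemma cscale_subproof a (s : cseq) n : LScale a (s n) ~[n] LScale a (s n.+1).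
Proof. by apply: LC_scale; apply: cseqP. Qed.
Definition cscale a s := CSeq (cscale_subproof a s).

Lemma cbr_subproof (s t : cseq) n : LBr (s n) (t n) ~[n] LBr (s n.+1) (t n.+1).
Proof. by apply: LC_br; apply: cseqP. Qed.
Definition cbr s t := CSeq (cbr_subproof s t).

Definition hat0 : hat := \pi_hat (cconst LZero).
Definition hat_add (x y : hat) : hat := \pi_hat (cadd (repr x) (repr y)).
Definition hat_scale a (x : hat) : hat := \pi_hat (cscale a (repr x)).
Definition hat_opp (x : hat) : hat := hat_scale (-1) x.
Definition hat_br (x y : hat) : hat := \pi_hat (cbr (repr x) (repr y)).
Definition hat_fil n (x : hat) : Prop := repr x n ~[n] LZero.

Lemma hat_addE s t : hat_add (\pi_hat s) (\pi_hat t) = \pi_hat (cadd s t).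
Proof. by apply/hatP => n; apply: LC_add; apply: hat_repr. Qed.
Lemma hat_scaleE a s : hat_scale a (\pi_hat s) = \pi_hat (cscale a s).
Proof. by apply/hatP => n; apply: LC_scale; apply: hat_repr. Qed.
Lemma hat_brE s t : hat_br (\pi_hat s) (\pi_hat t) = \pi_hat (cbr s t).
Proof. by apply/hatP => n; apply: LC_br; apply: hat_repr. Qed.
Lemma hat_filE n s : hat_fil n (\pi_hat s) <-> s n ~[n] LZero.
Proof.
by split=> h; apply: LC_trans h; [apply/LC_sym|]; apply: hat_repr.
Qed.

Definition hatE := (hat_addE, hat_scaleE, hat_brE).

Lemma hat_addA : associative hat_add.
Proof.
elim/hat_ind=> s; elim/hat_ind=> t; elim/hat_ind=> u; rewrite !hatE.
by apply/hatP => n; apply: LC_addA.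
Qed.
Lemma hat_addC : commutative hat_add.
Proof.
by elim/hat_ind=> s; elim/hat_ind=> t; rewrite !hatE;
  apply/hatP => n; apply: LC_addC.
Qed.
Lemma hat_add0 : left_id hat0 hat_add.
Proof. by elim/hat_ind=> s; rewrite !hatE; apply/hatP => n; apply: LC_add0. Qed.
Lemma hat_addN : left_inverse hat0 hat_opp hat_add.
Proof.
by elim/hat_ind=> s; rewrite /hat_opp !hatE; apply/hatP => n; apply: LC_addN.
Qed.
HB.instance Definition _ :=
  GRing.isZmodule.Build hat hat_addA hat_addC hat_add0 hat_addN.

Lemma hat_scaleA a b x : hat_scale a (hat_scale b x) = hat_scale (a * b) x.
Proof.
by elim/hat_ind: x => s; rewrite !hatE; apply/hatP => n; apply: LC_scaleA.
Qed.
Lemma hat_scale1 : left_id 1 hat_scale.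
Proof. by elim/hat_ind=> s; rewrite !hatE; apply/hatP => n; apply: LC_scale1. Qed.
Lemma hat_scaleDr : right_distributive hat_scale +%R.
Proof.
move=> a; elim/hat_ind=> s; elim/hat_ind=> t; rewrite /GRing.add /= !hatE.
by apply/hatP => n; apply: LC_scaleDr.
Qed.
Lemma hat_scaleDl x : {morph hat_scale^~ x : a b / a + b}.
Proof.
move=> a b; elim/hat_ind: x => s; rewrite [in RHS]/GRing.add /= !hatE.
by apply/hatP => n; apply: LC_scaleDl.
Qed.
HB.instance Definition _ := GRing.Zmodule_isLmodule.Build k hat
  hat_scaleA hat_scale1 hat_scaleDr hat_scaleDl.

Lemma hatD s t : \pi_hat s + \pi_hat t = \pi_hat (cadd s t).
Proof. exact: hat_addE. Qed.
Lemma hatZ a s : a *: \pi_hat s = \pi_hat (cscale a s).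
Proof. exact: hat_scaleE. Qed.
Lemma hatB s t : \pi_hat s - \pi_hat t = \pi_hat (cadd s (cscale (-1) t)).
Proof. by rewrite -hatD -hatZ scaleN1r. Qed.

Lemma hat_brDl x y z : hat_br (x + y) z = hat_br x z + hat_br y z.
Proof.
elim/hat_ind: x => s; elim/hat_ind: y => t; elim/hat_ind: z => u.
by rewrite hatD !hat_brE hatD; apply/hatP => n; apply: LC_brDl.
Qed.
Lemma hat_brDr x y z : hat_br x (y + z) = hat_br x y + hat_br x z.
Proof.
elim/hat_ind: x => s; elim/hat_ind: y => t; elim/hat_ind: z => u.
by rewrite hatD !hat_brE hatD; apply/hatP => n; apply: LC_brDr.
Qed.
Lemma hat_brZl (a : k) x y : hat_br (a *: x) y = a *: hat_br x y.
Proof.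
elim/hat_ind: x => s; elim/hat_ind: y => t.
by rewrite hatZ !hat_brE hatZ; apply/hatP => n; apply: LC_brZl.
Qed.
Lemma hat_brZr (a : k) x y : hat_br x (a *: y) = a *: hat_br x y.
Proof.
elim/hat_ind: x => s; elim/hat_ind: y => t.
by rewrite hatZ !hat_brE hatZ; apply/hatP => n; apply: LC_brZr.
Qed.
Lemma hat_brxx x : hat_br x x = 0.
Proof. by elim/hat_ind: x => s; rewrite hatE; apply/hatP => n; apply: LC_brxx. Qed.
Lemma hat_jacobi x y z :
  hat_br x (hat_br y z) + hat_br y (hat_br z x) + hat_br z (hat_br x y) = 0.
Proof.
elim/hat_ind: x => s; elim/hat_ind: y => t; elim/hat_ind: z => u.
by rewrite !hat_brE !hatD; apply/hatP => n; apply: LC_jacobi.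
Qed.

Lemma lcong0 n t : t ~[n] LZero <-> LZero ~[n] t.
Proof. by split; apply: LC_sym. Qed.

Lemma lcong_addz n : LAdd LZero LZero ~[n] LZero. Proof. exact: LC_add0. Qed.

Lemma lcong_scalez n a : LScale a LZero ~[n] LZero.
Proof.
have z0 b : LScale b LZero ~[n] LAdd (LScale b LZero) (LScale b LZero).
  apply: LC_trans (LC_scaleDr rel n b LZero LZero).
  by apply/LC_scale/LC_sym/LC_add0.
set u := LScale a LZero.
apply: (LC_trans (LC_sym (LC_add0 rel n u))).
apply: (LC_trans (LC_add (LC_sym (LC_addN rel n u)) (LC_refl rel n u))).
apply: (LC_trans (LC_sym (LC_addA rel n _ _ _))).
apply: LC_trans (LC_addN rel n u).
by apply: LC_add; [apply: LC_refl|apply: LC_sym; apply: z0].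
Qed.

Lemma lcong_subr n t u : LAdd t (LScale (-1) u) ~[n] LZero <-> t ~[n] u.
Proof.
split=> h.
  apply: (LC_trans (LC_sym (LC_add0 rel n t))).
  apply: (LC_trans (LC_addC _ _ _ _)).
  apply: (LC_trans (LC_add (LC_refl rel n t) (LC_sym (LC_addN rel n u)))).
  apply: (LC_trans (LC_addA _ _ _ _ _)).
  apply: (LC_trans (LC_add h (LC_refl rel n u))).
  exact: LC_add0.
apply: (LC_trans (LC_add h (LC_refl rel n _))).
apply: (LC_trans (LC_addC _ _ _ _)).
exact: LC_addN.
Qed.

Lemma hat_filB n s t : hat_fil n (\pi_hat s - \pi_hat t) <-> s n ~[n] t n.
Proof. by rewrite hatB hat_filE /=; apply: lcong_subr. Qed.

Lemma lcong_low n t : (n <= 1)%N -> t ~[n] LZero.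
Proof.
move=> n1; elim: t => [x||t ht u hu|a t ht|t ht u hu].
- exact: LC_deg.
- exact: LC_refl.
- exact: LC_trans (LC_add ht hu) (lcong_addz n).
- exact: LC_trans (LC_scale a ht) (lcong_scalez n a).
- by apply: LC_trans (LC_br ht hu) _; apply: LC_brxx.
Qed.

(* [ldeep m t]: t is a combination of bracket terms of degree >= m. *)
Inductive ldeep (m : nat) : term -> Prop :=
| LD0 : ldeep m LZero
| LDD t u : ldeep m t -> ldeep m u -> ldeep m (LAdd t u)
| LDZ a t : ldeep m t -> ldeep m (LScale a t)
| LDdeg t : (m <= ldeg t)%N -> ldeep m t.

Lemma ldeep_cong m t : ldeep m t -> t ~[m] LZero.
Proof.
elim=> {t} [|t u _ ht _ hu|a t _ ht|t]; last exact: LC_deg.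
- exact: LC_refl.
- exact: LC_trans (LC_add ht hu) (lcong_addz m).
- exact: LC_trans (LC_scale a ht) (lcong_scalez m a).
Qed.

Lemma lcong_brz n t : LBr t LZero ~[n] LZero.
Proof.
have h1 : LScale 0 (LBr t LZero) ~[n] LZero.
  have := LC_scaleDl rel n (-1) 1 (LBr t LZero).
  rewrite addNr => h; apply: (LC_trans h).
  apply: (LC_trans _ (LC_addN rel n (LBr t LZero))).
  by apply: LC_add; [apply: LC_refl|apply: LC_scale1].
apply: LC_trans h1; apply: LC_sym.
apply: (LC_trans (LC_sym (LC_brZr rel n 0 t LZero))).
by apply: LC_br; [apply: LC_refl|apply: lcong_scalez].
Qed.

Lemma lcong_zbr n t : LBr LZero t ~[n] LZero.
Proof.
have h1 : LScale 0 (LBr LZero t) ~[n] LZero.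
  have := LC_scaleDl rel n (-1) 1 (LBr LZero t).
  rewrite addNr => h; apply: (LC_trans h).
  apply: (LC_trans _ (LC_addN rel n (LBr LZero t))).
  by apply: LC_add; [apply: LC_refl|apply: LC_scale1].
apply: LC_trans h1; apply: LC_sym.
apply: (LC_trans (LC_sym (LC_brZl rel n 0 LZero t))).
by apply: LC_br; [apply: lcong_scalez|apply: LC_refl].
Qed.

Lemma lcong_ldeep m n t : t ~[m] LZero -> (m <= n)%N ->
  exists2 d, ldeep m d & t ~[n] d.
Proof.
move=> tm mn.
suff diff u v : u ~[m] v ->
    exists2 d, ldeep m d & u ~[n] LAdd v d.
  have [d dm td] := diff _ _ tm; exists d => //.
  by apply: LC_trans td _; apply: LC_add0.
clear t tm.
have add0r t : LAdd t LZero ~[n] t.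
  by apply: LC_trans (LC_addC _ _ _ _) (LC_add0 _ _ _).
have AC a b c d : LAdd (LAdd a b) (LAdd c d) ~[n] LAdd (LAdd a c) (LAdd b d).
  apply: (LC_trans (LC_sym (LC_addA _ _ _ _ _))).
  apply: (LC_trans _ (LC_addA _ _ _ _ _)).
  apply: LC_add; first exact: LC_refl.
  apply: (LC_trans (LC_addA _ _ _ _ _)).
  apply: (LC_trans _ (LC_sym (LC_addA _ _ _ _ _))).
  by apply: LC_add; [apply: LC_addC|apply: LC_refl].
have eqz x y : x ~[n] y -> exists2 d, ldeep m d & x ~[n] LAdd y d.
  move=> xy; exists LZero; first exact: LD0.
  by apply: LC_trans xy _; apply/LC_sym/add0r.
have brl d t : ldeep m d -> exists2 e, ldeep m e & LBr d t ~[n] e.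
  elim=> {d} [|d e _ [d' hd' hd] _ [e' he' he]|a d _ [d' hd' hd]|d dm].
  - by exists LZero; [apply: LD0|apply: lcong_zbr].
  - exists (LAdd d' e'); first exact: LDD.
    by apply: LC_trans (LC_brDl _ _ _ _ _) _; apply: LC_add.
  - exists (LScale a d'); first exact: LDZ.
    by apply: LC_trans (LC_brZl _ _ _ _ _) _; apply: LC_scale.
  - exists (LBr d t); last exact: LC_refl.
    by apply: LDdeg => /=; apply: leq_trans dm (leq_addr _ _).
have brr d t : ldeep m d -> exists2 e, ldeep m e & LBr t d ~[n] e.
  elim=> {d} [|d e _ [d' hd' hd] _ [e' he' he]|a d _ [d' hd' hd]|d dm].
  - by exists LZero; [apply: LD0|apply: lcong_brz].
  - exists (LAdd d' e'); first exact: LDD.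
    by apply: LC_trans (LC_brDr _ _ _ _ _) _; apply: LC_add.
  - exists (LScale a d'); first exact: LDZ.
    by apply: LC_trans (LC_brZr _ _ _ _ _) _; apply: LC_scale.
  - exists (LBr t d); last exact: LC_refl.
    by apply: LDdeg => /=; apply: leq_trans dm (leq_addl _ _).
elim=> {u v}; try by move=> *; apply: eqz; constructor.
- move=> t u _ [d dm h]; exists (LScale (-1) d); first exact: LDZ.
  apply: LC_sym; apply: (LC_trans (LC_add h (LC_refl _ _ _))).
  apply: (LC_trans (LC_sym (LC_addA _ _ _ _ _))).
  apply: (LC_trans _ (add0r u)).
  apply: LC_add; first exact: LC_refl.
  by apply: LC_trans (LC_addC _ _ _ _) (LC_addN _ _ _).
- move=> t u v _ [d dm hd] _ [e em he].
  exists (LAdd e d); first exact: LDD.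
  apply: (LC_trans hd); apply: (LC_trans _ (LC_sym (LC_addA _ _ _ _ _))).
  by apply: LC_add => //; apply: LC_refl.
- move=> t t' u u' _ [d dm hd] _ [e em he].
  exists (LAdd d e); first exact: LDD.
  by apply: (LC_trans (LC_add hd he)); apply: AC.
- move=> a t t' _ [d dm hd]; exists (LScale a d); first exact: LDZ.
  by apply: LC_trans (LC_scale a hd) _; apply: LC_scaleDr.
- move=> t t' u u' _ [d dm hd] _ [e em he].
  have [d1 d1m hd1] := brl _ u' dm.
  have [e1 e1m he1] := brr _ (LAdd t' d) em.
  exists (LAdd d1 e1); first exact: LDD.
  apply: (LC_trans (LC_br hd he)).
  apply: (LC_trans (LC_brDr _ _ _ _ _)).
  apply: (LC_trans _ (LC_sym (LC_addA _ _ _ _ _))).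
  apply: LC_add => //.
  apply: (LC_trans (LC_brDl _ _ _ _ _)).
  by apply: LC_add => //; apply: LC_refl.
- move=> t tm; exists t; first exact: LDdeg.
  by apply/LC_sym/LC_add0.
Qed.

Lemma cseq_le (s : cseq) m n : (m <= n)%N -> s m ~[m] s n.
Proof.
move=> /subnK <-; elim: (n - m)%N => [|i IH]; first exact: LC_refl.
apply: LC_trans IH _; apply: lcong_le (cseqP s _); exact: leq_addl.
Qed.

Lemma hat_fil_lift n (s : cseq) N : hat_fil n (\pi_hat s) -> (n <= N)%N ->
  s N ~[n] LZero.
Proof.
move=> /hat_filE h nN; apply: LC_trans h.
by apply/LC_sym/cseq_le.
Qed.

Lemma hat_fil1 x : hat_fil 1 x.
Proof. exact: lcong_low. Qed.
Lemma hat_fil0 n : hat_fil n 0.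
Proof. by apply/hat_filE; apply: LC_refl. Qed.
Lemma hat_filD n x y : hat_fil n x -> hat_fil n y -> hat_fil n (x + y).
Proof.
elim/hat_ind: x => s; elim/hat_ind: y => t /hat_filE hs /hat_filE ht.
rewrite hatD; apply/hat_filE.
exact: LC_trans (LC_add hs ht) (lcong_addz n).
Qed.
Lemma hat_filZ n (a : k) x : hat_fil n x -> hat_fil n (a *: x).
Proof.
elim/hat_ind: x => s /hat_filE hs; rewrite hatZ; apply/hat_filE.
exact: LC_trans (LC_scale a hs) (lcong_scalez n a).
Qed.
Lemma hat_fil_le m n x : (m <= n)%N -> hat_fil n x -> hat_fil m x.
Proof.
elim/hat_ind: x => s mn /hat_filE hs; apply/hat_filE.
apply: LC_trans (cseq_le s mn) _; exact: lcong_le hs.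
Qed.
Lemma hat_filbr m n x y :
  hat_fil m x -> hat_fil n y -> hat_fil (m + n)%N (hat_br x y).
Proof.
elim/hat_ind: x => s; elim/hat_ind: y => t hs ht.
rewrite hatE; apply/hat_filE => /=.
have {hs} hs := hat_fil_lift hs (leq_addr n m).
have {ht} ht := hat_fil_lift ht (leq_addl m n).
have [d dm hd] := lcong_ldeep hs (leq_addr n m).
have [e en he] := lcong_ldeep ht (leq_addl m n).
apply: (LC_trans (LC_br hd he)); move: dm en {hs ht hd he}.
elim=> {d} [|d d' _ IH _ IH'|a d _ IH|d dm].
- by move=> _; apply: lcong_zbr.
- move=> en; apply: (LC_trans (LC_brDl _ _ _ _ _)).
  exact: LC_trans (LC_add (IH en) (IH' en)) (lcong_addz _).
- move=> en; apply: (LC_trans (LC_brZl _ _ _ _ _)).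
  exact: LC_trans (LC_scale a (IH en)) (lcong_scalez _ a).
elim=> {e} [|e e' _ IH _ IH'|a e _ IH|e en].
- exact: lcong_brz.
- apply: (LC_trans (LC_brDr _ _ _ _ _)).
  exact: LC_trans (LC_add IH IH') (lcong_addz _).
- apply: (LC_trans (LC_brZr _ _ _ _ _)).
  exact: LC_trans (LC_scale a IH) (lcong_scalez _ a).
- by apply: LC_deg; apply: leq_add.
Qed.
Lemma hat_fil_sep x : (forall n, hat_fil n x) -> x = 0.
Proof. by elim/hat_ind: x => s h; apply/hatP => n; apply/hat_filE. Qed.
Lemma hat_fil_complete (s : nat -> hat) :
  (forall n, hat_fil n (s n.+1 - s n)) ->
  exists x, forall n, hat_fil n (x - s n).
Proof.
move=> h; pose r n := repr (s n) n.
have rP n : r n ~[n] r n.+1.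
  have := h n; rewrite -[s n.+1]reprK -[s n]reprK => /hat_filB/LC_sym hn.
  by apply: LC_trans hn _; apply: cseqP.
exists (\pi_hat (CSeq rP)) => n; rewrite -[s n]reprK.
by apply/hat_filB; apply: LC_refl.
Qed.

HB.instance Definition _ := Lmodule_isCompleteLie.Build k hat
  hat_brDl hat_brDr hat_brZl hat_brZr hat_brxx hat_jacobi hat_fil1 hat_fil0
  hat_filD hat_filZ hat_fil_le hat_filbr hat_fil_sep hat_fil_complete.

Definition hgen (x : X) : hat := \pi_hat (cconst (LGen x)).

End Hat.

Section Lift.
Variables (k k' : qalgType) (X : Type) (rel : lterm k X -> Prop).
Variables (phi : {rmorphism k -> k'}) (L : clieType k') (v : X -> L).

Fixpoint leval (t : lterm k X) : L :=
  match t with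
  | LGen x => v x
  | LZero => 0
  | LAdd t u => leval t + leval u
  | LScale a t => phi a *: leval t
  | LBr t u => [l: leval t, leval u]
  end.

Lemma fil_N n (x : L) : fil n x -> fil n (- x).
Proof. by move=> h; rewrite -scaleN1r; apply: fil_Z. Qed.

Lemma fil_B n (x y : L) : fil n x -> fil n y -> fil n (x - y).
Proof. by move=> hx hy; apply: fil_D => //; apply: fil_N. Qed.

Lemma fil_tri n (x y z : L) : fil n (x - y) -> fil n (y - z) -> fil n (x - z).
Proof. by move=> hx hy; rewrite -[x](subrK y) -addrA; apply: fil_D. Qed.

Lemma lbr0 (x : L) : [l: 0, x] = 0.
Proof. by have := lbrZl (0 : k') 0 x; rewrite !scale0r. Qed.

Lemma fil_leval t : fil (ldeg t) (leval t).
Proof.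
have f0 x : @fil _ L 0 x by apply: (@fil_le _ _ 0 1) => //; apply: fil_1.
by elim: t => //= [x|t ht u hu]; [apply: fil_1|apply: fil_lbr].
Qed.

Hypothesis vrel : forall t, rel t -> leval t = 0.

Lemma leval_lcong n t u : lcong rel n t u -> fil n (leval t - leval u).
Proof.
have E x y : x = y -> @fil _ L n (x - y).
  by move=> ->; rewrite subrr; apply: fil_0.
elim=> {t u} /=.
- by move=> t; apply: E.
- by move=> t u _ h; rewrite -opprB; apply: fil_N.
- by move=> t u w _ h1 _ h2; apply: fil_tri h1 h2.
- move=> t t' u u' _ h1 _ h2.
  by rewrite opprD addrACA; apply: fil_D.
- by move=> a t t' _ h; rewrite -scalerBr; apply: fil_Z.
- move=> t t' u u' _ h1 _ h2.
  apply: (@fil_tri _ _ [l: leval t', leval u]).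
    have -> : [l: leval t, leval u] - [l: leval t', leval u]
        = [l: leval t - leval t', leval u].
      by rewrite lbrDl -scaleN1r -[in RHS]scaleN1r lbrZl.
    by apply: (@fil_le _ _ n (n + 1)%N); [apply: leq_addr|apply: fil_lbr => //; apply: fil_1].
  have -> : [l: leval t', leval u] - [l: leval t', leval u']
      = [l: leval t', leval u - leval u'].
    by rewrite lbrDr -scaleN1r -[in RHS]scaleN1r lbrZr.
  by apply: (@fil_le _ _ n (1 + n)%N); [apply: leq_addl|apply: fil_lbr => //; apply: fil_1].
- by move=> *; apply: E; rewrite addrA.
- by move=> *; apply: E; rewrite addrC.
- by move=> *; apply: E; rewrite add0r.
- by move=> *; apply: E; rewrite rmorphN rmorph1 scaleN1r addNr.
- by move=> *; apply: E; rewrite scalerA rmorphM.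
- by move=> *; apply: E; rewrite rmorph1 scale1r.
- by move=> *; apply: E; rewrite scalerDr.
- by move=> *; apply: E; rewrite rmorphD scalerDl.
- by move=> *; apply: E; rewrite lbrDl.
- by move=> *; apply: E; rewrite lbrDr.
- by move=> *; apply: E; rewrite lbrZl.
- by move=> *; apply: E; rewrite lbrZr.
- by move=> *; apply: E; rewrite lbrxx.
- by move=> *; apply: E; rewrite jacobi.
- by move=> t /vrel ->; apply: E.
- by move=> t nt; rewrite subr0; apply: fil_le nt _; apply: fil_leval.
Qed.

Lemma fil_eq (x y : L) : (forall n, fil n (x - y)) -> x = y.
Proof. by move=> h; apply/eqP; rewrite -subr_eq0; apply/eqP/fil_sep. Qed.

Theorem hat_lift : exists f : hat rel -> L,
  clie_morph phi f /\ forall x, f (hgen rel x) = v x.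
Proof.
have lim (s : cseq rel) : exists y, forall n, fil n (y - leval (s n)).
  apply: fil_complete => n; rewrite -opprB; apply: fil_N.
  by apply: leval_lcong; apply: cseqP.
pose f0 (s : cseq rel) := projT1 (cid (lim s)).
have f0P (s : cseq rel) n : fil n (f0 s - leval (s n)) by rewrite /f0; case: cid.
have f0E (s : cseq rel) y : (forall n, fil n (y - leval (s n))) -> f0 s = y.
  move=> h; apply: fil_eq => n; apply: fil_tri (f0P s n) _.
  by rewrite -opprB; apply: fil_N.
have f0_eq (s t : cseq rel) : \pi_(hat rel) s = \pi_(hat rel) t -> f0 s = f0 t.
  move/hatP => st; apply: f0E => n; apply: fil_tri (f0P t n) _.
  by rewrite -opprB; apply: fil_N; apply: leval_lcong.
pose f (x : hat rel) := f0 (repr x).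
have fE (s : cseq rel) : f (\pi_(hat rel) s) = f0 s by apply: f0_eq; rewrite reprK.
exists f; split; first split.
- elim/hat_ind=> s; elim/hat_ind=> t; rewrite hatD !fE; apply: f0E => n /=.
  by rewrite opprD addrACA; apply: fil_D.
- move=> a; elim/hat_ind=> s; rewrite hatZ !fE; apply: f0E => n /=.
  by rewrite -scalerBr; apply: fil_Z.
- elim/hat_ind=> s; elim/hat_ind=> t.
  rewrite [X in f X](hat_brE s t) !fE; apply: f0E => n /=.
  apply: (@fil_tri _ _ [l: leval (s n), f0 t]).
    have -> : [l: f0 s, f0 t] - [l: leval (s n), f0 t]
        = [l: f0 s - leval (s n), f0 t].
      by rewrite lbrDl -scaleN1r -[in RHS]scaleN1r lbrZl.
    by apply: (@fil_le _ _ n (n + 1)%N); [apply: leq_addr|apply: fil_lbr => //; apply: fil_1].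
  have -> : [l: leval (s n), f0 t] - [l: leval (s n), leval (t n)]
      = [l: leval (s n), f0 t - leval (t n)].
    by rewrite lbrDr -scaleN1r -[in RHS]scaleN1r lbrZr.
  by apply: (@fil_le _ _ n (1 + n)%N); [apply: leq_addl|apply: fil_lbr => //; apply: fil_1].
- move=> n; exists n; elim/hat_ind=> s /hat_filE sn; rewrite fE.
  rewrite -[f0 s](subrK (leval (s n))); apply: fil_D => //.
  by rewrite -[leval _]subr0; apply: (leval_lcong sn).
- move=> x; rewrite fE; apply: f0E => n /=.
  by rewrite subrr; apply: fil_0.
Qed.

End Lift.

Section LiftUnique.
Variables (k k' : qalgType) (X : Type) (rel : lterm k X -> Prop).
Variables (phi : {rmorphism k -> k'}) (L : clieType k').

Theorem hat_lift_unique (f g : hat rel -> L) :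
  clie_morph phi f -> clie_morph phi g ->
  (forall x, f (hgen rel x) = g (hgen rel x)) -> f = g.
Proof.
move=> [fD fZ fbr fc] [gD gZ gbr gc] fg; apply/funext => x.
have f0 : f 0 = 0 by rewrite -(scale0r 0) fZ rmorph0 scale0r.
have g0 : g 0 = 0 by rewrite -(scale0r 0) gZ rmorph0 scale0r.
have fgt t : f (\pi_(hat rel) (cconst rel t)) = g (\pi_(hat rel) (cconst rel t)).
  elim: t => [y||t ht u hu|a t ht|t ht u hu].
  - exact: fg.
  - by rewrite [f _]f0 [g _]g0.
  - have -> : \pi_(hat rel) (cconst rel (LAdd t u))
        = \pi_(hat rel) (cconst rel t) + \pi_(hat rel) (cconst rel u).
      by rewrite hatD; apply/hatP => n; apply: LC_refl.
    by rewrite fD gD ht hu.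
  - have -> : \pi_(hat rel) (cconst rel (LScale a t)) = a *: \pi_(hat rel) (cconst rel t).
      by rewrite hatZ; apply/hatP => n; apply: LC_refl.
    by rewrite fZ gZ ht.
  - have -> : \pi_(hat rel) (cconst rel (LBr t u))
        = [l: \pi_(hat rel) (cconst rel t), \pi_(hat rel) (cconst rel u)].
      rewrite [RHS](hat_brE (cconst rel t) (cconst rel u)).
      by apply/hatP => n; apply: LC_refl.
    by rewrite fbr gbr ht hu.
apply: fil_eq => n; have [m1 h1] := fc n; have [m2 h2] := gc n.
elim/hat_ind: x => s; pose m := maxn m1 m2.
pose c := \pi_(hat rel) (cconst rel (s m)); pose d := \pi_(hat rel) s - c.
have dm : fil m d by apply/hat_filB; apply: LC_refl.
have -> : \pi_(hat rel) s = d + c by rewrite subrK.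
rewrite fD gD fgt opprD addrACA subrr addr0; apply: fil_B.
- by apply: h1; apply: fil_le dm; apply: leq_maxl.
- by apply: h2; apply: fil_le dm; apply: leq_maxr.
Qed.
End LiftUnique.

Section Exp.
Variables (k : qalgType) (L : clieType k).
Implicit Types x y : L.

Definition qscale (q : rat) x : L := ofQ q *: x.

Definition lsum (f : nat -> L) : L :=
  xget 0 [set S | forall n, exists m0, forall m, (m0 <= m)%N ->
                  fil n (S - \sum_(i < m) f i)].

Definition ad x : L -> L := lbr x.

(* Ad(e^x) = exp(ad x) *)
Definition Ad x y : L := lsum (fun n => qscale (n`!%:R^-1) (iter n (ad x) y)).

(* [:: x1; ...; xn] |-> [x1, [x2, ... [x(n-1), xn]]] *)
Fixpoint rbracket (s : seq L) : L :=
  match s with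
  | [::] => 0
  | [:: x] => x
  | x :: s' => [l: x, rbracket s']
  end.

End Exp.

(* Coefficients of noncommutative power series in A = true and B = false:
   of e^A e^B - 1, of its powers, and of log(e^A e^B). *)
Definition expexp_coef (w : seq bool) : rat :=
  let r := count id w in let s := count negb w in
  if (w != [::]) && (w == nseq r true ++ nseq s false)
  then (r`! * s`!)%N%:R^-1 else 0.

Fixpoint expexp_pow_coef (m : nat) (w : seq bool) : rat :=
  if m is m'.+1 then
    \sum_(i < (size w).+1)
      expexp_coef (take i w) * expexp_pow_coef m' (drop i w)
  else (w == [::])%:R.

Definition logexpexp_coef (w : seq bool) : rat :=
  \sum_(1 <= m < (size w).+1) (-1) ^+ m.-1 / m%:R * expexp_pow_coef m w.

Section ExpGroup.
Variables (k : qalgType) (L : clieType k).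
Implicit Types x y : L.

(* Dynkin's form of the Baker-Campbell-Hausdorff series log(e^x e^y). *)
Definition bch x y : L :=
  lsum (fun n => qscale n%:R^-1 (\sum_(w : n.-tuple bool)
    qscale (logexpexp_coef w)
      (rbracket [seq if b then x else y | b : bool <- w]))).

(* The group exp(L) is represented on L itself by e^x <-> x; a Lie algebra
   morphism acts on it by application. *)
Definition emul x y : L := bch x y.
Definition einv x : L := - x.
Definition eone : L := 0.

End ExpGroup.

Notation "x \*e y" := (emul x y) (at level 40, left associativity) : ring_scope.

(* The coefficients of t / (e^t - 1), i.e. B_n / n!, computed as those of the
   inverse of the power series (e^t - 1) / t = \sum_n t^n / (n+1)!. *)
Fixpoint bern_seq (n : nat) : seq rat :=
  if n is n'.+1 then
    let s := bern_seq n' in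
    rcons s (- \sum_(j < n) nth 0 s j / ((n - j).+1)`!%:R)
  else [:: 1].
Definition bern_coef n : rat := nth 0 (bern_seq n) n.

Lemma size_bern_seq n : size (bern_seq n) = n.+1.
Proof. by elim: n => //= n IH; rewrite size_rcons IH. Qed.

Lemma nth_bern_seq n j : (j <= n)%N -> nth 0 (bern_seq n) j = bern_coef j.
Proof.
elim: n => [|n IH]; first by case: j.
rewrite leq_eqVlt => /orP[/eqP-> //|jn].
by rewrite /= nth_rcons size_bern_seq jn IH.
Qed.

Lemma bern_coefE n :
  \sum_(j < n.+1) bern_coef j / ((n - j).+1)`!%:R = (n == 0%N)%:R.
Proof.
case: n => [|n]; first by rewrite big_ord1.
rewrite big_ord_recr /= subnn divr1 {2}/bern_coef /= nth_rcons size_bern_seq.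
rewrite ltnn eqxx; apply/eqP; rewrite subr_eq0; apply/eqP.
by apply: eq_bigr => j _; rewrite nth_bern_seq // -ltnS.
Qed.

(* (ad x / (e^(ad x) - 1)) (y) *)
Definition ad_bern (k : qalgType) (L : clieType k) (x y : L) : L :=
  lsum (fun n => qscale (bern_coef n) (iter n (ad x) y)).

Inductive no_rel (k : Type) (X : Type) : lterm k X -> Prop := .

Definition f2 (k : qalgType) : clieType k := hat (@no_rel k bool).
Definition fA (k : qalgType) : f2 k := hgen (@no_rel k bool) true.
Definition fB (k : qalgType) : f2 k := hgen (@no_rel k bool) false.

(* All pairs (i, j) are generators, the superfluous t_ii being set to 0. *)
Inductive t_rel (k : qalgType) (n : nat) : lterm k ('I_n * 'I_n) -> Prop :=
| t_rel_diag i : t_rel (LGen (i, i))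
| t_rel_sym i j : i != j ->
    t_rel (LAdd (LGen (i, j)) (LScale (-1) (LGen (j, i))))
| t_rel_3 i j l : uniq [:: i; j; l] ->
    t_rel (LBr (LGen (i, j)) (LAdd (LGen (i, l)) (LGen (j, l))))
| t_rel_4 i j l m : uniq [:: i; j; l; m] ->
    t_rel (LBr (LGen (i, j)) (LGen (l, m))).

Definition tn (k : qalgType) (n : nat) : clieType k := hat (@t_rel k n).
Definition tgen (k : qalgType) n (i j : 'I_n) : tn k n :=
  hgen (@t_rel k n) (i, j).

(* The generators (true, i) and (false, i) are x_i^+ and x_i^-. *)
Inductive te_rel (k : qalgType) (n : nat) : lterm k (bool * 'I_n) -> Prop :=
| te_rel_sum s :
    te_rel (\big[@LAdd k (bool * 'I_n) / LZero]_(i < n) LGen (s, i))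
| te_rel_comm s i j : i != j -> te_rel (LBr (LGen (s, i)) (LGen (s, j)))
| te_rel_sym i j : i != j ->
    te_rel (LAdd (LBr (LGen (true, i)) (LGen (false, j)))
             (LScale (-1) (LBr (LGen (true, j)) (LGen (false, i)))))
| te_rel_3 s i j l : uniq [:: i; j; l] ->
    te_rel (LBr (LGen (s, l)) (LBr (LGen (true, i)) (LGen (false, j)))).

Definition te (k : qalgType) (n : nat) : clieType k := hat (@te_rel k n).
Definition tegen (k : qalgType) n (s : bool) (i : 'I_n) : te k n :=
  hgen (@te_rel k n) (s, i).

(* Indices are 1-based, as in {1,...,n}. *)
Section Numbered.
Variables (k : qalgType) (n : nat).
Definition num (i : nat) : 'I_n.+1 := inord i.-1.
Definition tt_ (i j : nat) : tn k n.+1 := tgen k (num i) (num j).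
Definition x_ (i : nat) : te k n.+1 := tegen k true (num i).
Definition y_ (i : nat) : te k n.+1 := tegen k false (num i).
Definition te_t_ (i j : nat) : te k n.+1 := [l: x_ i, y_ j].
End Numbered.

Arguments tt_ {k n} i j.
Arguments x_ {k n} i.
Arguments y_ {k n} i.
Arguments te_t_ {k n} i j.

(* g(a, b); [hat_lift] and [hat_lift_unique] show that the morphisms picked by
   [xget] below exist and are unique once the images satisfy the relations. *)
Definition f2_subst (k : qalgType) (L : clieType k) (a b : L) : f2 k -> L :=
  xget (fun=> 0) [set f | [/\ clie_morph idfun f, f (fA k) = a & f (fB k) = b]].

(* u(a, b) for u in t_{1,2}, free on x_1 and y_1 *)
Definition te2_subst (k : qalgType) (L : clieType k) (a b : L) : te k 2 -> L :=
  xget (fun=> 0) [set f | [/\ clie_morph idfun f, f (x_ 1) = a & f (y_ 1) = b]].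

(* x |-> x^{I_1,...,I_n}, with I given as a list of lists of 1-based indices;
   e.g. g^{1,23,4} is obtained from [:: [:: 1]; [:: 2; 3]; [:: 4]]. *)
Definition in_block (I : seq (seq nat)) n p (i : 'I_n) (a : 'I_p) : bool :=
  a.+1 \in nth [::] I i.

Definition tn_ins (k : qalgType) (n p : nat) (I : seq (seq nat)) :
    tn k n -> tn k p :=
  xget (fun=> 0) [set f | clie_morph idfun f /\
    forall i j, i != j -> f (tgen k i j) =
      \sum_(a | in_block I i a) \sum_(b | in_block I j b) tgen k a b].

Definition te_ins (k : qalgType) (n p : nat) (I : seq (seq nat)) :
    te k n -> te k p :=
  xget (fun=> 0) [set f | clie_morph idfun f /\
    forall s i, f (tegen k s i) = \sum_(a | in_block I i a) tegen k s a].

Definition tn_te (k : qalgType) (n : nat) : tn k n -> te k n :=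
  xget (fun=> 0) [set f | clie_morph idfun f /\
    forall i j, i != j ->
      f (tgen k i j) = [l: tegen k true i, tegen k false j]].

Definition f2_map (k k' : qalgType) (phi : k -> k') : f2 k -> f2 k' :=
  xget (fun=> 0)
    [set f | [/\ clie_morph phi f, f (fA k) = fA k' & f (fB k) = fB k']].

Definition te_map (k k' : qalgType) (phi : k -> k') n : te k n -> te k' n :=
  xget (fun=> 0) [set f | clie_morph phi f /\
    forall s i, f (tegen k s i) = tegen k' s i].

Definition group_morphism (G H : Type) (A : set G) (mulA : G -> G -> G)
    (B : set H) (mulB : H -> H -> H) (f : G -> H) : Prop :=
  (forall x, A x -> B (f x)) /\
  (forall x y, A x -> A y -> f (mulA x y) = mulB (f x) (f y)).

Record kunit (k : qalgType) := KUnit {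
  uval : k;
  uinv : k;
  uvalK : uval * uinv = 1
}.

Lemma kmul_subproof (k : qalgType) (c d : kunit k) :
  (uval c * uval d) * (uinv c * uinv d) = 1.
Proof. by rewrite mulrACA !uvalK mulr1. Qed.
Definition kmul (k : qalgType) (c d : kunit k) := KUnit (kmul_subproof c d).

Lemma kmap_subproof (k k' : qalgType) (phi : {rmorphism k -> k'})
  (c : kunit k) : phi (uval c) * phi (uinv c) = 1.
Proof. by rewrite -rmorphM uvalK rmorph1. Qed.
Definition kmap (k k' : qalgType) (phi : {rmorphism k -> k'}) (c : kunit k) :=
  KUnit (kmap_subproof phi c).

Section GRT.
Variable k : qalgType.

(* g^{I_1,I_2,I_3} in exp(t_p), through A |-> t_12, B |-> t_23 *)
Definition gt p (I : seq (seq nat)) (g : f2 k) : tn k p :=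
  tn_ins p I (f2_subst (tt_ 1 2 : tn k 3) (tt_ 2 3) g).

Definition GRT1 : set (f2 k) := [set g |
  [/\ gt 3 [:: [:: 3]; [:: 2]; [:: 1]]%N g
        = einv (gt 3 [:: [:: 1]; [:: 2]; [:: 3]]%N g),
      gt 3 [:: [:: 3]; [:: 1]; [:: 2]]%N g \*e gt 3 [:: [:: 2]; [:: 3]; [:: 1]]%N g
        \*e gt 3 [:: [:: 1]; [:: 2]; [:: 3]]%N g = eone _,
      tt_ 1 2 + Ad (einv (gt 3 [:: [:: 1]; [:: 2]; [:: 3]]%N g)) (tt_ 2 3)
        + Ad (einv (gt 3 [:: [:: 2]; [:: 1]; [:: 3]]%N g)) (tt_ 1 3)
        = tt_ 1 2 + tt_ 1 3 + tt_ 2 3 &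
      gt 4 [:: [:: 2]; [:: 3]; [:: 4]]%N g \*e gt 4 [:: [:: 1]; [:: 2; 3]; [:: 4]]%N g
        \*e gt 4 [:: [:: 1]; [:: 2]; [:: 3]]%N g
        = gt 4 [:: [:: 1]; [:: 2]; [:: 3; 4]]%N g
          \*e gt 4 [:: [:: 1; 2]; [:: 3]; [:: 4]]%N g]].

Definition GRT1_mul (g1 g2 : f2 k) : f2 k :=
  f2_subst (Ad g2 (fA k)) (fB k) g1 \*e g2.

Definition GRT1_act (c : kunit k) (g : f2 k) : f2 k :=
  f2_subst (uinv c *: fA k) (uinv c *: fB k) g.

(* elements (g, c) of GRT_1(k) x| k^* *)
Definition GRT : set (f2 k * kunit k) := [set x | GRT1 x.1].

Definition GRT_mul (x y : f2 k * kunit k) : f2 k * kunit k :=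
  (GRT1_mul x.1 (GRT1_act x.2 y.1), kmul x.2 y.2).

Definition GRT_Gm (x : f2 k * kunit k) : kunit k := x.2.

(* triples (g, (u_+, u_-)) *)
Definition ell : Type := (f2 k * (te k 2 * te k 2))%type.

(* g^{I_1,I_2,I_3} in exp(t_{1,3}) *)
Definition ge (I : seq (seq nat)) (g : f2 k) : te k 3 := tn_te (gt 3 I g).
(* u^{I_1,I_2} in t_{1,3} *)
Definition ue (I : seq (seq nat)) (u : te k 2) : te k 3 := te_ins 3 I u.

Definition GRT1ell : set ell := [set e : ell |
  let: (g, (up, um)) := e in
  let ad123 := Ad (einv (ge [:: [:: 1]; [:: 2]; [:: 3]]%N g)) in
  let ad213 := Ad (einv (ge [:: [:: 2]; [:: 1]; [:: 3]]%N g)) in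
  let u1_23 := ue [:: [:: 1]; [:: 2; 3]]%N in
  let u2_13 := ue [:: [:: 2]; [:: 1; 3]]%N in
  let u3_12 := ue [:: [:: 3]; [:: 1; 2]]%N in
  [/\ GRT1 g,
      ad123 (u1_23 up) + ad213 (u2_13 up) + u3_12 up = 0 /\
      ad123 (u1_23 um) + ad213 (u2_13 um) + u3_12 um = 0,
      [l: ad123 (u1_23 up), u3_12 up] = 0 /\
      [l: ad123 (u1_23 um), u3_12 um] = 0 &
      [l: ad123 (u1_23 up), ad213 (u2_13 um)] = te_t_ 1 2]].

Definition GRT1ell_mul (e1 e2 : ell) : ell :=
  (GRT1_mul e1.1 e2.1,
   (te2_subst e2.2.1 e2.2.2 e1.2.1, te2_subst e2.2.1 e2.2.2 e1.2.2)).

Definition GRT1ell_act (c : kunit k) (e : ell) : ell :=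
  (GRT1_act c e.1,
   (te2_subst (x_ 1) (uinv c *: y_ 1) e.2.1,
    uval c *: te2_subst (x_ 1) (uinv c *: y_ 1) e.2.2)).

Definition GRTell : set (ell * kunit k) := [set x | GRT1ell x.1].

Definition GRTell_mul (x y : ell * kunit k) : ell * kunit k :=
  (GRT1ell_mul x.1 (GRT1ell_act x.2 y.1), kmul x.2 y.2).

Definition GRTell_GRT (x : ell * kunit k) : f2 k * kunit k := (x.1.1, x.2).

Definition Gm_GL2 (c : kunit k) : 'M[k]_2 :=
  diag_mx (\row_(j < 2) if j == 0 then 1 else uval c).

(* u = a x_1 + b y_1 modulo brackets: as the generators have degree 1, the
   span of brackets is the part of degree >= 2. *)
Definition lin_part (u : te k 2) (a b : k) : Prop :=
  fil 2%N (u - (a *: x_ 1 + b *: y_ 1)).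

Definition GRT1ell_GL2 (e : ell) : 'M[k]_2 :=
  xget 0 [set M : 'M[k]_2 | lin_part e.2.1 (M 0 0) (M 0 1) /\
                            lin_part e.2.2 (M 1 0) (M 1 1)].

Definition GRTell_GL2 (x : ell * kunit k) : 'M[k]_2 :=
  GRT1ell_GL2 x.1 *m Gm_GL2 x.2.

Definition t0_ (i : nat) : te k 2 := - ad_bern (x_ i) (y_ i).
Definition g012 (g : f2 k) : te k 2 := f2_subst (t0_ 1) (te_t_ 1 2) g.
Definition g021 (g : f2 k) : te k 2 := f2_subst (t0_ 2) (te_t_ 2 1) g.

Definition is_alpha (g : f2 k) (alpha : te k 2 -> te k 2) : Prop :=
  [/\ clie_aut alpha,
      alpha (x_ 1) = g021 g \*e x_ 1 \*e einv (g012 g) &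
      alpha (t0_ 1) = Ad (g012 g) (t0_ 1)].

(* s is a group morphism GRT_1(k) -> GRT_1^ell(k) with
   s(g) = (g, u_+^g, u_-^g). *)
Definition is_section1 (s : f2 k -> ell) : Prop :=
  group_morphism GRT1 GRT1_mul GRT1ell GRT1ell_mul s /\
  (forall g, GRT1 g -> exists2 alpha, unique (is_alpha g) alpha &
     s g = (g, (alpha (x_ 1), alpha (y_ 1)))).

Definition GRT_ext (s : f2 k -> ell) (x : f2 k * kunit k) : ell * kunit k :=
  (s x.1, x.2).

End GRT.

Section BaseChange.
Variables (k k' : qalgType) (phi : {rmorphism k -> k'}).

Definition GRT_map (x : f2 k * kunit k) : f2 k' * kunit k' :=
  (f2_map phi x.1, kmap phi x.2).

Definition GRTell_map (x : ell k * kunit k) : ell k' * kunit k' :=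
  ((f2_map phi x.1.1, (te_map phi x.1.2.1, te_map phi x.1.2.2)),
   kmap phi x.2).

End BaseChange.

(* Main.v *)
(** Put [b(s) = s / (e^s - 1)], [t_0i = - b(ad x_i)(y_i)].  In terms of the
    [x_i], [t_0i], [t_ij] the relations of [t_{1,3}] say that the [x_i] commute
    and have sum 0, that [t_0i], [t_ij] are an infinitesimal braid family on the
    strands 0, 1, 2, 3 with sum 0, and that [Ad(e^{-x_i})(t_0j) = t_0j + t_ij].
    The step that is not formal is [[t_0i, t_0j + t_ij] = [y_i, y_j]], which
    amounts to a quadratic addition formula for the Bernoulli series [b].
    Conjugating such a family by the associators [g^{0,i,jl}], [g^{0,jl,i}] and
    [g^{j,l,i}] produces, by the pentagon and hexagon equations, a family
    with the same properties; translated back, this is the system of equations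
    defining [GRT_1^ell].

    The map [alpha_g] is an automorphism because it is unipotent ([g] has no
    linear term), and [g |-> alpha_g] is multiplicative because [alpha_g] fixes
    [t_12], so that [alpha_{g1 * g2}] and [alpha_{g2} o alpha_{g1}] agree on
    [x_1] and [t_01].

    The group laws of the Baker-Campbell-Hausdorff series are checked on
    noncommutative power series, into which the free Lie algebra embeds by the
    Dynkin-Specht-Wever theorem. *)

Require Import Defs.
From HB Require Import structures.
From mathcomp Require Import all_boot all_order all_algebra.
From mathcomp Require Import boolp classical_sets.
From mathcomp Require Import ring lra zify.

Set Implicit Arguments.
Unset Strict Implicit.
Unset Printing Implicit Defensive.

Import GRing.Theory.
Local Open Scope classical_set_scope.
Local Open Scope ring_scope.

(** The ring [k] may have zero divisors or even be zero, so nothing is cancelled in it. Identities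
    with denominators are proved over [rat], or over a domain of polynomials in two variables which
    then acts on the Lie algebra through two commuting operators [ad]. Each relation of the twisted
    family is simple only after a conjugation that depends on one strand. The images of the x_i are
    therefore kept in three frames, one for each strand: the hexagon is the cocycle condition
    between frames, the pentagon simplifies products inside a frame, and each relation is checked in
    the frame where it is shortest. That g has no linear term follows from the pentagon in an
    abelian Lie algebra of rank one. Besides unipotence it serves to compute alpha_g(x_1)^{i,jl}:
    there t_02 becomes t_0j + t_0l + t_jl, and the extra t_jl must be dropped to obtain g^{0,jl,i}.
    The uniqueness claim is immediate, since a morphism of Lie algebras is known from x_1 and t_01;
    the work lies in showing that the values satisfy the equations. *)

Inductive zexp :=
  ZVar of nat | ZZero | ZAdd of zexp & zexp | ZOpp of zexp | ZMul of zexp & nat.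

Section Zexp.
Variables (M : zmodType) (env : seq M).

Fixpoint zeval (e : zexp) : M :=
  match e with
  | ZVar i => nth 0 env i
  | ZZero => 0
  | ZAdd a b => zeval a + zeval b
  | ZOpp a => - zeval a
  | ZMul a n => zeval a *+ n
  end.

Fixpoint zcoef (e : zexp) (i : nat) : int :=
  match e with
  | ZVar j => if i == j then 1 else 0
  | ZZero => 0
  | ZAdd a b => zcoef a i + zcoef b i
  | ZOpp a => - zcoef a i
  | ZMul a n => zcoef a i *+ n
  end.

Lemma zevalE e : zeval e = \sum_(i < size env) nth 0 env i *~ zcoef e i.
Proof.
elim: e => [j||a IHa b IHb|a IHa|a IHa n] /=.
- case: (ltnP j (size env)) => [lt|ge].
    rewrite (bigD1 (Ordinal lt)) //= eqxx mulr1z big1 ?addr0 // => i.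
    by rewrite -val_eqE /= => /negPf ->; rewrite mulr0z.
  rewrite nth_default // big1 // => i _; case: eqP => [ij|_]; last by rewrite mulr0z.
  by have := ltn_ord i; rewrite ij ltnNge ge.
- by rewrite big1 // => i _; rewrite mulr0z.
- by rewrite IHa IHb -big_split; apply: eq_bigr => i _; rewrite /= mulrzDr.
- by rewrite IHa -sumrN; apply: eq_bigr => i _; rewrite mulrNz.
- by rewrite IHa -sumrMnl; apply: eq_bigr => i _; rewrite pmulrn -mulrzA -[in RHS]mulr_natr natz.
Qed.

(** Proof by reflection: both sides are integer combinations of the atoms in [env], and the
    comparison of the coefficients is settled by computation. *)
Lemma zexpP a b :
  all (fun i => zcoef a i == zcoef b i) (iota 0 (size env)) ->
  zeval a = zeval b.
Proof.
move=> /allP h; rewrite !zevalE; apply: eq_bigr => i _.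
by have /eqP -> : zcoef a i == zcoef b i by apply: h; rewrite mem_iota /= add0n.
Qed.
End Zexp.

Ltac zm_index x l :=
  match l with
  | x :: _ => constr:(0%N)
  | ?y :: _ => let _ := match goal with _ => unify x y end in constr:(0%N)
  | _ :: ?l' => let n := zm_index x l' in constr:(S n)
  end.
Ltac zm_add x l :=
  match l with
  | _ => let n := zm_index x l in l
  | _ => constr:(x :: l)
  end.
Ltac zm_atoms e l :=
  lazymatch e with
  | @GRing.add _ ?a ?b => let l1 := zm_atoms a l in zm_atoms b l1
  | @GRing.opp _ ?a => zm_atoms a l
  | @GRing.natmul _ ?a ?n => zm_atoms a l
  | @GRing.zero _ => l
  | _ => zm_add e l
  end.
Ltac zm_reify e l :=
  lazymatch e with
  | @GRing.add _ ?a ?b =>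
      let a' := zm_reify a l in let b' := zm_reify b l in constr:(ZAdd a' b')
  | @GRing.opp _ ?a => let a' := zm_reify a l in constr:(ZOpp a')
  | @GRing.natmul _ ?a ?n => let a' := zm_reify a l in constr:(ZMul a' n)
  | @GRing.zero _ => constr:(ZZero)
  | _ => let n := zm_index e l in constr:(ZVar n)
  end.
(* Decides identities in abelian groups. *)
Ltac zmod :=
  lazymatch goal with
  | |- @eq ?T ?a ?b =>
    let l0 := constr:(@nil T) in
    let l1 := zm_atoms a l0 in let l := zm_atoms b l1 in
    let a' := zm_reify a l in let b' := zm_reify b l in
    exact: (@zexpP _ l a' b' isT)
  end.

(** * Complete Lie algebras and series of operators *)

Section LieBasics.
Variables (k : qalgType) (L : clieType k).
Implicit Types (x y z : L) (p q : rat).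

Lemma lbr0r x : [l: x, 0] = 0.
Proof. by have := lbrZr (0 : k) x 0; rewrite !scale0r. Qed.
Lemma lbrNl x y : [l: - x, y] = - [l: x, y].
Proof. by rewrite -scaleN1r lbrZl scaleN1r. Qed.
Lemma lbrNr x y : [l: x, - y] = - [l: x, y].
Proof. by rewrite -scaleN1r lbrZr scaleN1r. Qed.
Lemma lbrBl x y z : [l: x - y, z] = [l: x, z] - [l: y, z].
Proof. by rewrite lbrDl lbrNl. Qed.
Lemma lbrBr x y z : [l: x, y - z] = [l: x, y] - [l: x, z].
Proof. by rewrite lbrDr lbrNr. Qed.
Lemma lbrC x y : [l: x, y] = - [l: y, x].
Proof.
have := lbrxx (x + y); rewrite lbrDl !lbrDr !lbrxx add0r addr0.
by move/eqP; rewrite addr_eq0 => /eqP.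
Qed.
Lemma lbr_suml I (r : seq I) (P : pred I) (F : I -> L) y :
  [l: \sum_(i <- r | P i) F i, y] = \sum_(i <- r | P i) [l: F i, y].
Proof.
by elim/big_rec2: _ => [|i u v _ <-]; rewrite ?lbr0 ?lbrDl.
Qed.
Lemma lbr_sumr I (r : seq I) (P : pred I) (F : I -> L) x :
  [l: x, \sum_(i <- r | P i) F i] = \sum_(i <- r | P i) [l: x, F i].
Proof.
by elim/big_rec2: _ => [|i u v _ <-]; rewrite ?lbr0r ?lbrDr.
Qed.
Lemma lbr_leibniz x y z : [l: x, [l: y, z]] = [l: [l: x, y], z] + [l: y, [l: x, z]].
Proof.
have := jacobi x y z; rewrite (lbrC z [l: x, y]) (lbrC z x) lbrNr => h.
apply/eqP; rewrite -subr_eq0; apply/eqP; rewrite -[RHS]h; zmod.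
Qed.
Lemma lbr_leibnizl x y z : [l: [l: x, y], z] = [l: x, [l: y, z]] - [l: y, [l: x, z]].
Proof. by rewrite lbr_leibniz addrK. Qed.

Lemma fil_any n x : (n <= 1)%N -> fil n x.
Proof. by move=> n1; apply: fil_le n1 (fil_1 x). Qed.
Lemma fil_sum n I (r : seq I) (P : pred I) (F : I -> L) :
  (forall i, P i -> fil n (F i)) -> fil n (\sum_(i <- r | P i) F i).
Proof.
by move=> h; elim/big_ind: _ => //; [apply: fil_0|move=> *; apply: fil_D].
Qed.
Lemma fil_lbrr n x y : fil n y -> fil n.+1 [l: x, y].
Proof. by move=> h; rewrite -add1n; apply: fil_lbr h; apply: fil_1. Qed.
Lemma fil_lbrl n x y : fil n x -> fil n.+1 [l: x, y].
Proof. by move=> h; rewrite -addn1; apply: fil_lbr h _; apply: fil_1. Qed.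
Lemma fil_subC n x y : fil n (x - y) -> fil n (y - x).
Proof. by rewrite -opprB => /fil_N; rewrite opprK. Qed.
Lemma fil_sub_congr n x y : fil n (x - y) -> fil n y -> fil n x.
Proof. by move=> h hy; rewrite -[x](subrK y); apply: fil_D. Qed.

Lemma qscaleDl p q x : qscale (p + q) x = qscale p x + qscale q x.
Proof. by rewrite /qscale rmorphD scalerDl. Qed.
Lemma qscaleDr p x y : qscale p (x + y) = qscale p x + qscale p y.
Proof. by rewrite /qscale scalerDr. Qed.
Lemma qscaleA p q x : qscale p (qscale q x) = qscale (p * q) x.
Proof. by rewrite /qscale scalerA rmorphM. Qed.
Lemma qscale1 x : qscale 1 x = x.
Proof. by rewrite /qscale rmorph1 scale1r. Qed.
Lemma qscale0 x : qscale 0 x = 0.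
Proof. by rewrite /qscale rmorph0 scale0r. Qed.
Lemma qscaler0 p : qscale p (0 : L) = 0.
Proof. by rewrite /qscale scaler0. Qed.
Lemma qscaleNl p x : qscale (- p) x = - qscale p x.
Proof. by rewrite /qscale rmorphN scaleNr. Qed.
Lemma qscaleNr p x : qscale p (- x) = - qscale p x.
Proof. by rewrite /qscale scalerN. Qed.
Lemma qscaleBr p x y : qscale p (x - y) = qscale p x - qscale p y.
Proof. by rewrite qscaleDr qscaleNr. Qed.
Lemma qscale_nat n x : qscale n%:R x = x *+ n.
Proof. by rewrite /qscale rmorph_nat scaler_nat. Qed.
Lemma qscale_sumr I (r : seq I) (P : pred I) (F : I -> L) p :
  qscale p (\sum_(i <- r | P i) F i) = \sum_(i <- r | P i) qscale p (F i).
Proof. by rewrite /qscale scaler_sumr. Qed.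
Lemma lbr_qscalel p x y : [l: qscale p x, y] = qscale p [l: x, y].
Proof. exact: lbrZl. Qed.
Lemma lbr_qscaler p x y : [l: x, qscale p y] = qscale p [l: x, y].
Proof. exact: lbrZr. Qed.
Lemma fil_qscale n p x : fil n x -> fil n (qscale p x).
Proof. exact: fil_Z. Qed.
Lemma fil_natmul n m x : fil n (x *+ m.+1) -> fil n x.
Proof.
move=> /(fil_qscale m.+1%:R^-1); rewrite -qscale_nat qscaleA mulVf ?qscale1 //.
by rewrite Num.Theory.pnatr_eq0.
Qed.

(** [lsum] chooses some limit of the partial sums. Completeness provides one and separatedness makes
    it unique, so the choice can be identified. *)
Lemma lsumP (f : nat -> L) : (forall n, fil n (f n)) ->
  forall n m, (n <= m)%N -> fil n (lsum f - \sum_(i < m) f i).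
Proof.
move=> hf.
have [x hx] : exists x, forall n, fil n (x - \sum_(i < n) f i).
  by apply: fil_complete => n; rewrite big_ord_recr /= addrAC subrr add0r.
have hx' n m : (n <= m)%N -> fil n (x - \sum_(i < m) f i).
  by move=> nm; apply: fil_le nm (hx m).
suff -> : lsum f = x by [].
rewrite /lsum; case: xgetP => [S _ hS|/(_ x) /=]; last first.
  by case=> n; exists n => m; apply: hx'.
apply: fil_eq => n; have [m0 h0] := hS n.
apply: (@fil_tri _ _ _ _ (\sum_(i < maxn m0 n) f i)).
  by apply: h0; apply: leq_maxl.
by apply/fil_subC/hx'; apply: leq_maxr.
Qed.

Lemma lsum_unique (f : nat -> L) S : (forall n, fil n (f n)) ->
  (forall n, fil n (S - \sum_(i < n) f i)) -> lsum f = S.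
Proof.
move=> hf hS; apply: fil_eq => n; apply: fil_tri (lsumP hf (leqnn n)) _.
exact/fil_subC.
Qed.

Lemma lsumD (f g : nat -> L) : (forall n, fil n (f n)) -> (forall n, fil n (g n)) ->
  lsum (fun n => f n + g n) = lsum f + lsum g.
Proof.
move=> hf hg; apply: lsum_unique => n; first exact: fil_D.
rewrite big_split opprD addrACA; apply: fil_D; exact: lsumP.
Qed.

Lemma fil_lsum (f : nat -> L) m : (forall n, fil n (f n)) ->
  (forall n, fil m (f n)) -> fil m (lsum f).
Proof.
by move=> hf hm; apply: fil_sub_congr (lsumP hf (leqnn m)) _; apply: fil_sum.
Qed.

Lemma lsum_recl (f : nat -> L) : (forall n, fil n (f n)) ->
  (forall n, fil n (f n.+1)) ->
  lsum f = f 0%N + lsum (fun n => f n.+1).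
Proof.
move=> hf hf'; apply: lsum_unique => // -[|n]; first by apply: fil_any.
rewrite big_ord_recl /= opprD addrACA subrr add0r.
rewrite -[X in X - _](subrK (\sum_(i < n.+1) f i.+1)) -addrA.
apply: fil_D; first exact: lsumP.
by rewrite big_ord_recr /= addrAC subrr add0r.
Qed.
End LieBasics.

(** Images of integers agree, and a denominator stays invertible in every target; this replaces
    cancellation, as R may have zero divisors. It makes every semilinear morphism commute with
    rational scalars. *)
Lemma rat_rmorph_unique (R : comPzRingType) (f g : {rmorphism rat -> R}) : f =1 g.
Proof.
move=> q; pose d : rat := (denq q)%:~R.
have dq : d * d^-1 = 1 by rewrite divff // intr_eq0 denq_neq0.
have qd : q * d = (numq q)%:~R.
  by rewrite -[q in LHS]divq_num_den mulfVK // intr_eq0 denq_neq0.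
have fg (n : int) : f n%:~R = g n%:~R by rewrite !rmorph_int.
rewrite -[q]mulr1 -dq mulrA qd [in LHS]rmorphM fg [in RHS]rmorphM; congr (_ * _).
have fgd : f d = g d by apply: fg.
rewrite -[LHS]mulr1 -(rmorph1 g) -dq rmorphM mulrA -fgd -rmorphM mulrC.
by rewrite [d^-1 * d]mulrC dq rmorph1 mulr1.
Qed.

(** * Polynomials and power series in one operator *)

Section PolyAct.
Variables (S : comNzRingType) (V : zmodType) (act : S -> V -> V) (D : V -> V).
Hypotheses (actDl : forall p q x, act (p + q) x = act p x + act q x).
Hypotheses (actDr : forall p x y, act p (x + y) = act p x + act p y).
Hypotheses (actM : forall p q x, act (p * q) x = act p (act q x)).
Hypothesis act1 : forall x, act 1 x = x.
Hypothesis D_add : {morph D : x y / x + y}.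
Hypothesis D_act : forall p x, D (act p x) = act p (D x).

Implicit Types (p q : {poly S}) (x y : V).

(** The scalar action is a plain function, so that the construction can be iterated: [pad] below
    feeds [pact] back into it and obtains an action of polynomials in two variables. *)
Definition pact (p : {poly S}) (x : V) : V :=
  \sum_(i < size p) act p`_i (iter i D x).

Lemma pact_act0 x : act 0 x = 0.
Proof. by apply: (addrI (act 0 x)); rewrite -actDl !addr0. Qed.

Lemma pact_iterD i : {morph iter i D : x y / x + y}.
Proof. by elim: i => // i IH x y; rewrite /= IH D_add. Qed.

Lemma pact_widen N p x : (size p <= N)%N ->
  pact p x = \sum_(i < N) act p`_i (iter i D x).
Proof.
move=> pN; rewrite /pact (big_ord_widen N (fun i => act p`_i (iter i D x))) //.
rewrite big_mkcond; apply: eq_bigr => i _; case: ifP => // /negbT.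
by rewrite -leqNgt => h; rewrite nth_default // pact_act0.
Qed.

Lemma pactDl p q x : pact (p + q) x = pact p x + pact q x.
Proof.
pose N := maxn (size p) (size q).
rewrite !(@pact_widen N) ?leq_maxl ?leq_maxr ?size_polyD // -big_split.
by apply: eq_bigr => i _; rewrite coefD actDl.
Qed.

Lemma pactDr p x y : pact p (x + y) = pact p x + pact p y.
Proof.
by rewrite -big_split; apply: eq_bigr => i _; rewrite pact_iterD actDr.
Qed.

Lemma pactC c x : pact c%:P x = act c x.
Proof. by rewrite (@pact_widen 1) ?size_polyC ?leq_b1 // big_ord1 coefC. Qed.

Lemma pactMX p x : pact (p * 'X) x = pact p (D x).
Proof.
rewrite (@pact_widen (size p).+1); last first.
  by apply: leq_trans (size_polyMleq _ _) _; rewrite size_polyX addn2.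
rewrite big_ord_recl coefMX eqxx pact_act0 add0r.
by apply: eq_bigr => i _; rewrite coefMX /= -iterSr.
Qed.

Lemma D_pact p x : D (pact p x) = pact p (D x).
Proof.
have D0 : D 0 = 0 by apply: (addrI (D 0)); rewrite -D_add !addr0.
rewrite /pact (big_morph _ D_add D0); apply: eq_bigr => i _.
by rewrite D_act -iterSr.
Qed.

Lemma pactM p q x : pact (p * q) x = pact p (pact q x).
Proof.
elim/poly_ind: p x => [|p c IH] x.
  by rewrite mul0r /pact size_poly0 !big_ord0.
rewrite mulrDl -mulrA (mulrC 'X) mulrA !pactDl !pactMX IH D_pact; congr (_ + _).
elim/poly_ind: q x {IH} => [|q d IH] x.
  rewrite mulr0 /pact size_poly0 !big_ord0.
  have := pactDr c%:P 0 0; rewrite addr0 => h.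
  by symmetry; apply: (addrI (pact c%:P 0)); rewrite addr0 -{1}h.
rewrite mulrDr mulrA !pactDl !pactMX IH pactDr; congr (_ + _).
by rewrite -polyCM !pactC actM.
Qed.

Lemma pact1 x : pact 1 x = x.
Proof. by rewrite -[1]/(1%:P) pactC act1. Qed.

Lemma pactX x : pact 'X x = D x.
Proof. by rewrite -['X]mul1r pactMX pact1. Qed.

End PolyAct.

(** Raising the filtration makes every power series in D converge. Linearity over [rat] suffices
    because all series have rational coefficients. *)
Definition nilop (k : qalgType) (L : clieType k) (D : L -> L) : Prop :=
  [/\ {morph D : x y / x + y}, forall q x, D (qscale q x) = qscale q (D x) &
      forall n x, fil n x -> fil n.+1 (D x)].

Definition oser (k : qalgType) (L : clieType k) (c : nat -> rat) (D : L -> L)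
  (y : L) : L := lsum (fun n => qscale (c n) (iter n D y)).

Definition cauchy (c d : nat -> rat) (n : nat) : rat :=
  \sum_(j < n.+1) c j * d (n - j)%N.

Section Oser.
Variables (k : qalgType) (L : clieType k) (D : L -> L).
Hypothesis nD : nilop D.
Implicit Types (x y : L) (c d : nat -> rat) (p q : {poly rat}).

Local Notation pactL := (pact (@qscale k L) D).

Let D_add : {morph D : x y / x + y}. Proof. by case: nD. Qed.
Let D_q (q : rat) x : D (qscale q x) = qscale q (D x). Proof. by case: nD. Qed.
Let D_fil n x : fil n x -> fil n.+1 (D x). Proof. by case: nD => _ _; apply. Qed.

Lemma nilop_iter n m x : fil m x -> fil (n + m)%N (iter n D x).
Proof. by move=> h; elim: n => //= n IH; rewrite addSn; apply: D_fil. Qed.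

Lemma nilop_iter_qscale n (q : rat) x : iter n D (qscale q x) = qscale q (iter n D x).
Proof. by elim: n => //= n ->. Qed.

Lemma nilop0 : D 0 = 0.
Proof. by apply: (addrI (D 0)); rewrite -D_add !addr0. Qed.

Lemma nilopN x : D (- x) = - D x.
Proof. by apply/eqP; rewrite -subr_eq0 opprK -D_add addNr nilop0. Qed.

Lemma oser_fil c y n : fil n (qscale (c n) (iter n D y)).
Proof.
apply: fil_qscale; apply: (@fil_le _ _ _ (n + 1)); first by rewrite addn1.
by apply: nilop_iter; apply: fil_1.
Qed.
Hint Resolve oser_fil : core.

Definition trunc N c : {poly rat} := \poly_(i < N) c i.

Lemma oserE N c y : fil N (oser c D y - pactL (trunc N c) y).
Proof.
rewrite (@pact_widen _ _ _ D (@qscaleDl k L) N) ?size_poly //.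
have -> : \sum_(i < N) qscale (trunc N c)`_i (iter i D y)
    = \sum_(i < N) qscale (c i) (iter i D y).
  by apply: eq_bigr => i _; rewrite coef_poly ltn_ord.
exact: lsumP.
Qed.

Lemma fil_pact N m p y : (forall i, (i < N)%N -> p`_i = 0) -> fil m y ->
  fil (N + m)%N (pactL p y).
Proof.
move=> h hy; apply: fil_sum => i _; case: (ltnP i N) => [iN|Ni].
  by rewrite h // qscale0; apply: fil_0.
apply: fil_qscale; apply: (@fil_le _ _ _ (i + m)); first by rewrite leq_add2r.
exact: nilop_iter.
Qed.

Lemma pactLB p q x : pactL (p - q) x = pactL p x - pactL q x.
Proof.
have pDl := @pactDl _ _ _ D (@qscaleDl k L).
by apply: (addIr (pactL q x)); rewrite -pDl !subrK.
Qed.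

Lemma pactLBr p x y : pactL p (x - y) = pactL p x - pactL p y.
Proof.
have pDr := @pactDr _ _ _ D (@qscaleDr k L) D_add.
by apply: (addIr (pactL p y)); rewrite -pDr !subrK.
Qed.

Lemma pact_congr N p q y : (forall i, (i < N)%N -> p`_i = q`_i) ->
  fil N (pactL p y - pactL q y).
Proof.
move=> h; rewrite -pactLB; apply: (@fil_le _ _ _ (N + 1)); first exact: leq_addr.
apply: fil_pact; last exact: fil_1.
by move=> i iN; rewrite coefB h // subrr.
Qed.

(** Modulo F^N each series may be replaced by its truncation, for which composition is the product
    of polynomials. *)
Lemma oserM c d y : oser c D (oser d D y) = oser (cauchy c d) D y.
Proof.
apply: fil_eq => N; apply: fil_tri (oserE N c _) _.
apply: (@fil_tri _ _ _ _ (pactL (trunc N c) (pactL (trunc N d) y))).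
  rewrite -pactLBr; apply: (@fil_pact 0 N) => //; exact: oserE.
rewrite -(@pactM _ _ _ D (@qscaleDl k L) (@qscaleDr k L)) //; last first.
  by move=> *; rewrite qscaleA.
apply: fil_tri (fil_subC (oserE N _ y)).
apply: pact_congr => i iN; rewrite coefM coef_poly iN; apply: eq_bigr => j _.
rewrite !coef_poly (leq_ltn_trans _ iN) ?leq_ord //.
by rewrite (leq_ltn_trans (leq_subr _ _) iN).
Qed.

Lemma oserDr c x y : oser c D (x + y) = oser c D x + oser c D y.
Proof.
rewrite -lsumD //; congr lsum; apply/funext => n.
by rewrite (pact_iterD D_add) qscaleDr.
Qed.

Lemma oser0 c : oser c D 0 = 0.
Proof. by apply: (addrI (oser c D 0)); rewrite -oserDr !addr0. Qed.

Lemma oserN c x : oser c D (- x) = - oser c D x.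
Proof. by apply/eqP; rewrite -subr_eq0 opprK -oserDr addNr oser0. Qed.

Lemma oserB c x y : oser c D (x - y) = oser c D x - oser c D y.
Proof. by rewrite oserDr oserN. Qed.

Lemma oserDl c d y : oser (fun n => c n + d n) D y = oser c D y + oser d D y.
Proof.
rewrite -lsumD //; congr lsum; apply/funext => n.
by rewrite qscaleDl.
Qed.

Lemma fil_oser c m y : fil m y -> fil m (oser c D y).
Proof.
move=> h; apply: fil_lsum => // n; apply: fil_qscale.
by apply: (@fil_le _ _ _ (n + m)); [apply: leq_addl|apply: nilop_iter].
Qed.

Lemma oser_recl c y : oser c D y = qscale (c 0%N) y + oser (fun n => c n.+1) D (D y).
Proof.
rewrite /oser lsum_recl //.
  by congr (_ + lsum _); apply/funext => n; rewrite iterSr.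
by move=> n; apply: (@fil_le _ _ _ n.+1).
Qed.

Lemma oser_delta y : oser (fun n => (n == 0%N)%:R) D y = y.
Proof.
rewrite oser_recl qscale1; apply/eqP; rewrite addrC -subr_eq0 addrK; apply/eqP.
apply: lsum_unique => n; first by rewrite qscale0; apply: fil_0.
rewrite big1 ?subr0; first exact: fil_0.
by move=> i _; rewrite qscale0.
Qed.

End Oser.

Section LsumMorph.
Variables (k k' : qalgType) (L : clieType k) (L' : clieType k') (f : L -> L').
Hypothesis fD : {morph f : x y / x + y}.
Hypothesis fc : forall n, exists m, forall x, fil m x -> fil n (f x).

(** Continuity of f gives no rate of convergence; the second hypothesis puts the n-th term of the
    image series in F^n, which is what [lsum] expects. *)
Lemma lsum_morph (u : nat -> L) : (forall n, fil n (u n)) ->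
  (forall n, fil n (f (u n))) -> f (lsum u) = lsum (fun n => f (u n)).
Proof.
have f0 : f 0 = 0 by apply: (addrI (f 0)); rewrite -fD !addr0.
move=> hu hfu; symmetry; apply: lsum_unique => // n; have [m hm] := fc n.
have fB x y : f (x - y) = f x - f y by apply: (addIr (f y)); rewrite -fD !subrK.
rewrite -(big_morph f fD f0) -fB.
rewrite -[lsum u](subrK (\sum_(i < maxn m n) u i)) -addrA fD; apply: fil_D.
  by apply: hm; apply: lsumP => //; apply: leq_maxl.
rewrite -(subnKC (leq_maxr m n)) big_split_ord /= addrAC subrr add0r.
rewrite (big_morph f fD f0); apply: fil_sum => i _.
by apply: fil_le (hfu _); apply: leq_addr.
Qed.
End LsumMorph.

Lemma lsum_morph_oser (k : qalgType) (L : clieType k) (D : L -> L)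
  (k' : qalgType) (L' : clieType k') (D' : L' -> L') (f : L -> L') c y :
  nilop D -> nilop D' -> {morph f : x y / x + y} ->
  (forall q x, f (qscale q x) = qscale q (f x)) ->
  (forall n, exists m, forall x, fil m x -> fil n (f x)) ->
  (forall x, f (D x) = D' (f x)) ->
  f (oser c D y) = oser c D' (f y).
Proof.
move=> nD nD' fD fq fc fDD'.
have fi n x : f (iter n D x) = iter n D' (f x) by elim: n => //= n <-.
rewrite /oser lsum_morph //.
- by congr lsum; apply/funext => n; rewrite fq fi.
- exact: oser_fil.
- by move=> n; rewrite fq fi; apply: oser_fil.
Qed.

Lemma oser_comm (k : qalgType) (L : clieType k) (D E : L -> L) c y :
  nilop D -> nilop E -> (forall x, E (D x) = D (E x)) ->
  E (oser c D y) = oser c D (E y).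
Proof.
move=> nD nE; have [ED Eq Ef] := nE; apply: lsum_morph_oser => //.
by move=> n; exists n => x /Ef; apply: fil_le.
Qed.

Lemma clie_qscale (k k' : qalgType) (phi : {rmorphism k -> k'}) (L : clieType k)
  (L' : clieType k') (f : L -> L') :
  clie_morph phi f -> forall q x, f (qscale q x) = qscale q (f x).
Proof.
move=> [_ fZ _ _] q x; rewrite /qscale fZ; congr (_ *: _).
exact: (rat_rmorph_unique (phi \o ofQ) ofQ).
Qed.

Section Ad.
Variables (k : qalgType) (L : clieType k).
Implicit Types (x y z : L).

Lemma nilop_ad x : nilop (ad x).
Proof.
split=> [y z|q y|n y h]; rewrite /ad.
- exact: lbrDr.
- exact: lbr_qscaler.
- exact: fil_lbrr.
Qed.

Definition exp_coef (n : nat) : rat := n`!%:R^-1.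
(** These are the coefficients of (e^s - 1)/s, the inverse of b(s) = s/(e^s - 1); those of
    [bernT_coef] belong to h(s) = (b(s) - 1)/s. *)
Definition eps_coef (n : nat) : rat := (n.+1)`!%:R^-1.
Definition bernT_coef (n : nat) : rat := bern_coef n.+1.

Lemma AdE x y : Ad x y = oser exp_coef (ad x) y. Proof. by []. Qed.
Lemma ad_bernE x y : ad_bern x y = oser bern_coef (ad x) y. Proof. by []. Qed.

Lemma cauchyC c d : cauchy c d = cauchy d c.
Proof.
apply/funext => n; rewrite /cauchy (reindex_inj rev_ord_inj) /=.
by apply: eq_bigr => i _; rewrite subSS subKn ?leq_ord // mulrC.
Qed.

Lemma bern_eps : cauchy bern_coef eps_coef = (fun n => (n == 0%N)%:R).
Proof. by apply/funext => n; rewrite -bern_coefE. Qed.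

Section OpSeries.
Variables (D : L -> L) (nD : nilop D).

Lemma oser_bern_eps y : oser bern_coef D (oser eps_coef D y) = y.
Proof. by rewrite oserM // bern_eps oser_delta. Qed.
Lemma oser_eps_bern y : oser eps_coef D (oser bern_coef D y) = y.
Proof. by rewrite oserM // cauchyC bern_eps oser_delta. Qed.
Lemma oser_exp y : oser exp_coef D y = y + D (oser eps_coef D y).
Proof.
rewrite oser_recl // (oser_comm _ _ nD nD) // /exp_coef fact0 invr1 qscale1.
by [].
Qed.
Lemma oser_bern y : oser bern_coef D y = y + D (oser bernT_coef D y).
Proof.
by rewrite oser_recl // (oser_comm _ _ nD nD) // [bern_coef 0]/(1 : rat) qscale1.
Qed.

(** e^D - 1 is D composed with the series [eps_coef] in D, and the latter is invertible. *)
Lemma oser_exp_fix y : oser exp_coef D y = y -> D y = 0.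
Proof.
rewrite oser_exp => /eqP; rewrite addrC -subr_eq0 addrK => /eqP h.
rewrite -[D y]oser_bern_eps -(oser_comm _ _ nD nD) // h; exact: oser0.
Qed.
End OpSeries.
End Ad.

(** * Identities of power series modulo X^N: exponential and logarithm *)

Definition peq (R : nzSemiRingType) (N : nat) (p q : {poly R}) : Prop :=
  forall i, (i < N)%N -> p`_i = q`_i.

Section Peq.
Variables (R : comNzRingType).
Implicit Types (p q r : {poly R}).

Lemma peq_refl N p : peq N p p. Proof. by []. Qed.
Lemma peq_sym N p q : peq N p q -> peq N q p.
Proof. by move=> h i /h. Qed.
Lemma peq_trans N q p r : peq N p q -> peq N q r -> peq N p r.
Proof. by move=> h1 h2 i iN; rewrite h1 // h2. Qed.
Lemma peqD N p p' q q' : peq N p p' -> peq N q q' -> peq N (p + q) (p' + q').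
Proof. by move=> h1 h2 i iN; rewrite !coefD h1 // h2. Qed.
Lemma peqN N p p' : peq N p p' -> peq N (- p) (- p').
Proof. by move=> h1 i iN; rewrite !coefN h1. Qed.
Lemma peqM N p p' q q' : peq N p p' -> peq N q q' -> peq N (p * q) (p' * q').
Proof.
move=> h1 h2 i iN; rewrite !coefM; apply: eq_bigr => j _.
by rewrite h1 ?h2 // (leq_ltn_trans _ iN) ?leq_ord ?leq_subr.
Qed.
Lemma peq_exp0 N p : p`_0 = 0 -> peq N (p ^+ N) 0.
Proof.
move=> p0 i iN; rewrite coef0.
have -> : p = \poly_(j < (size p).-1) p`_j.+1 * 'X.
  apply/polyP => -[|j]; rewrite coefMX ?p0 //= coef_poly.
  by case: ltnP => // h; rewrite nth_default // (leq_trans (leqSpred _)).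
by rewrite exprMn coefMXn iN.
Qed.
Lemma peq_sub_exp0 N p : p`_0 = 0 -> peq N (1 - p ^+ N) 1.
Proof. by move=> p0 i iN; rewrite coefB (peq_exp0 p0 iN) coef0 subr0. Qed.
Lemma peq_comp0 N p q r : peq N p q -> r`_0 = 0 -> peq N (p \Po r) (q \Po r).
Proof.
move=> h r0 i iN; apply/eqP; rewrite -subr_eq0 -coefB -comp_polyB; apply/eqP.
have pq j : (j < N)%N -> (p - q)`_j = 0 by move=> jN; rewrite coefB h // subrr.
rewrite comp_polyE coef_sum big1 // => j _; rewrite coefZ.
case: (ltnP j N) => jN; first by rewrite pq // mul0r.
by rewrite (@peq_exp0 j r r0) ?coef0 ?mulr0 // (leq_trans iN).
Qed.
End Peq.

Definition log_coef (n : nat) : rat := if n is m.+1 then (-1) ^+ m / m.+1%:R else 0.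

Section LogExp.
Variable N : nat.
Local Notation E := (trunc N.+1 exp_coef).
Local Notation Lg := (trunc N.+1 log_coef).

Lemma natr_rat_neq0 n : (n.+1%:R : rat) != 0.
Proof. by rewrite Num.Theory.pnatr_eq0. Qed.

Lemma exp_coef0 : exp_coef 0 = 1.
Proof. by rewrite /exp_coef fact0 invr1. Qed.

Lemma exp_coefS n : exp_coef n.+1 *+ n.+1 = exp_coef n.
Proof.
by rewrite -mulr_natr /exp_coef factS natrM invfM mulrAC mulVf ?natr_rat_neq0 ?mul1r.
Qed.

Lemma expP_deriv : peq N E^`() E.
Proof.
by move=> i iN; rewrite coef_deriv !coef_poly ltnS iN ltnS (ltnW iN) exp_coefS.
Qed.

(** The derivative of the truncated logarithm is a finite geometric sum, whence the exact error
    term. *)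
Lemma logP_deriv : Lg^`() * (1 + 'X) = 1 - (- 'X) ^+ N.
Proof.
have -> : Lg^`() = \sum_(i < N) (- 'X) ^+ i.
  apply/polyP => i; rewrite coef_deriv coef_poly coef_sum ltnS.
  under eq_bigr => j _ do rewrite exprNn -polyC1 -polyCN -rmorphXn /= mul_polyC coefZ coefXn.
  case: ltnP => [iN|Ni].
    rewrite (bigD1 (Ordinal iN)) //= eqxx mulr1 big1 ?addr0.
      by rewrite -[LHS]mulr_natr divfK ?natr_rat_neq0.
    by move=> j; rewrite -val_eqE eq_sym /= => /negPf ->; rewrite mulr0.
  rewrite mul0rn big1 // => j _; case: eqP => [ij|_]; last by rewrite mulr0.
  by move: Ni; rewrite ij leqNgt ltn_ord.
have := subrXX 1 (- 'X : {poly rat}) N; rewrite expr1n opprK => ->.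
rewrite mulrC; congr (_ * _).
by apply: eq_bigr => i _; rewrite expr1n mul1r.
Qed.

(** The composite u has u(0) = 1 and satisfies (1 + X) u' = u, that is (i + 1) u_{i+1} = (1 - i)
    u_i, and 1 + X is the only solution. *)
Lemma exp_log_coef : peq N.+1 (E \Po Lg) (1 + 'X).
Proof.
set u := E \Po Lg.
have Lg0 : Lg`_0 = 0 by rewrite coef_poly.
have u0 : u`_0 = 1.
  rewrite -horner_coef0 /u horner_comp (horner_coef0 Lg) Lg0 horner_coef0.
  by rewrite coef_poly /exp_coef fact0 invr1.
have du : peq N (u^`() * (1 + 'X)) u.
  rewrite /u deriv_comp -mulrA logP_deriv -[X in peq _ _ X]mulr1.
  apply: peqM; first by apply: peq_comp0 Lg0; apply: expP_deriv.
  by apply: peq_sub_exp0; rewrite coefN coefX oppr0.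
have rec i : (i < N)%N -> u`_i.+1 *+ i.+1 = u`_i - u`_i *+ i.
  move=> iN; apply/eqP; rewrite eq_sym subr_eq; apply/eqP.
  have := du i iN; rewrite mulrDr mulr1 coefD coefMX !coef_deriv.
  case: i iN => [|i] iN /= h; last exact/esym.
  by rewrite mulr0n -[LHS]h.
have natI n (x : rat) : x *+ n.+1 = 0 -> x = 0.
  by move/eqP; rewrite -mulr_natr mulf_eq0 (negPf (natr_rat_neq0 n)) orbF => /eqP.
elim=> [|[|i] IH] iN; rewrite coefD coef1 coefX /= ?u0 ?addr0 //.
  by have := rec 0%N iN; rewrite mulr1n u0 subr0 => ->; rewrite add0r.
apply: (natI i.+1); rewrite rec // IH ?(ltnW iN) // coefD coef1 coefX /=.
by case: i {IH iN} => [|i] /=; rewrite ?add0r ?addr0 ?mulr1n ?subrr ?mul0rn ?subr0.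
Qed.

(** By the chain rule and [logP_deriv] the composite has derivative 1, and its constant term is
    0. *)
Lemma log_exp_coef : peq N.+1 (Lg \Po (E - 1)) 'X.
Proof.
set e := E - 1; set u := Lg \Po e.
have e0 : e`_0 = 0.
  by rewrite coefB coef1 coef_poly /exp_coef fact0 invr1 subrr.
have u0 : u`_0 = 0.
  by rewrite -horner_coef0 /u horner_comp (horner_coef0 e) e0 horner_coef0 coef_poly.
have Ee : E = (1 + 'X) \Po e.
  by rewrite comp_polyD comp_polyX -polyC1 comp_polyC addrC subrK.
have du : peq N u^`() 1.
  rewrite /u deriv_comp.
  apply: (@peq_trans _ _ ((Lg^`() \Po e) * E)).
    by apply: peqM => //; rewrite derivB derivC subr0; apply: expP_deriv.
  rewrite Ee -comp_polyM logP_deriv.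
  have -> : (1 - (- 'X) ^+ N) \Po e = 1 - (- e) ^+ N.
    rewrite -[LHS]/(comp_poly e _) rmorphB rmorph1 rmorphXn rmorphN /=.
    by rewrite comp_polyX.
  by apply: peq_sub_exp0; rewrite coefN e0 oppr0.
case=> [|i] iN; rewrite coefX /= ?u0 //.
have := du i iN; rewrite coef_deriv coef1 => h.
apply: (mulIf (natr_rat_neq0 i)); rewrite mulr_natr h.
by case: i {h iN} => [|i] /=; rewrite ?mulr1 ?mul0r.
Qed.
End LogExp.

Section LsumTools.
Variables (k : qalgType) (L : clieType k).

Lemma lsum_tail (f : nat -> L) m N : (forall n, fil n (f n)) ->
  (forall j, (m <= j)%N -> fil N (f j)) -> fil N (lsum f - \sum_(j < m) f j).
Proof.
move=> hf hN.
apply: (@fil_tri _ _ _ _ (\sum_(j < m + N) f j)).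
  by apply: lsumP => //; apply: leq_addl.
rewrite big_split_ord /= addrAC subrr add0r; apply: fil_sum => i _.
by apply: hN; apply: leq_addr.
Qed.

Lemma sum_triangle (V : nmodType) (a : nat -> nat -> V) N :
  \sum_(i < N) \sum_(j < N - i) a i j = \sum_(n < N) \sum_(i < n.+1) a i (n - i)%N.
Proof.
elim: N => [|N IH]; first by rewrite !big_ord0.
rewrite [in RHS]big_ord_recr /= -IH.
transitivity (\sum_(i < N.+1) (\sum_(j < N - i) a i j + a i (N - i)%N)).
  by apply: eq_bigr => i _; rewrite subSn ?leq_ord // big_ord_recr.
by rewrite big_split /= big_ord_recr /= subnn big_ord0 addr0.
Qed.

Lemma lsum2 (a : nat -> nat -> L) : (forall i j, fil (i + j)%N (a i j)) ->
  lsum (fun i => lsum (a i)) = lsum (fun n => \sum_(i < n.+1) a i (n - i)%N).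
Proof.
move=> ha.
have ha2 i j : fil j (a i j) by apply: fil_le (ha i j); apply: leq_addl.
have ha1 i : fil i (lsum (a i)).
  apply: fil_lsum => // j; apply: fil_le (ha i j); exact: leq_addr.
symmetry; apply: lsum_unique => n.
  by apply: fil_sum => i _; apply: fil_le (ha _ _); rewrite subnKC ?leq_ord.
rewrite -sum_triangle; apply: fil_tri (lsumP ha1 (leqnn n)) _.
rewrite -sumrB; apply: fil_sum => i _; apply: lsum_tail => // j hj.
by apply: fil_le (ha _ _); rewrite -leq_subLR.
Qed.

Lemma lsum_qscale p (f : nat -> L) : (forall n, fil n (f n)) ->
  qscale p (lsum f) = lsum (fun n => qscale p (f n)).
Proof.
move=> hf; symmetry; apply: lsum_unique => n; first exact: fil_qscale.
by rewrite -qscale_sumr -qscaleBr; apply: fil_qscale; apply: lsumP.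
Qed.
End LsumTools.

Section OpComp.
Variables (k : qalgType) (L : clieType k) (D : L -> L).
Hypothesis nD : nilop D.
Local Notation pactL := (pact (@qscale k L)).

Let D_add : {morph D : x y / x + y}. Proof. by case: nD. Qed.
Let D_q (q : rat) x : D (qscale q x) = qscale q (D x). Proof. by case: nD. Qed.
Let D_fil n x : fil n x -> fil n.+1 (D x). Proof. by case: nD => _ _; apply. Qed.

Lemma oser_qscale c (q : rat) x : oser c D (qscale q x) = qscale q (oser c D x).
Proof.
rewrite /oser lsum_qscale; last by move=> n; apply: oser_fil.
by congr lsum; apply/funext => n; rewrite (nilop_iter_qscale nD) !qscaleA mulrC.
Qed.

Lemma nilop_oser c : c 0%N = 0 -> nilop (oser c D).
Proof.
move=> c0; split; [exact: oserDr|exact: oser_qscale|move=> n x h].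
by rewrite oser_recl // c0 qscale0 add0r; apply/fil_oser/D_fil.
Qed.

Lemma pact_comp (p q : {poly rat}) y :
  pactL D (p \Po q) y = pactL (pactL D q) p y.
Proof.
have pDl := @pactDl _ _ _ D (@qscaleDl k L).
have pDl' := @pactDl _ _ _ (pactL D q) (@qscaleDl k L).
have pM := @pactM _ _ _ D (@qscaleDl k L) (@qscaleDr k L) _ D_add D_q.
have p0 D' x : pactL D' 0 x = 0 by rewrite /pact size_poly0 big_ord0.
elim/poly_ind: p y => [|p c IH] y; first by rewrite comp_poly0 !p0.
rewrite comp_poly_MXaddC pDl pM; last by move=> *; rewrite qscaleA.
rewrite pDl' !(pactC _ (@qscaleDl k L)) (pactMX _ (@qscaleDl k L)) IH //.
Qed.

Lemma oser_comp c d e y : d 0%N = 0 ->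
  (forall N, peq N.+1 (trunc N.+1 c \Po trunc N.+1 d) (trunc N.+1 e)) ->
  oser c (oser d D) y = oser e D y.
Proof.
move=> d0 h; apply: fil_eq => N; apply: (@fil_le _ _ _ N.+1) => //.
have nE := nilop_oser d0.
apply: fil_tri (oserE nE N.+1 c y) _.
apply: fil_tri (fil_subC (oserE nD N.+1 e y)).
apply: fil_tri (pact_congr nD _ (h N)); rewrite pact_comp.
apply: (@fil_tri _ _ _ _ (\sum_(i < N.+1) qscale (c i) (iter i (pactL D (trunc N.+1 d)) y))).
  rewrite (@pact_widen _ _ _ _ (@qscaleDl k L) N.+1) ?size_poly // -sumrB.
  apply: fil_sum => i _; rewrite coef_poly ltn_ord -qscaleBr; apply: fil_qscale.
  have itc M F G (z : L) : (forall x, fil M (F x - G x)) -> {morph G : x y / x + y} ->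
      (forall x, fil M x -> fil M (G x)) -> forall j, fil M (iter j F z - iter j G z).
    move=> FG GD Gf; elim=> [|j IH] /=; first by rewrite subrr; apply: fil_0.
    apply: fil_tri (FG _) _.
    have GB u v : G (u - v) = G u - G v by apply: (addIr (G v)); rewrite -GD !subrK.
    by rewrite -GB; apply: Gf.
  apply: itc => [x||].
  - exact: oserE.
  - exact: (@pactDr _ _ _ D (@qscaleDr k L) D_add).
  - by move=> x hx; apply: (@fil_pact _ _ _ nD 0).
rewrite (@pact_widen _ _ _ _ (@qscaleDl k L) N.+1) ?size_poly //.
rewrite -sumrB; apply: fil_sum => i _; rewrite coef_poly ltn_ord subrr.
exact: fil_0.
Qed.

Lemma oser_exp_log y : oser exp_coef (oser log_coef D) y = y + D y.
Proof.
(* The witness is the coefficient sequence of 1 + s. *)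
rewrite (@oser_comp _ _ (fun n => (n <= 1)%N%:R)) //.
  rewrite oser_recl // qscale1; congr (_ + _).
  rewrite oser_recl // qscale1 (_ : (fun n => _) = fun=> 0) ?addr0 //.
  apply/eqP; rewrite eq_sym addrC -subr_eq subrr; apply/eqP; symmetry.
  apply: lsum_unique => n; first by rewrite qscale0; apply: fil_0.
  by rewrite big1 ?subr0 => [|i _]; rewrite ?qscale0 //; apply: fil_0.
move=> N i iN; rewrite (exp_log_coef iN) coef_poly iN coefD coef1 coefX.
by case: i iN => [|[|i]].
Qed.

Lemma oser_log_exp y : oser log_coef (fun x => oser exp_coef D x - x) y = D y.
Proof.
pose d n : rat := if n is 0%N then 0 else exp_coef n.
have dE : (fun x => oser exp_coef D x - x) = oser d D.
  apply/funext => x; rewrite (oser_recl nD exp_coef) (oser_recl nD d) qscale0 add0r.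
  by rewrite /exp_coef fact0 invr1 qscale1 addrC addKr.
rewrite dE (@oser_comp _ _ (fun n => (n == 1%N)%:R)) //.
  by rewrite oser_recl // qscale0 add0r oser_delta.
move=> N i iN.
have -> : trunc N.+1 d = trunc N.+1 exp_coef - 1.
  apply/polyP => -[|j]; rewrite coefB coef1 !coef_poly ?subr0 //.
by rewrite (log_exp_coef iN) coef_poly iN coefX.
Qed.

Lemma oser_opp c y : oser c (fun x => - D x) y = oser (fun n => (-1) ^+ n * c n) D y.
Proof.
congr lsum; apply/funext => n; rewrite -mulrC -qscaleA; congr (qscale _ _).
elim: n => [|n IH] /=; first by rewrite qscale1.
by rewrite IH D_q exprS mulN1r qscaleNl.
Qed.

(* e^P Y e^(-P) = sum_n ad(P)^n(Y) / n!, where Y n stands for ad(P)^n(Y). *)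
Lemma oser_exp_conj (Y : nat -> L -> L) x :
  {morph Y 0%N : x y / x + y} ->
  (forall q x, Y 0%N (qscale q x) = qscale q (Y 0%N x)) ->
  (forall n x, fil n x -> fil n (Y 0%N x)) ->
  (forall n x, Y n.+1 x = D (Y n x) - Y n (D x)) ->
  oser exp_coef D (Y 0%N (oser exp_coef (fun x => - D x) x)) =
  lsum (fun n => qscale (exp_coef n) (Y n x)).
Proof.
move=> YD Yq Yf YS.
pose a i j x := qscale (exp_coef i * (exp_coef j * (-1) ^+ j))
  (iter i D (Y 0%N (iter j D x))).
have filx n z : fil n (iter n D z).
  by apply: fil_le (nilop_iter nD n (fil_1 z)); apply: leq_addr.
have fa i j z : fil (i + j)%N (a i j z).
  by apply: fil_qscale; apply: nilop_iter => //; apply: Yf.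
have iq i q z : iter i D (qscale q z) = qscale q (iter i D z).
  exact: nilop_iter_qscale.
have -> : oser exp_coef D (Y 0%N (oser exp_coef (fun x => - D x) x)) =
    lsum (fun i => lsum (fun j => a i j x)).
  congr lsum; apply/funext => i; rewrite oser_opp.
  rewrite [X in iter i D X](lsum_morph (f := Y 0%N)) //; last 3 first.
  - by move=> n; exists n => z; apply: Yf.
  - by move=> n; apply/fil_qscale/filx.
  - by move=> n; apply/Yf/fil_qscale/filx.
  rewrite [X in qscale _ X](lsum_morph (f := iter i D)).
  - rewrite lsum_qscale; last first.
      move=> n; rewrite Yq iq; apply/fil_qscale.
      by apply: fil_le (nilop_iter nD i (Yf _ _ (filx n x))); apply: leq_addl.
    congr lsum; apply/funext => j.
    by rewrite Yq iq qscaleA [(-1) ^+ _ * _]mulrC.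
  - exact: pact_iterD.
  - move=> n; exists n => z /(nilop_iter nD i); apply: fil_le; exact: leq_addl.
  - by move=> n; apply/Yf/fil_qscale/filx.
  - move=> n; rewrite Yq iq; apply/fil_qscale.
    by apply: fil_le (nilop_iter nD i (Yf _ _ (filx n x))); apply: leq_addl.
rewrite lsum2 //; congr lsum; apply/funext => n.
(* Up to the factor m + 1, antidiagonal sums obey the recursion of Y: write m + 1 as i + (m + 1 - i)
   and absorb each summand into one of the two factorials. *)
have rec m z : (\sum_(i < m.+2) a i (m.+1 - i)%N z) *+ m.+1 =
    D (\sum_(i < m.+1) a i (m - i)%N z) - \sum_(i < m.+1) a i (m - i)%N (D z).
  rewrite -sumrMnl.
  have -> : \sum_(i < m.+2) a i (m.+1 - i)%N z *+ m.+1 =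
    \sum_(i < m.+2) a i (m.+1 - i)%N z *+ i +
    \sum_(i < m.+2) a i (m.+1 - i)%N z *+ (m.+1 - i).
    by rewrite -big_split; apply: eq_bigr => i _; rewrite /= -mulrnDr subnKC ?leq_ord.
  rewrite [X in X + _]big_ord_recl mulr0n add0r.
  rewrite [X in _ + X]big_ord_recr /= subnn mulr0n addr0.
  rewrite (big_morph D D_add (nilop0 nD)) -sumrN; congr (_ + _).
    apply: eq_bigr => i _; rewrite /a /bump /= add1n subSS D_q -qscale_nat qscaleA.
    by rewrite mulrA mulr_natl exp_coefS.
  apply: eq_bigr => i _; rewrite subSn ?leq_ord // /a -qscale_nat qscaleA -qscaleNl -iterSr.
  congr (qscale _ _); rewrite exprS -[in RHS](exp_coefS (m - i)) -mulr_natr; ring.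
elim: n x => [|n IH] x'; first by rewrite big_ord1 /a exp_coef0 !mul1r.
have := rec n x'; rewrite !IH D_q -qscaleBr -YS => h.
rewrite -[LHS]qscale1 -(mulVf (natr_rat_neq0 n)) -qscaleA qscale_nat h qscaleA.
by rewrite -(exp_coefS n) -[exp_coef n.+1 *+ _]mulr_natl mulKf ?natr_rat_neq0.
Qed.

End OpComp.

(** Each operator is recovered as the logarithm of its exponential. *)
Lemma oser_exp_inj (k : qalgType) (L : clieType k) (P Q : L -> L) :
  nilop P -> nilop Q -> (forall y, oser exp_coef P y = oser exp_coef Q y) -> P =1 Q.
Proof.
move=> nP nQ h y; rewrite -(oser_log_exp nP) -(oser_log_exp nQ).
have -> // : (fun x => oser exp_coef P x - x) = (fun x => oser exp_coef Q x - x).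
by apply/funext => z; rewrite h.
Qed.

Section Morph.
Variables (k k' : qalgType) (phi : {rmorphism k -> k'}).
Variables (L : clieType k) (L' : clieType k') (f : L -> L').
Hypothesis fM : clie_morph phi f.

Let fD : {morph f : x y / x + y}. Proof. by case: fM. Qed.
Let fbr x y : f [l: x, y] = [l: f x, f y]. Proof. by case: fM. Qed.
Let fc n : exists m, forall x, fil m x -> fil n (f x). Proof. by case: fM. Qed.

Lemma clie0 : f 0 = 0.
Proof. by apply: (addrI (f 0)); rewrite -fD !addr0. Qed.
Lemma clieN x : f (- x) = - f x.
Proof. by apply/eqP; rewrite -subr_eq0 opprK -fD addNr clie0. Qed.
Lemma clieB x y : f (x - y) = f x - f y.
Proof. by rewrite fD clieN. Qed.
Lemma clie_sum I (r : seq I) (P : pred I) F :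
  f (\sum_(i <- r | P i) F i) = \sum_(i <- r | P i) f (F i).
Proof. exact: (big_morph f fD clie0). Qed.

Lemma clie_oser c x y : f (oser c (ad x) y) = oser c (ad (f x)) (f y).
Proof.
apply: lsum_morph_oser => //; try exact: nilop_ad.
exact: (clie_qscale fM).
Qed.
Lemma clie_Ad x y : f (Ad x y) = Ad (f x) (f y).
Proof. exact: (clie_oser exp_coef). Qed.

Lemma clie_rbracket s : f (rbracket s) = rbracket (map f s).
Proof.
elim: s => [|x [|y s] IH] //=; first exact: clie0.
by rewrite fbr IH.
Qed.

Lemma fil_rbracket (M : clieType k) (s : seq M) : fil (size s) (rbracket s).
Proof.
elim: s => [|x [|y s] IH]; [exact: fil_0|exact: fil_1|exact: fil_lbrr].
Qed.
End Morph.

Section BchMorph.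
Variables (k k' : qalgType) (phi : {rmorphism k -> k'}).
Variables (L : clieType k) (L' : clieType k') (f : L -> L').
Hypothesis fM : clie_morph phi f.

Definition bch_term (k : qalgType) (L : clieType k) (x y : L) n : L :=
  qscale n%:R^-1 (\sum_(w : n.-tuple bool)
    qscale (logexpexp_coef w)
      (rbracket [seq if b then x else y | b : bool <- w])).

Lemma fil_bch_term (k0 : qalgType) (M : clieType k0) (x y : M) n : fil n (bch_term x y n).
Proof.
apply/fil_qscale/fil_sum => w _; apply/fil_qscale.
by have := fil_rbracket [seq if b then x else y | b : bool <- w]; rewrite size_map size_tuple.
Qed.

Lemma clie_bch x y : f (bch x y) = bch (f x) (f y).
Proof.
have [fD _ _ fc] := fM; have fq := clie_qscale fM.
have ft n : f (bch_term x y n) = bch_term (f x) (f y) n.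
  rewrite /bch_term fq (clie_sum fM); congr qscale; apply: eq_bigr => w _.
  rewrite fq (clie_rbracket fM) -map_comp; congr (qscale _ (rbracket _)).
  by apply: eq_map => -[].
rewrite [LHS](lsum_morph (f := f)) //.
- by congr lsum; apply/funext.
- exact: fil_bch_term.
- move=> n; rewrite -/(bch_term _ _ _) ft; exact: fil_bch_term.
Qed.
End BchMorph.

(** * Noncommutative power series and the Baker-Campbell-Hausdorff formula *)

HB.instance Definition _ := ComPzRing_isQAlgebra.Build rat idfun.

(* Noncommutative formal power series over rat, as functions on words. *)
Definition ncs (X : Type) : Type := seq X -> rat.

Section NcsRing.
Variable X : Type.
Implicit Types (c d e : ncs X) (w : seq X).

HB.instance Definition _ := gen_eqMixin (ncs X).
HB.instance Definition _ := gen_choiceMixin (ncs X).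

Definition ncs_add c d : ncs X := fun w => c w + d w.
Definition ncs_opp c : ncs X := fun w => - c w.
Definition ncs_zero : ncs X := fun=> 0.
Definition ncs_one : ncs X := fun w => if w is [::] then 1 else 0.
Definition ncs_scale (q : rat) c : ncs X := fun w => q * c w.
Definition pder x c : ncs X := fun w => c (x :: w).

(** The sum over all splittings of the word, written by recursion on the first letter so that the
    ring laws become inductions on words; [ncsM_split] gives the usual form. *)
Fixpoint ncs_mul c d w : rat :=
  match w with
  | [::] => c [::] * d [::]
  | x :: w' => c [::] * d (x :: w') + ncs_mul (pder x c) d w'
  end.

Fact ncs_addA : associative ncs_add.
Proof. by move=> c d e; apply/funext => w; rewrite /ncs_add addrA. Qed.
Fact ncs_addC : commutative ncs_add.
Proof. by move=> c d; apply/funext => w; rewrite /ncs_add addrC. Qed.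
Fact ncs_add0 : left_id ncs_zero ncs_add.
Proof. by move=> c; apply/funext => w; rewrite /ncs_add add0r. Qed.
Fact ncs_addN : left_inverse ncs_zero ncs_opp ncs_add.
Proof. by move=> c; apply/funext => w; rewrite /ncs_add addNr. Qed.
HB.instance Definition _ :=
  GRing.isZmodule.Build (ncs X) ncs_addA ncs_addC ncs_add0 ncs_addN.

Lemma ncsD c d w : (c + d) w = c w + d w. Proof. by []. Qed.
Lemma ncsN c w : (- c) w = - c w. Proof. by []. Qed.
Lemma ncsB c d w : (c - d) w = c w - d w. Proof. by []. Qed.
Lemma ncs_sum I (r : seq I) (P : pred I) (F : I -> ncs X) w :
  (\sum_(i <- r | P i) F i) w = \sum_(i <- r | P i) F i w.
Proof. exact: (big_morph (fun c : ncs X => c w)). Qed.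

Fact ncs_mulDl : left_distributive ncs_mul +%R.
Proof.
move=> c d e; apply/funext => w; rewrite ncsD.
elim: w c d => [|x w IH] c d /=; first by rewrite mulrDl.
have -> : pder x (c + d) = pder x c + pder x d by [].
by rewrite IH mulrDl; ring.
Qed.
Fact ncs_mulDr : right_distributive ncs_mul +%R.
Proof.
move=> c d e; apply/funext => w; rewrite ncsD.
elim: w c => [|x w IH] c /=; first by rewrite mulrDr.
by rewrite IH mulrDr; ring.
Qed.
Lemma ncs_mulZ q c d : ncs_mul (ncs_scale q c) d = ncs_scale q (ncs_mul c d).
Proof.
apply/funext => w; elim: w c => [|x w IH] c /=; first by rewrite /ncs_scale /= mulrA.
by rewrite (IH (pder x c)) /ncs_scale /=; ring.
Qed.
Fact ncs_mulA : associative ncs_mul.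
Proof.
move=> c d e; apply/funext => w; elim: w c => [|x w IH] c /=; first by rewrite mulrA.
have -> : pder x (ncs_mul c d) = ncs_scale (c [::]) (pder x d) + ncs_mul (pder x c) d by [].
rewrite ncs_mulDl ncsD ncs_mulZ -IH /ncs_scale; ring.
Qed.
Lemma ncs_mul0 d : ncs_mul (0 : ncs X) d = (0 : ncs X).
Proof.
apply/funext => w; elim: w => [|x w IH] /=; first by rewrite mul0r.
by rewrite mul0r add0r.
Qed.
Fact ncs_mul1l : left_id ncs_one ncs_mul.
Proof.
move=> c; apply/funext => -[|x w] /=; rewrite mul1r //.
by rewrite (_ : pder x ncs_one = 0) // ncs_mul0 addr0.
Qed.
Fact ncs_mul1r : right_id ncs_one ncs_mul.
Proof.
move=> c; apply/funext => w; elim: w c => [|x w IH] c /=; rewrite ?mulr1 //.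
by rewrite mulr0 add0r IH.
Qed.
Fact ncs_one_neq0 : ncs_one != 0.
Proof. by apply/eqP => /(congr1 (fun c : ncs X => c [::])). Qed.
HB.instance Definition _ := GRing.Zmodule_isNzRing.Build (ncs X)
  ncs_mulA ncs_mul1l ncs_mul1r ncs_mulDl ncs_mulDr ncs_one_neq0.

Fact ncs_scaleA a b c : ncs_scale a (ncs_scale b c) = ncs_scale (a * b) c.
Proof. by apply/funext => w; rewrite /ncs_scale mulrA. Qed.
Fact ncs_scale1 : left_id 1 ncs_scale.
Proof. by move=> c; apply/funext => w; rewrite /ncs_scale mul1r. Qed.
Fact ncs_scaleDr : right_distributive ncs_scale +%R.
Proof. by move=> a c d; apply/funext => w; rewrite /ncs_scale mulrDr. Qed.
Fact ncs_scaleDl c : {morph ncs_scale^~ c : a b / a + b}.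
Proof. by move=> a b; apply/funext => w; rewrite /ncs_scale mulrDl. Qed.
HB.instance Definition _ := GRing.Zmodule_isLmodule.Build rat (ncs X)
  ncs_scaleA ncs_scale1 ncs_scaleDr ncs_scaleDl.

Lemma ncsZ q c w : (q *: c) w = q * c w. Proof. by []. Qed.
Lemma ncs1 w : (1 : ncs X) w = if w is [::] then 1 else 0. Proof. by []. Qed.
Lemma ncsM_nil c d : (c * d) [::] = c [::] * d [::]. Proof. by []. Qed.
Lemma ncsM_cons c d x w :
  (c * d) (x :: w) = c [::] * d (x :: w) + (pder x c * d) w.
Proof. by []. Qed.
Lemma pderM x c d : pder x (c * d) = c [::] *: pder x d + pder x c * d.
Proof. by []. Qed.
Lemma ncsMZl q c d : (q *: c) * d = q *: (c * d).
Proof. exact: ncs_mulZ. Qed.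
Lemma ncsMZr q c d : c * (q *: d) = q *: (c * d).
Proof.
apply/funext => w; elim: w c => [|x w IH] c.
  by rewrite ncsZ !ncsM_nil ncsZ mulrCA.
by rewrite ncsZ !ncsM_cons IH !ncsZ; ring.
Qed.

Lemma ncsM_split c d w :
  (c * d) w = \sum_(i < (size w).+1) c (take i w) * d (drop i w).
Proof.
elim: w c => [|x w IH] c; first by rewrite big_ord1.
by rewrite ncsM_cons IH [in RHS]big_ord_recl.
Qed.

(* The shift by 1 makes every series an element of ncs_fil 1, as required of
   a complete Lie algebra; the bracket on all of ncs is taken to be 0. *)
Definition ncs_fil n c : Prop := forall w, ((size w).+1 < n)%N -> c w = 0.

Lemma ncs_filM m n c d : ncs_fil m.+1 c -> ncs_fil n d -> ncs_fil (m + n) (c * d).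
Proof.
move=> hc hd w hw; rewrite ncsM_split big1 // => i _.
have iw : (i <= size w)%N by rewrite -ltnS.
case: (ltnP i m) => im; first by rewrite hc ?mul0r // size_takel.
by rewrite hd ?mulr0 // size_drop; lia.
Qed.

Fact ncs_fil1 c : ncs_fil 1 c. Proof. by []. Qed.
Fact ncs_fil0 n : ncs_fil n 0. Proof. by []. Qed.
Fact ncs_filD n c d : ncs_fil n c -> ncs_fil n d -> ncs_fil n (c + d).
Proof. by move=> hc hd w hw; rewrite ncsD hc ?hd ?addr0. Qed.
Fact ncs_filZ n (a : rat) c : ncs_fil n c -> ncs_fil n (a *: c).
Proof. by move=> hc w hw; rewrite ncsZ hc ?mulr0. Qed.
Fact ncs_fil_le m n c : (m <= n)%N -> ncs_fil n c -> ncs_fil m c.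
Proof. by move=> mn hc w hw; apply/hc/(leq_trans hw). Qed.
Fact ncs_fil_sep c : (forall n, ncs_fil n c) -> c = 0.
Proof. by move=> h; apply/funext => w; apply: (h (size w).+2). Qed.
Fact ncs_complete (s : nat -> ncs X) : (forall n, ncs_fil n (s n.+1 - s n)) ->
  exists c, forall n, ncs_fil n (c - s n).
Proof.
(* From the index [(size w).+2] on, the coefficient at w no longer changes. *)
move=> h; exists (fun w => s (size w).+2 w) => n w hw; rewrite ncsB.
have H m : s ((size w).+2 + m)%N w = s (size w).+2 w.
  elim: m => [|m IH]; first by rewrite addn0.
  have := h ((size w).+2 + m)%N w; rewrite ncsB -addnS => /(_ _)/eqP.
  by rewrite subr_eq0 IH => h'; apply/eqP/h'; rewrite leq_addr.
by rewrite -(subnKC hw) H subrr.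
Qed.

Definition ncs_br c d : ncs X := 0.
Fact ncs_brDl c d e : ncs_br (c + d) e = ncs_br c e + ncs_br d e.
Proof. by rewrite /ncs_br addr0. Qed.
Fact ncs_brDr c d e : ncs_br c (d + e) = ncs_br c d + ncs_br c e.
Proof. by rewrite /ncs_br addr0. Qed.
Fact ncs_brZl (a : rat) c d : ncs_br (a *: c) d = a *: ncs_br c d.
Proof. by rewrite /ncs_br scaler0. Qed.
Fact ncs_brZr (a : rat) c d : ncs_br c (a *: d) = a *: ncs_br c d.
Proof. by rewrite /ncs_br scaler0. Qed.
Fact ncs_brxx c : ncs_br c c = 0. Proof. by []. Qed.
Fact ncs_jacobi c d e :
  ncs_br c (ncs_br d e) + ncs_br d (ncs_br e c) + ncs_br e (ncs_br c d) = 0.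
Proof. by rewrite /ncs_br !addr0. Qed.
Fact ncs_fil_br m n c d : ncs_fil m c -> ncs_fil n d -> ncs_fil (m + n)%N (ncs_br c d).
Proof. by []. Qed.
HB.instance Definition _ := Lmodule_isCompleteLie.Build rat (ncs X)
  ncs_brDl ncs_brDr ncs_brZl ncs_brZr ncs_brxx ncs_jacobi
  ncs_fil1 ncs_fil0 ncs_filD ncs_filZ ncs_fil_le ncs_fil_br ncs_fil_sep ncs_complete.

Lemma ncs_qscale q c : qscale q c = q *: c. Proof. by []. Qed.

Lemma ncs_lsum (f : nat -> ncs X) w N : (forall n, fil n (f n)) ->
  ((size w).+1 < N)%N -> lsum f w = \sum_(i < N) f i w.
Proof.
move=> hf hN; have /(_ w hN) := lsumP hf (leqnn N).
by rewrite ncsB ncs_sum => /eqP; rewrite subr_eq0 => /eqP.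
Qed.
End NcsRing.

Lemma commutator_jacobi (R : nzRingType) (x y z : R) :
  x * (y * z - z * y) - (y * z - z * y) * x + (y * (z * x - x * z) - (z * x - x * z) * y)
  + (z * (x * y - y * x) - (x * y - y * x) * z) = 0.
Proof. rewrite !mulrBl !mulrBr !mulrA; zmod. Qed.

(** Without constant terms the commutator respects a filtration starting at F^1, where F^n consists
    of the series whose words have length at least n; this is the Lie algebra that receives the free
    one. *)
Definition ncp (X : Type) : Type := {c : ncs X | c [::] == 0}.

Section NcpLie.
Variable X : Type.
Implicit Types (x y z : ncp X).

HB.instance Definition _ := gen_eqMixin (ncp X).
HB.instance Definition _ := gen_choiceMixin (ncp X).

Definition ncp_val x : ncs X := proj1_sig x.
Lemma ncp_nil x : ncp_val x [::] = 0. Proof. exact/eqP/(proj2_sig x). Qed.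
Lemma ncp_inj x y : ncp_val x = ncp_val y -> x = y.
Proof.
case: x y => c hc [d hd]; rewrite /ncp_val /= => h; case: _ / h hd => hd.
by congr exist; apply: bool_irrelevance.
Qed.
Definition ncp_mk (c : ncs X) (h : c [::] = 0) : ncp X := exist _ c (introT eqP h).

Definition ncp_add x y := @ncp_mk (ncp_val x + ncp_val y)
  (etrans (f_equal2 +%R (ncp_nil x) (ncp_nil y)) (addr0 0)).
Definition ncp_scale (a : rat) x := @ncp_mk (a *: ncp_val x)
  (etrans (f_equal2 *%R (erefl a) (ncp_nil x)) (mulr0 a)).
Definition ncp_zero := @ncp_mk 0 erefl.
Lemma ncp_br_subproof x y :
  (ncp_val x * ncp_val y - ncp_val y * ncp_val x) [::] = 0.
Proof. by rewrite ncsB !ncsM_nil !ncp_nil mulr0 subrr. Qed.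
Definition ncp_br x y := ncp_mk (ncp_br_subproof x y).

Fact ncp_addA : associative ncp_add.
Proof. by move=> x y z; apply/ncp_inj/addrA. Qed.
Fact ncp_addC : commutative ncp_add.
Proof. by move=> x y; apply/ncp_inj/addrC. Qed.
Fact ncp_add0 : left_id ncp_zero ncp_add.
Proof. by move=> x; apply/ncp_inj/add0r. Qed.
Fact ncp_addN : left_inverse ncp_zero (ncp_scale (-1)) ncp_add.
Proof. by move=> x; apply/ncp_inj; rewrite /= scaleN1r addNr. Qed.
HB.instance Definition _ :=
  GRing.isZmodule.Build (ncp X) ncp_addA ncp_addC ncp_add0 ncp_addN.

Fact ncp_scaleA a b x : ncp_scale a (ncp_scale b x) = ncp_scale (a * b) x.
Proof. by apply/ncp_inj/scalerA. Qed.
Fact ncp_scale1 : left_id 1 ncp_scale.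
Proof. by move=> x; apply/ncp_inj/scale1r. Qed.
Fact ncp_scaleDr : right_distributive ncp_scale +%R.
Proof. by move=> a x y; apply/ncp_inj/scalerDr. Qed.
Fact ncp_scaleDl x : {morph ncp_scale^~ x : a b / a + b}.
Proof. by move=> a b; apply/ncp_inj/scalerDl. Qed.
HB.instance Definition _ := GRing.Zmodule_isLmodule.Build rat (ncp X)
  ncp_scaleA ncp_scale1 ncp_scaleDr ncp_scaleDl.

Lemma ncp_valD x y : ncp_val (x + y) = ncp_val x + ncp_val y. Proof. by []. Qed.
Lemma ncp_valZ a x : ncp_val (a *: x) = a *: ncp_val x. Proof. by []. Qed.
Lemma ncp_valN x : ncp_val (- x) = - ncp_val x.
Proof. by rewrite -scaleN1r ncp_valZ scaleN1r. Qed.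
Lemma ncp_valB x y : ncp_val (x - y) = ncp_val x - ncp_val y.
Proof. by rewrite ncp_valD ncp_valN. Qed.

Definition ncp_fil n x : Prop := fil n.+1 (ncp_val x).

Fact ncp_brDl x y z : ncp_br (x + y) z = ncp_br x z + ncp_br y z.
Proof. by apply: ncp_inj; rewrite ncp_valD /= mulrDl mulrDr opprD addrACA. Qed.
Fact ncp_brDr x y z : ncp_br x (y + z) = ncp_br x y + ncp_br x z.
Proof. by apply: ncp_inj; rewrite ncp_valD /= mulrDl mulrDr opprD addrACA. Qed.
Fact ncp_brZl a x y : ncp_br (a *: x) y = a *: ncp_br x y.
Proof. by apply: ncp_inj; rewrite ncp_valZ /= ncsMZl ncsMZr scalerBr. Qed.
Fact ncp_brZr a x y : ncp_br x (a *: y) = a *: ncp_br x y.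
Proof. by apply: ncp_inj; rewrite ncp_valZ /= ncsMZl ncsMZr scalerBr. Qed.
Fact ncp_brxx x : ncp_br x x = 0.
Proof. by apply: ncp_inj; rewrite /= subrr. Qed.
Fact ncp_jacobi x y z :
  ncp_br x (ncp_br y z) + ncp_br y (ncp_br z x) + ncp_br z (ncp_br x y) = 0.
Proof.
apply: ncp_inj; exact: (commutator_jacobi (ncp_val x) (ncp_val y) (ncp_val z)).
Qed.
Fact ncp_fil1 x : ncp_fil 1 x.
Proof. by move=> [|a w]; rewrite ?ncp_nil. Qed.
Fact ncp_fil0 n : ncp_fil n 0. Proof. exact: fil_0. Qed.
Fact ncp_filD n x y : ncp_fil n x -> ncp_fil n y -> ncp_fil n (x + y).
Proof. exact: fil_D. Qed.
Fact ncp_filZ n (a : rat) x : ncp_fil n x -> ncp_fil n (a *: x).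
Proof. exact: fil_Z. Qed.
Fact ncp_fil_le m n x : (m <= n)%N -> ncp_fil n x -> ncp_fil m x.
Proof. by move=> mn; apply: fil_le. Qed.
Fact ncp_fil_br m n x y : ncp_fil m x -> ncp_fil n y -> ncp_fil (m + n)%N (ncp_br x y).
Proof.
move=> hx hy; apply: fil_B; rewrite -?addnS; first exact: ncs_filM.
by rewrite addnS -addSn addnC; apply: ncs_filM.
Qed.
Fact ncp_fil_sep x : (forall n, ncp_fil n x) -> x = 0.
Proof.
move=> h; apply/ncp_inj/fil_sep => n; apply: fil_le (h n); exact: leqnSn.
Qed.
Fact ncp_complete (s : nat -> ncp X) : (forall n, ncp_fil n (s n.+1 - s n)) ->
  exists x, forall n, ncp_fil n (x - s n).
Proof.
move=> h.
have [|c hc] := @fil_complete _ (ncs X) (fun n => ncp_val (s n.-1)).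
  move=> [|n] /=; first by rewrite subrr; apply: fil_0.
  by rewrite -ncp_valB; apply: h.
have c0 : c [::] = 0.
  by have := hc 2%N [::] isT; rewrite ncsB ncp_nil subr0.
exists (ncp_mk c0) => n; rewrite /ncp_fil ncp_valB; exact: (hc n.+1).
Qed.
HB.instance Definition _ := Lmodule_isCompleteLie.Build rat (ncp X)
  ncp_brDl ncp_brDr ncp_brZl ncp_brZr ncp_brxx ncp_jacobi
  ncp_fil1 ncp_fil0 ncp_filD ncp_filZ ncp_fil_le ncp_fil_br ncp_fil_sep ncp_complete.

Lemma ncp_filE n x : fil n x <-> fil n.+1 (ncp_val x). Proof. by []. Qed.
Lemma ncp_val_qscale q x : ncp_val (qscale q x) = qscale q (ncp_val x).
Proof. by []. Qed.
Lemma ncp_val_lsum (f : nat -> ncp X) : (forall n, fil n (f n)) ->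
  ncp_val (lsum f) = lsum (fun n => ncp_val (f n)).
Proof.
have h n x : fil n x -> fil n (ncp_val x).
  by move=> /ncp_filE; apply: fil_le; apply: leqnSn.
move=> hf; apply: (lsum_morph (f := ncp_val)) => // [|n]; last exact: h.
by move=> n; exists n => x; apply: h.
Qed.
End NcpLie.

Lemma sum_tuple_cons (V : nmodType) (X : finType) n (F : seq X -> V) :
  \sum_(w : n.+1.-tuple X) F w = \sum_x \sum_(w : n.-tuple X) F (x :: w).
Proof.
rewrite pair_big /= (reindex (fun p : X * n.-tuple X => cons_tuple p.1 p.2)) //=.
exists (fun w : n.+1.-tuple X => (thead w, behead_tuple w)) => [[x w] _|w _] /=.
  by congr (_, _); apply/val_inj.
by apply/val_inj; rewrite /= [w in RHS]tuple_eta.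
Qed.

Lemma sum_tuple0 (V : nmodType) (X : finType) (F : seq X -> V) :
  \sum_(w : 0.-tuple X) F w = F [::].
Proof.
rewrite (bigD1 [tuple]) //= big1 ?addr0 // => w.
by case/eqP; apply: tuple0.
Qed.

Lemma lsumN (k : qalgType) (L : clieType k) (f : nat -> L) :
  (forall n, fil n (f n)) -> lsum (fun n => - f n) = - lsum f.
Proof.
move=> hf; apply: lsum_unique => n; first exact: fil_N.
by rewrite sumrN -opprD; apply/fil_N/lsumP.
Qed.

Lemma lsum_sum (k : qalgType) (L : clieType k) (I : finType) (f : I -> nat -> L) :
  (forall i n, fil n (f i n)) ->
  lsum (fun n => \sum_i f i n) = \sum_i lsum (f i).
Proof.
move=> hf; apply: lsum_unique => n; first exact: fil_sum.
rewrite exchange_big -sumrB; apply: fil_sum => i _; exact: lsumP.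
Qed.

(** * Power series acting by operators, exponentials and the Dynkin operator *)

Section Act.
Variables (X : finType) (k : qalgType) (V : clieType k) (T : X -> V -> V).
Hypothesis nT : forall x, nilop (T x).
Implicit Types (a b : ncs X) (m : V).

Definition act_term a m n : V :=
  \sum_(w : n.-tuple X) qscale (a w) (foldr T m w).
(* The word x1 ... xn acts as T x1 \o ... \o T xn. *)
Definition act a m : V := lsum (act_term a m).

Let T_add x : {morph T x : m m' / m + m'}. Proof. by case: (nT x). Qed.
Let T_q x q m : T x (qscale q m) = qscale q (T x m). Proof. by case: (nT x). Qed.
Let T_fil x n m : fil n m -> fil n.+1 (T x m). Proof. by case: (nT x) => _ _; apply. Qed.

Lemma fil_foldr w n m : fil n m -> fil (size w + n)%N (foldr T m w).
Proof. by move=> h; elim: w => //= x w IH; apply: T_fil. Qed.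

Lemma fil_act_term a m j n : fil j m -> fil (n + j)%N (act_term a m n).
Proof.
move=> h; apply: fil_sum => w _; apply: fil_qscale.
by have := fil_foldr w h; rewrite size_tuple.
Qed.

Lemma fil_act_term0 a m n : fil n (act_term a m n).
Proof. by apply: fil_le (fil_act_term a n (fil_1 m)); apply: leq_addr. Qed.
Hint Resolve fil_act_term0 : core.

Lemma act_termD a b m n : act_term (a + b) m n = act_term a m n + act_term b m n.
Proof. by rewrite -big_split; apply: eq_bigr => w _; rewrite /= qscaleDl. Qed.
Lemma act_termZ q a m n : act_term (q *: a) m n = qscale q (act_term a m n).
Proof. by rewrite qscale_sumr; apply: eq_bigr => w _; rewrite /= qscaleA. Qed.

Lemma actDl a b m : act (a + b) m = act a m + act b m.
Proof. by rewrite /act -lsumD //; congr lsum; apply/funext => n; rewrite act_termD. Qed.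
Lemma actZ q a m : act (q *: a) m = qscale q (act a m).
Proof. by rewrite /act lsum_qscale //; congr lsum; apply/funext => n; rewrite act_termZ. Qed.
Lemma act0 m : act 0 m = 0.
Proof. by apply: (addrI (act 0 m)); rewrite -actDl !addr0. Qed.

Lemma foldrT_add w : {morph (fun m => foldr T m w) : m m' / m + m'}.
Proof. by move=> m m'; elim: w => //= x w ->; rewrite T_add. Qed.
Lemma foldrT_q w q m : foldr T (qscale q m) w = qscale q (foldr T m w).
Proof. by elim: w => //= x w ->; rewrite T_q. Qed.

Lemma actDr a m m' : act a (m + m') = act a m + act a m'.
Proof.
rewrite /act -lsumD //; congr lsum; apply/funext => n.
by rewrite -big_split; apply: eq_bigr => w _; rewrite foldrT_add qscaleDr.
Qed.
Lemma act_q a q m : act a (qscale q m) = qscale q (act a m).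
Proof.
rewrite /act lsum_qscale //; congr lsum; apply/funext => n.
rewrite qscale_sumr; apply: eq_bigr => w _.
by rewrite foldrT_q !qscaleA mulrC.
Qed.

(* [fil n.+1 a] means that a has no words of length < n. *)
Lemma fil_act a m n j : fil n.+1 a -> fil j m -> fil (n + j)%N (act a m).
Proof.
move=> ha hm; apply: fil_lsum => // i; case: (ltnP i n) => hi.
  rewrite /act_term big1 => [|w _]; first exact: fil_0.
  by rewrite ha ?qscale0 // size_tuple.
by apply: fil_le (fil_act_term a i hm); rewrite leq_add2r.
Qed.

Lemma act_rec a m : act a m = qscale (a [::]) m + \sum_x T x (act (pder x a) m).
Proof.
rewrite /act lsum_recl //; last by move=> n; apply: (@fil_le _ _ _ n.+1).
rewrite {1}/act_term (@sum_tuple0 _ _ (fun w => qscale (a w) (foldr T m w))); congr (_ + _).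
have -> : (fun n => act_term a m n.+1) = (fun n => \sum_x T x (act_term (pder x a) m n)).
  apply/funext => n; rewrite /act_term.
  rewrite (@sum_tuple_cons _ _ _ (fun w => qscale (a w) (foldr T m w))).
  apply: eq_bigr => x _; rewrite (big_morph (T x) (T_add x) (nilop0 (nT x))).
  by apply: eq_bigr => w _; rewrite T_q.
have fT x n : fil n (T x (act_term (pder x a) m n)).
  by apply: (@fil_le _ _ _ n.+1) => //; apply: T_fil.
rewrite lsum_sum //; apply: eq_bigr => x _; symmetry; apply: lsum_morph => //.
by move=> n; exists n => y h; apply: fil_le (T_fil x h).
Qed.

(** Splitting off the first letter of a gains one step of the filtration, so both sides agree modulo
    every F^N. *)
Lemma actM a b m : act (a * b) m = act a (act b m).
Proof.
apply: fil_eq => N; elim: N a => [|N IH] a; first exact: fil_any.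
rewrite (act_rec (a * b)) (act_rec a) ncsM_nil -qscaleA.
have -> : \sum_x T x (act (pder x (a * b)) m) =
    qscale (a [::]) (\sum_x T x (act (pder x b) m)) +
    \sum_x T x (act (pder x a * b) m).
  rewrite qscale_sumr -big_split; apply: eq_bigr => x _.
  by rewrite pderM actDl actZ /= T_add T_q.
rewrite addrA -qscaleDr -act_rec opprD addrACA subrr add0r -sumrB.
apply: fil_sum => x _; rewrite -(nilopN (nT x)) -T_add; exact/T_fil/IH.
Qed.

Lemma act1 m : act 1 m = m.
Proof.
rewrite act_rec qscale1 big1 ?addr0 // => x _.
by rewrite (_ : pder x 1 = 0) // act0 (nilop0 (nT x)).
Qed.

Lemma nilop_act a : a [::] = 0 -> nilop (act a).
Proof.
move=> a0; split; [exact: actDr|exact: act_q|move=> n m h].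
rewrite -add1n; apply: fil_act h => -[|x [|y w]] //.
Qed.
End Act.

Section Nexp.
Variable X : Type.
Implicit Types a b c : ncs X.

Lemma nilop_mul a : a [::] = 0 -> nilop (fun b => a * b).
Proof.
move=> a0; split=> [b c|q b|n b h]; [exact: mulrDr|exact: ncsMZr|].
rewrite -add1n; apply: ncs_filM h => -[|x [|y w]] //.
Qed.

Definition nser (s : nat -> rat) a : ncs X := oser s (fun b => a * b) 1.
Definition nexp a : ncs X := nser exp_coef a.

Lemma fil_ncsMr n a b : fil n a -> fil n (a * b).
Proof. by case: n => [|n] h //; rewrite -[n.+1]addn1; apply: (@ncs_filM _ n 1). Qed.

Lemma nser_mul s a b : a [::] = 0 -> nser s a * b = oser s (fun b => a * b) b.
Proof.
move=> a0; rewrite -[in RHS](mul1r b).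
apply: (lsum_morph_oser (f := fun c => c * b)); try exact: nilop_mul.
- by move=> x y; apply: mulrDl.
- by move=> q c; apply: ncsMZl.
- by move=> n; exists n => c; apply: fil_ncsMr.
- by move=> c; rewrite mulrA.
Qed.

Lemma nser_comm s a : a [::] = 0 -> nser s a * a = a * nser s a.
Proof.
move=> a0; rewrite nser_mul // -{2}(mulr1 a); symmetry.
exact: (oser_comm _ _ (nilop_mul a0) (nilop_mul a0)).
Qed.

Lemma nexpN a : a [::] = 0 -> nexp a * nexp (- a) = 1.
Proof.
move=> a0; rewrite nser_mul //.
have nN : (- a) [::] = 0 by rewrite ncsN a0 oppr0.
(* The conjugated operator is the identity, whose iterated commutators with the multiplication by a
   vanish. *)
pose Y n (b : ncs X) : ncs X := if n is 0%N then b else 0.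
have -> : nexp (- a) = Y 0%N (oser exp_coef (fun b => - (a * b)) 1).
  by rewrite /nexp /nser; congr oser; apply/funext => b; rewrite mulNr.
rewrite (oser_exp_conj (nilop_mul a0)) //=.
  apply: lsum_unique => n.
    by case: n => [|n] //; rewrite /= qscaler0; apply: fil_0.
  case: n => [|n] //; rewrite big_ord_recl exp_coef0 qscale1 big1.
    by rewrite addr0 subrr; apply: fil_0.
  by move=> i _; rewrite /= qscaler0.
by case=> [|n] b /=; rewrite ?subrr // mulr0 subr0.
Qed.

Lemma nexpNK a : a [::] = 0 -> nexp (- a) * nexp a = 1.
Proof. by move=> a0; rewrite -{2}(opprK a) nexpN // ncsN a0 oppr0. Qed.

Lemma nexp_nil a : a [::] = 0 -> nexp a [::] = 1.
Proof.
move=> a0; rewrite /nexp /nser (oser_exp (nilop_mul a0)) ncsD ncsM_nil a0.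
by rewrite mul0r addr0.
Qed.

Lemma val_Ad (u y : ncp X) :
  ncp_val (Ad u y) * nexp (ncp_val u) = nexp (ncp_val u) * ncp_val y.
Proof.
set a := ncp_val u; have a0 : a [::] = 0 by exact: ncp_nil.
suff -> : ncp_val (Ad u y) = nexp a * (ncp_val y * nexp (- a)).
  by rewrite -!mulrA nexpNK // mulr1.
pose Y n (b : ncs X) := ncp_val (iter n (ad u) y) * b.
rewrite nser_mul //.
have -> : nexp (- a) = oser exp_coef (fun b => - (a * b)) 1.
  by rewrite /nexp /nser; congr oser; apply/funext => b; rewrite mulNr.
rewrite -/(Y 0%N _) (oser_exp_conj (nilop_mul a0)).
- rewrite AdE ncp_val_lsum; last by move=> n; apply: oser_fil; apply: nilop_ad.
  by congr lsum; apply/funext => n; rewrite /Y mulr1.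
- by move=> b c; apply: mulrDr.
- by move=> q b; apply: ncsMZr.
- move=> n b h; apply: (@fil_le _ _ _ (1 + n)) => //.
  apply: ncs_filM h => -[|x [|z w]] //= _; exact: ncp_nil.
- by move=> n b; rewrite /Y /= -/a mulrBl !mulrA.
Qed.

(** The derivation by degree. It determines a series up to the constant term, and it will be
    compared with the Dynkin operator [dyn]. *)
Definition euler a : ncs X := fun w => (size w)%:R * a w.

Lemma eulerD : {morph euler : a b / a + b}.
Proof. by move=> a b; apply/funext => w; rewrite /euler !ncsD mulrDr. Qed.
Lemma eulerZ q a : euler (q *: a) = q *: euler a.
Proof. by apply/funext => w; rewrite /euler !ncsZ mulrCA. Qed.
Lemma fil_euler n a : fil n a -> fil n (euler a).
Proof. by move=> h w hw; rewrite /euler h ?mulr0. Qed.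
Lemma eulerM a b : euler (a * b) = euler a * b + a * euler b.
Proof.
apply/funext => w; elim: w a => [|x w IH] a.
  by rewrite ncsD !ncsM_nil /euler /= !mul0r mulr0 addr0.
have pE : pder x (euler a) = euler (pder x a) + pder x a.
  by apply/funext => v; rewrite ncsD /pder /euler /= -natr1 mulrDl mul1r.
have eb : euler b (x :: w) = (size w)%:R * b (x :: w) + b (x :: w).
  by rewrite /euler /= -natr1 mulrDl mul1r.
have eab : euler (a * b) (x :: w) = (size w)%:R * (a * b) (x :: w) + (a * b) (x :: w).
  by rewrite /euler /= -natr1 mulrDl mul1r.
have ea : euler a [::] = 0 by rewrite /euler mul0r.
rewrite eab ncsD !ncsM_cons eb ea pE mulrDl ncsD.
have h : (euler (pder x a) * b) w = (size w)%:R * (pder x a * b) w - (pder x a * euler b) w.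
  by apply/eqP; rewrite eq_sym subr_eq; apply/eqP; apply: IH.
by rewrite h; ring.
Qed.
Lemma euler_inj a b : a [::] = b [::] -> euler a = euler b -> a = b.
Proof.
move=> h0 h; apply/funext => -[|x w] //.
have /(congr1 (fun c : ncs X => c (x :: w))) := h; rewrite /euler /=.
exact/mulfI/natr_rat_neq0.
Qed.

Lemma eulerp_subproof (u : ncp X) : euler (ncp_val u) [::] = 0.
Proof. by rewrite /euler mul0r. Qed.
Definition eulerp (u : ncp X) := ncp_mk (eulerp_subproof u).

(** This is the derivative of the exponential: e^a euler e^{-a} is the sum of the ad(a)^n(euler)/n!,
    the commutator of a with [euler] is multiplication by - euler(a), and applying everything to e^a
    gives e^a euler(1) = 0. *)
Lemma euler_exp (u : ncp X) : euler (nexp (ncp_val u)) =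
  ncp_val (oser eps_coef (ad u) (eulerp u)) * nexp (ncp_val u).
Proof.
set a := ncp_val u; have a0 : a [::] = 0 by exact: ncp_nil.
pose Y n (b : ncs X) := if n is n'.+1 then - (ncp_val (iter n' (ad u) (eulerp u)) * b)
  else euler b.
have YD : {morph Y 0%N : b c / b + c} by exact: eulerD.
have YS n b : Y n.+1 b = a * Y n b - Y n (a * b).
  case: n => [|n] /=; first by rewrite eulerM [euler a * b + _]addrC opprD addrA subrr add0r.
  by rewrite -/a mulrBl mulrN opprK -!mulrA opprB addrC.
have := @oser_exp_conj _ _ _ (nilop_mul a0) Y (nexp a) YD eulerZ fil_euler YS.
have -> : oser exp_coef (fun b => - (a * b)) (nexp a) = 1.
  have nN : (- a) [::] = 0 by rewrite ncsN a0 oppr0.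
  rewrite -[a in nexp a]opprK -(nexpN nN) nser_mul //; congr oser.
  by apply/funext => b; rewrite mulNr.
have -> : Y 0%N 1 = 0 :> ncs X by apply/funext => -[|x w]; rewrite /= /euler ?mul0r ?mulr0.
rewrite (oser0 (nilop_mul a0)) lsum_recl; last 2 first.
- case=> [|n] //; apply/fil_qscale/fil_N/fil_ncsMr.
  by have /ncp_filE := nilop_iter (nilop_ad u) n (fil_1 (eulerp u)); apply: fil_le; lia.
- move=> n; apply/fil_qscale/fil_N/fil_ncsMr.
  by have /ncp_filE := nilop_iter (nilop_ad u) n (fil_1 (eulerp u)); apply: fil_le; lia.
rewrite exp_coef0 qscale1 /= => /eqP; rewrite eq_sym addr_eq0 => /eqP ->; rewrite -[RHS]opprK; congr (- _).
have fe n : fil n (qscale (eps_coef n) (iter n (ad u) (eulerp u))).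
  exact/oser_fil/nilop_ad.
have fe' n : fil n (ncp_val (qscale (eps_coef n) (iter n (ad u) (eulerp u)))).
  by apply: fil_le (proj1 (ncp_filE _ _) (fe n)).
rewrite ncp_val_lsum // (lsum_morph (f := fun c => c * nexp a)) //; last 3 first.
- by move=> x y; apply: mulrDl.
- by move=> n; exists n => c; apply: fil_ncsMr.
- by move=> n; apply: fil_ncsMr.
rewrite -lsumN; last by move=> n; apply: fil_ncsMr.
congr lsum; apply/funext => n; rewrite ncp_val_qscale ncsMZl -[X in _ = - X]/(qscale _ _).
by rewrite qscaleNr.
Qed.
End Nexp.

Section Dyn.
Variables (X : finType) (k : qalgType) (L : clieType k) (v : X -> L).
Implicit Types (a b : ncs X).

Definition dyn_term a n : L :=
  \sum_(w : n.-tuple X) qscale (a w) (rbracket (map v w)).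
Definition dyn a : L := lsum (dyn_term a).

Local Notation T := (fun x => ad (v x)).
Let nT x : nilop (T x). Proof. exact: nilop_ad. Qed.

Lemma fil_dyn_term a n : fil n (dyn_term a n).
Proof.
apply: fil_sum => w _; apply: fil_qscale.
by have := fil_rbracket (map v w); rewrite size_map size_tuple.
Qed.
Hint Resolve fil_dyn_term : core.

Lemma dynD a b : dyn (a + b) = dyn a + dyn b.
Proof.
rewrite /dyn -lsumD //; congr lsum; apply/funext => n.
by rewrite -big_split; apply: eq_bigr => w _; rewrite /= qscaleDl.
Qed.
Lemma dynZ q a : dyn (q *: a) = qscale q (dyn a).
Proof.
rewrite /dyn lsum_qscale //; congr lsum; apply/funext => n.
by rewrite qscale_sumr; apply: eq_bigr => w _; rewrite /= qscaleA.
Qed.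
Lemma dyn0 : dyn 0 = 0.
Proof. by apply: (addrI (dyn 0)); rewrite -dynD !addr0. Qed.
Lemma dynB a b : dyn (a - b) = dyn a - dyn b.
Proof. by rewrite -scaleN1r dynD dynZ qscaleNl qscale1. Qed.

Lemma fil_dyn a n : fil n.+1 a -> fil n (dyn a).
Proof.
move=> ha; apply: fil_lsum => // i; case: (ltnP i n) => hi.
  rewrite /dyn_term big1 => [|w _]; first exact: fil_0.
  by rewrite ha ?qscale0 // size_tuple.
by apply: fil_le (fil_dyn_term a i).
Qed.

(** The words of one letter need a separate term: their bracket is the letter itself, whereas [x,
    [rbracket] of the empty word] is 0. *)
Lemma dyn_rec a : dyn a = \sum_x (qscale (a [:: x]) (v x) + [l: v x, dyn (pder x a)]).
Proof.
pose f x n : L := qscale (if n is 0%N then a [:: x] else 0) (v x).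
have ff x n : fil n (f x n).
  by case: n => [|n]; [apply: fil_any|rewrite /f qscale0; apply: fil_0].
pose g x n : L := [l: v x, dyn_term (pder x a) n].
have fg x n : fil n (g x n) by apply: (@fil_le _ _ _ n.+1) => //; apply: fil_lbrr.
have rb x (s : seq L) : rbracket (x :: s) = (if s is [::] then x else 0) + [l: x, rbracket s].
  by case: s => [|y s] /=; rewrite ?lbr0r ?addr0 ?add0r.
rewrite /dyn lsum_recl //; last by move=> n; apply: (@fil_le _ _ _ n.+1).
rewrite {1}/dyn_term (@sum_tuple0 _ _ (fun w => qscale (a w) (rbracket (map v w)))).
rewrite qscaler0 add0r.
have -> : (fun n => dyn_term a n.+1) = (fun n => \sum_x (f x n + g x n)).
  apply/funext => n; rewrite /dyn_term.
  rewrite (@sum_tuple_cons _ _ _ (fun w => qscale (a w) (rbracket (map v w)))).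
  apply: eq_bigr => x _; rewrite /g lbr_sumr.
  rewrite (eq_bigr (fun w : n.-tuple X =>
     qscale (a (x :: w)) (if tval w is [::] then v x else 0) +
     [l: v x, qscale (pder x a w) (rbracket (map v w))])); last first.
    move=> w _; rewrite lbr_qscaler -qscaleDr [map v _]/= rb.
    by case: (tval w).
  rewrite big_split /=; congr (_ + _); rewrite /f.
  case: n => [|n].
    by rewrite (@sum_tuple0 _ _ (fun w => qscale (a (x :: w)) (if w is [::] then v x else 0))).
  rewrite qscale0 big1 // => w _; case: w => -[|y w] //= _; exact: qscaler0.
rewrite lsum_sum; last by move=> x n; apply: fil_D.
apply: eq_bigr => x _; rewrite lsumD //; congr (_ + _).
  apply: lsum_unique => // -[|n]; first exact: fil_any.
  rewrite big_ord_recl /= opprD addrA subrr add0r big1 ?oppr0; first exact: fil_0.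
  by move=> i _; rewrite /f qscale0.
symmetry; apply: (lsum_morph (f := T (x : X))) => //.
- by case: (nT x).
- by move=> n; exists n => y h; apply: fil_le (fil_lbrr (v x) h).
- by move=> n; apply: fg.
Qed.

(** In a bracket nested to the right, the letters of a act by [ad] on the bracket of b; only when b
    contributes the empty word does the bracket of a itself survive. *)
Lemma dynM a b : dyn (a * b) = act T a (dyn b) + qscale (b [::]) (dyn a).
Proof.
apply: fil_eq => N; elim: N a => [|N IH] a; first exact: fil_any.
rewrite dyn_rec (dyn_rec a) (act_rec nT).
have -> : \sum_x (qscale ((a * b) [:: x]) (v x) + [l: v x, dyn (pder x (a * b))]) =
    qscale (a [::]) (dyn b) + \sum_x (qscale (a [:: x] * b [::]) (v x) +
       [l: v x, dyn (pder x a * b)]).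
  rewrite [dyn b]dyn_rec qscale_sumr -big_split; apply: eq_bigr => x _.
  rewrite ncsM_cons ncsM_nil pderM dynD dynZ lbrDr qscaleDl -qscaleA /=.
  rewrite lbr_qscaler qscaleDr; zmod.
rewrite -[X in _ - X]addrA opprD addrACA subrr add0r qscale_sumr -big_split -sumrB.
apply: fil_sum => x _ /=; rewrite qscaleDr qscaleA [_ * a _]mulrC.
have zz (Q P A R : L) : Q + P - (A + (Q + R)) = P - (A + R) by zmod.
rewrite zz -lbr_qscaler -lbrDr -lbrBr.
exact/fil_lbrr/IH.
Qed.

Definition letter (x : X) : ncs X := fun w => if w == [:: x] then 1 else 0.

Lemma pder_letter x y : pder y (letter x) = (if y == x then 1 else 0) :> ncs X.
Proof.
apply/funext => w; rewrite /pder /letter eqseq_cons.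
by case: eqP => // _; case: w.
Qed.

Lemma dyn1 : dyn 1 = 0.
Proof.
rewrite dyn_rec big1 // => x _; rewrite (_ : pder x 1 = 0) // dyn0 lbr0r.
by rewrite qscale0 addr0.
Qed.

Lemma dyn_letter x : dyn (letter x) = v x.
Proof.
rewrite dyn_rec (bigD1 x) //= pder_letter eqxx dyn1 lbr0r addr0.
rewrite /letter eqxx qscale1 big1 ?addr0 // => y yx.
rewrite eqseq_cons (negPf yx) qscale0 add0r.
have -> : pder y (fun w => if w == [:: x] then 1 else 0) = pder y (letter x) by [].
by rewrite pder_letter (negPf yx) dyn0 lbr0r.
Qed.

Lemma act_letter (T0 : X -> L -> L) x m : (forall x, nilop (T0 x)) ->
  act T0 (letter x) m = T0 x m.
Proof.
move=> nT0; rewrite (act_rec nT0) qscale0 add0r (bigD1 x) //= pder_letter eqxx act1 //.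
rewrite big1 ?addr0 // => y yx.
by rewrite pder_letter (negPf yx) (act0 nT0) (nilop0 (nT0 y)).
Qed.
End Dyn.

Section ActSeries.
Variables (X : finType) (k : qalgType) (V : clieType k) (T : X -> V -> V).
Hypothesis nT : forall x, nilop (T x).

Lemma act_oser s (a b : ncs X) m : a [::] = 0 ->
  act T (oser s (fun c => a * c) b) m = oser s (act T a) (act T b m).
Proof.
move=> a0; apply: (lsum_morph_oser (f := fun c => act T c m)).
- exact: nilop_mul.
- exact: nilop_act.
- by move=> b' c; apply: actDl.
- by move=> q c; apply: actZ.
- move=> n; exists n.+1 => c hc.
  by apply: fil_le (fil_act nT hc (fil_1 m)); apply: leq_addr.
- by move=> c; apply: actM.
Qed.

Lemma act_morph (k' : qalgType) (V' : clieType k') (T' : X -> V' -> V') (f : V -> V') a m :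
  (forall x, nilop (T' x)) -> {morph f : x y / x + y} ->
  (forall q x, f (qscale q x) = qscale q (f x)) ->
  (forall n, exists m, forall x, fil m x -> fil n (f x)) ->
  (forall x m, f (T x m) = T' x (f m)) ->
  f (act T a m) = act T' a (f m).
Proof.
move=> nT' fD fq fc fT.
have f0 : f 0 = 0 by apply: (addrI (f 0)); rewrite -fD !addr0.
have ft n : f (act_term T a m n) = act_term T' a (f m) n.
  rewrite (big_morph f fD f0); apply: eq_bigr => w _; rewrite fq; congr qscale.
  by elim: (tval w) => //= x s <-.
rewrite /act (lsum_morph (f := f)) //.
- by congr lsum; apply/funext.
- exact: fil_act_term0.
- by move=> n; rewrite ft; apply: fil_act_term0.
Qed.
End ActSeries.

(** Write e^a = 1 + eps(a) a, with eps the series of [eps_coef], and apply [dynM]. *)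
Lemma dyn_oser_eps (X : finType) (k : qalgType) (L : clieType k) (v : X -> L) (a : ncs X) :
  a [::] = 0 ->
  dyn v (nexp a) = oser eps_coef (act (fun x => ad (v x)) a) (dyn v a).
Proof.
move=> a0; have nT x : nilop (ad (v x)) by apply: nilop_ad.
rewrite /nexp /nser (oser_exp (nilop_mul a0)) dynD dyn1 add0r.
rewrite -/(nser _ _) -nser_comm // dynM a0 qscale0 addr0.
by rewrite /nser act_oser // act1.
Qed.

Section Dynkin.
Local Notation lt b := (letter b : ncs bool).

Lemma letter_nil (X : finType) (x : X) : letter x [::] = 0. Proof. by []. Qed.
Definition letterp (X : finType) (x : X) : ncp X := ncp_mk (letter_nil x).

Let A := letterp true.
Let B := letterp false.
Let G : ncs bool := nexp (lt true) * nexp (lt false).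
Let T (b : bool) : ncp bool -> ncp bool := ad (letterp b).
Let nT b : nilop (T b). Proof. exact: nilop_ad. Qed.

Lemma letterX (X : finType) (x : X) n w :
  iter n (fun c => letter x * c) 1 w = if w == nseq n x then 1 else 0.
Proof.
elim: n w => [|n IH] [|y w] //=; rewrite ?ncsM_nil ?mul0r //.
rewrite ncsM_cons mul0r add0r pder_letter eqseq_cons.
case: eqP => _ /=; first by rewrite mul1r IH.
by rewrite mul0r.
Qed.

Lemma nexp_letter (X : finType) (x : X) w :
  nexp (letter x) w = if w == nseq (size w) x then exp_coef (size w) else 0.
Proof.
rewrite /nexp /nser /oser (@ncs_lsum _ _ w (size w).+2) //; last first.
  by move=> n; apply: oser_fil; apply: nilop_mul.
under eq_bigr => i _ do rewrite ncs_qscale ncsZ letterX.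
case: eqP => [wE|wE].
  have h : (size w < (size w).+2)%N by [].
  rewrite (bigD1 (Ordinal h)) //= -wE eqxx mulr1 big1 ?addr0 // => i.
  rewrite -val_eqE /= => iw; case: eqP => [we|_]; last by rewrite mulr0.
  by case/eqP: iw; have := congr1 size we; rewrite size_nseq => /esym.
rewrite big1 // => i _; case: eqP => [we|_]; last by rewrite mulr0.
by case: wE; have := congr1 size we; rewrite size_nseq => ->.
Qed.

Lemma expexp_coefE w : (G - 1) w = expexp_coef w.
Proof.
rewrite ncsB ncs1 /expexp_coef; set r := count id w; set s := count negb w.
have rs : (r + s)%N = size w by rewrite -(count_predC id w).
have rw : (r < (size w).+1)%N by rewrite ltnS -rs leq_addr.
have cN m : count id (nseq m true) = m by rewrite count_nseq mul1n.
have cN' m : count id (nseq m false) = 0%N by rewrite count_nseq mul0n.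
rewrite /G ncsM_split (bigD1 (Ordinal rw)) //= big1 ?addr0; last first.
  move=> i; rewrite -val_eqE /= !nexp_letter => ir.
  case: eqP => [e1|_]; last by rewrite mul0r.
  case: eqP => [e2|_]; last by rewrite mulr0.
  case/eqP: ir; rewrite /r; symmetry.
  have : count id (take i w ++ drop i w) = i; last by rewrite cat_take_drop.
  by rewrite count_cat e1 e2 cN cN' addn0 size_takel // -ltnS.
have rw' : (r <= size w)%N by [].
rewrite !nexp_letter size_takel // size_drop -rs addKn.
have -> : (w == nseq r true ++ nseq s false) =
   (take r w == nseq r true) && (drop r w == nseq s false).
  rewrite -{1}(cat_take_drop r w) eqseq_cat // size_takel ?size_nseq //.
case: w r s rs rw rw' => [|x w] r s rs rw rw'.
  have /eqP := rs; rewrite addn_eq0 => /andP[/eqP-> /eqP->].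
  by rewrite /= exp_coef0 mulr1 subrr.
rewrite subr0 /=; case: eqP => _ /=; last by rewrite mul0r.
case: eqP => _; last by rewrite mulr0.
by rewrite /exp_coef natrM invfM.
Qed.

Lemma expexp_powE m w : iter m (fun c => (G - 1) * c) 1 w = expexp_pow_coef m w.
Proof.
elim: m w => [|m IH] w /=; first by rewrite ncs1; case: w.
by rewrite ncsM_split; apply: eq_bigr => i _; rewrite expexp_coefE IH.
Qed.

Lemma G1_nil : (G - 1) [::] = 0.
Proof. by rewrite expexp_coefE. Qed.

Let l : ncs bool := nser log_coef (G - 1).

Lemma logexpexp_coefE w : l w = logexpexp_coef w.
Proof.
have nG := nilop_mul G1_nil.
rewrite /l /nser /oser (@ncs_lsum _ _ w (size w).+2) //; last first.
  by move=> n; apply: oser_fil.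
under eq_bigr => i _ do rewrite ncs_qscale ncsZ expexp_powE.
rewrite /logexpexp_coef big_ord_recr big_ord_recl.
have -> : expexp_pow_coef (size w).+1 w = 0.
  rewrite -expexp_powE; apply: (nilop_iter nG (size w).+1 (fil_1 (1 : ncs bool))).
  by rewrite addn1.
by rewrite /= mulr0 addr0 mul0r add0r big_add1 big_mkord.
Qed.

Lemma l_nil : l [::] = 0.
Proof. by rewrite logexpexp_coefE /logexpexp_coef big_geq. Qed.
Let lp := ncp_mk l_nil.

Lemma nexp_l : nexp l = G.
Proof.
have nG := nilop_mul G1_nil.
rewrite /nexp {1}/nser.
have -> : (fun c => l * c) = oser log_coef (fun c => (G - 1) * c).
  by apply/funext => c; rewrite nser_mul // G1_nil.
by rewrite oser_exp_log // mulr1 addrC subrK.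
Qed.

Lemma act_nexp (a : ncs bool) y : a [::] = 0 ->
  act T (nexp a) y = oser exp_coef (act T a) y.
Proof. by move=> a0; rewrite /nexp /nser act_oser // act1. Qed.

Lemma act_exp_letter b y : act T (nexp (lt b)) y = Ad (letterp b) y.
Proof.
rewrite act_nexp; last exact: letter_nil.
have -> // : act T (lt b) = ad (letterp b).
by apply/funext => z; rewrite act_letter.
Qed.

Lemma G_cancel (a b : ncs bool) : a * G = b * G -> a = b.
Proof.
move=> h; have := congr1 (fun c => c * nexp (- l)) h.
by rewrite -nexp_l -!mulrA nexpN ?mulr1 // l_nil.
Qed.

(** For a Lie series this would be clear, but l is not yet known to be one. Both operators have the
    same exponential, namely conjugation by G = e^A e^B, and exponentials of operators are
    injective. *)
Lemma act_l y : act T l y = [l: lp, y].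
Proof.
have nl : nilop (act T l) by apply: nilop_act => //; apply: l_nil.
apply: (oser_exp_inj nl (nilop_ad lp)) => z; rewrite -AdE.
rewrite -act_nexp ?l_nil // nexp_l actM // !act_exp_letter.
apply: ncp_inj; apply: G_cancel.
rewrite -[in RHS]nexp_l (val_Ad lp z) -/l nexp_l /G mulrA (val_Ad A) -!mulrA.
by rewrite (val_Ad B).
Qed.

Local Notation dynT := (dyn (fun b : bool => letterp b)).

Lemma euler_letter (b : bool) : eulerp (letterp b) = letterp b.
Proof.
apply/ncp_inj/funext => w; rewrite /= /euler /letter.
by case: eqP => [->|_]; rewrite ?mul1r ?mulr0.
Qed.

Lemma dyn_exp_letter (b : bool) : dynT (nexp (lt b)) = letterp b.
Proof.
rewrite dyn_oser_eps // dyn_letter oser_recl; last exact: nilop_act.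
rewrite act_letter // /ad lbrxx oser0 ?addr0; last exact: nilop_act.
by rewrite /eps_coef invr1 qscale1.
Qed.

Lemma euler_exp_letter (b : bool) : euler (nexp (lt b)) = lt b * nexp (lt b).
Proof.
rewrite (euler_exp (letterp b)) euler_letter oser_recl; last exact: nilop_ad.
rewrite /ad lbrxx oser0 ?addr0; last exact: nilop_ad.
by rewrite /eps_coef invr1 qscale1.
Qed.

(** The invertible series eps(ad l) sends both sides to A + Ad(e^A)(B): the left by [dyn_oser_eps],
    the right by [euler_exp], after computing [dyn] and [euler] of G from its two factors. *)
Lemma dyn_l : dynT l = eulerp lp.
Proof.
have nl := nilop_ad lp.
rewrite -[LHS](oser_bern_eps nl) -[RHS](oser_bern_eps nl); congr oser.
have <- : dynT G = oser eps_coef (ad lp) (dynT l).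
  rewrite -nexp_l dyn_oser_eps; last exact: l_nil.
  have -> // : act T l = ad lp.
  by apply/funext => y; apply: act_l.
apply/ncp_inj/G_cancel; rewrite -[in RHS]nexp_l -(euler_exp lp) -/l nexp_l.
rewrite /G dynM // act_exp_letter !dyn_exp_letter nexp_nil // qscale1.
rewrite eulerM !euler_exp_letter ncp_valD mulrDl addrC !mulrA.
by rewrite (val_Ad A B).
Qed.

(** On brackets of length n [euler] is multiplication by n, which cancels the factor 1/n of Dynkin's
    series; so [euler] of [bch A B] is [dyn] of l, which is [euler] of l. *)
Lemma ncp_val_bch : ncp_val (bch A B) = l.
Proof.
apply: euler_inj; first by rewrite ncp_nil l_nil.
rewrite -[euler (ncp_val _)]/(ncp_val (eulerp (bch A B))) -[euler l]/(ncp_val (eulerp lp)).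
congr ncp_val; rewrite -dyn_l.
have eD : {morph (@eulerp bool) : x y / x + y}.
  by move=> x y; apply/ncp_inj/eulerD.
have eq q x : eulerp (qscale q x) = qscale q (eulerp x) by apply/ncp_inj/eulerZ.
have e0 : eulerp 0 = 0 :> ncp bool by apply: (addrI (eulerp 0)); rewrite -eD !addr0.
have er (s : seq bool) : eulerp (rbracket (map (@letterp bool) s)) =
    qscale (size s)%:R (rbracket (map (@letterp bool) s)).
  elim: s => [|x [|y s] IH]; first by rewrite e0 qscaler0.
    by rewrite /= euler_letter qscale1.
  have ebr u v : eulerp [l: u, v] = [l: eulerp u, v] + [l: u, eulerp v].
    apply/ncp_inj; set a := ncp_val u; set b := ncp_val v.
    change (euler (a * b - b * a) =
      (euler a * b - b * euler a) + (a * euler b - euler b * a)).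
    rewrite -[- (b * a)]scaleN1r eulerD eulerZ !eulerM scaleN1r opprD; zmod.
  rewrite [rbracket _]/= ebr euler_letter; move: IH; rewrite [rbracket _]/= => ->.
  by rewrite lbr_qscaler -{1}[ [l: _, _] ]qscale1 -qscaleDl addrC natr1.
rewrite [bch A B](_ : _ = lsum (bch_term A B)) //.
rewrite (lsum_morph (f := @eulerp bool)) //; last 3 first.
- by move=> n; exists n => x; apply: fil_euler.
- by move=> n; apply: fil_bch_term.
- by move=> n; apply: fil_euler; apply: (fil_bch_term A B n).
congr lsum; apply/funext => n.
have -> : bch_term A B n = qscale n%:R^-1 (dyn_term (@letterp bool) l n).
  congr qscale; apply: eq_bigr => w _; rewrite logexpexp_coefE; congr (qscale _ (rbracket _)).
  by apply: eq_map => -[].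
rewrite eq (big_morph _ eD e0) qscale_sumr; apply: eq_bigr => w _.
rewrite eq er size_tuple !qscaleA.
(* In degree 0 the inverse of 0 is 0 by convention, and the empty bracket vanishes as well. *)
case: n w => [|n] w; last by rewrite mulrAC mulVf ?natr_rat_neq0 ?mul1r.
have -> : tval w = [::] by case: w => -[].
by rewrite /= !qscaler0.
Qed.

Lemma nexp_bch_letters : nexp (ncp_val (bch A B)) = nexp (lt true) * nexp (lt false).
Proof. by rewrite ncp_val_bch nexp_l. Qed.
End Dynkin.

Section Substitution.
Variables (X : Type) (c d : ncp X).
Let T (b : bool) (m : ncs X) := ncp_val (if b then c else d) * m.
Let nT b : nilop (T b). Proof. exact/nilop_mul/ncp_nil. Qed.

Let sub (a : ncs bool) : ncs X := act T a 1.

Let act_sub a m : act T a m = sub a * m.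
Proof.
symmetry; rewrite -{2}(mul1r m); apply: (act_morph nT (f := fun x => x * m)) => //.
- by move=> x y; apply: mulrDl.
- by move=> q x; apply: ncsMZl.
- by move=> n; exists n => x; apply: fil_ncsMr.
- by move=> b x; rewrite /T mulrA.
Qed.

Let fil_sub n a : fil n a -> fil n (sub a).
Proof.
case: n => [|n] h; first exact: fil_any.
by rewrite -addn1; apply: fil_act.
Qed.

Let sub_nil a : a [::] = 0 -> sub a [::] = 0.
Proof. by move=> a0; apply: (@fil_sub 2) => // -[]. Qed.

Let subp (a : ncp bool) : ncp X := ncp_mk (sub_nil (ncp_nil a)).

Let subM a b : sub (a * b) = sub a * sub b.
Proof. by rewrite {1}/sub actM // act_sub. Qed.

Let subp_morph : clie_morph idfun subp.
Proof.
split.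
- by move=> x y; apply/ncp_inj/actDl.
- by move=> q x; apply/ncp_inj/actZ.
- move=> x y; apply/ncp_inj.
  change (sub (ncp_val x * ncp_val y - ncp_val y * ncp_val x) =
    sub (ncp_val x) * sub (ncp_val y) - sub (ncp_val y) * sub (ncp_val x)).
  rewrite -!subM -[- (ncp_val y * _)]scaleN1r {1}/sub actDl // actZ //.
  by rewrite [qscale _ _]scaleN1r.
- by move=> n; exists n => x; apply: fil_sub.
Qed.

Let sub_nexp a : a [::] = 0 -> sub (nexp a) = nexp (sub a).
Proof.
move=> a0; rewrite /sub {1}/nexp {1}/nser act_oser // act1 // /nexp /nser.
by congr oser; apply/funext => m; apply: act_sub.
Qed.

Let subp_letter b : subp (letterp b) = if b then c else d.
Proof. by apply/ncp_inj; rewrite /= /sub act_letter // /T mulr1. Qed.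

(** Substituting c and d for the two letters is multiplicative on series and a Lie morphism on
    [ncp], so the identity for letters specializes. *)
Lemma nexp_bch : nexp (ncp_val (bch c d)) = nexp (ncp_val c) * nexp (ncp_val d).
Proof.
have -> : bch c d = subp (bch (letterp true) (letterp false)).
  by rewrite (clie_bch subp_morph) !subp_letter.
rewrite -sub_nexp ?ncp_nil // nexp_bch_letters subM !sub_nexp //.
have val_letter b : sub (letter b) = ncp_val (if b then c else d).
  by rewrite -subp_letter.
by rewrite !val_letter.
Qed.
End Substitution.

Lemma bchE (k : qalgType) (L : clieType k) (x y : L) : bch x y = lsum (bch_term x y).
Proof. by []. Qed.

Opaque lsum.

(** * Presented Lie algebras and the group laws *)

Section HatMorph.
Variables (k k' : qalgType) (phi : {rmorphism k -> k'}) (X : Type).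
Variables (rel : lterm k X -> Prop) (L : clieType k') (f : hat rel -> L).
Hypothesis fM : clie_morph phi f.

Definition hev (t : lterm k X) : hat rel := \pi_(hat rel)%qT (cconst rel t).

Lemma hev_gen x : hev (LGen x) = hgen rel x. Proof. by []. Qed.
Lemma hev_zero : hev LZero = 0. Proof. by []. Qed.
Lemma hev_add t u : hev (LAdd t u) = hev t + hev u.
Proof. by rewrite /hev hatD; apply/hatP => n; apply: LC_refl. Qed.
Lemma hev_scale a t : hev (LScale a t) = a *: hev t.
Proof. by rewrite /hev hatZ; apply/hatP => n; apply: LC_refl. Qed.
Lemma hev_br t u : hev (LBr t u) = [l: hev t, hev u].
Proof.
rewrite [RHS](hat_brE (cconst rel t) (cconst rel u)).
by apply/hatP => n; apply: LC_refl.
Qed.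
Lemma fil_hev t : fil (ldeg t) (hev t).
Proof. by apply/hat_filE; apply: LC_deg. Qed.

(** Reduces statements about the completion to inductions on terms, without losing the order n of
    the element. *)
Lemma hat_approx n m (x : hat rel) : fil n x -> (n <= m)%N ->
  exists2 d, ldeep n d & fil m (x - hev d).
Proof.
elim/hat_ind: x => s hs nm; have [d dn sd] := lcong_ldeep (hat_fil_lift hs nm) nm.
exists d => //; apply/hat_filB.
exact: sd.
Qed.

Lemma fil_hev_morph t : fil (ldeg t) (f (hev t)).
Proof.
have [fD fZ fbr fc] := fM.
have f0 x : fil 0 (f x) by apply: fil_any.
by elim: t => //= [x|t ht u hu]; [apply: fil_1|rewrite hev_br fbr; apply: fil_lbr].
Qed.

(** Continuity takes care of a remainder of high order; on brackets of degree n the bound is clear,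
    because generators go to F^1, which is everything. *)
Lemma fil_hat_morph n x : fil n x -> fil n (f x).
Proof.
have [fD fZ fbr fc] := fM; have [m hm] := fc n => hx.
have [d dn hd] := hat_approx hx (leq_maxr m n).
rewrite -[x](subrK (hev d)) fD; apply: fil_D.
  by apply: hm; apply: fil_le hd; apply: leq_maxl.
elim: dn => {d hd} [|t u _ ht _ hu|a t _ ht|t ht].
- by rewrite hev_zero (clie0 fM); apply: fil_0.
- by rewrite hev_add fD; apply: fil_D.
- by rewrite hev_scale fZ; apply: fil_Z.
- by apply: fil_le ht _; apply: fil_hev_morph.
Qed.
End HatMorph.

(** * The free Lie algebra inside noncommutative power series *)

Section FreeEmbedding.
Variables (X : finType).
Local Notation F := (hat (@no_rel rat X)).
Local Notation ev := (hev (@no_rel rat X)).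
Variable i : F -> ncp X.
Hypothesis iM : clie_morph idfun i.
Hypothesis i_gen : forall x, i (hgen _ x) = letterp x.

Let iM' : clie_morph (GRing.RMorphism.sort (idfun : {rmorphism rat -> rat})) i := iM.
Let w (t : lterm rat X) : ncs X := ncp_val (i (ev t)).
Let D : ncs X -> F := dyn (fun x => hgen (@no_rel rat X) x).

Let w_br t u : w (LBr t u) = w t * w u - w u * w t.
Proof. by rewrite /w hev_br; case: iM => _ _ -> _. Qed.
Let w_add t u : w (LAdd t u) = w t + w u.
Proof. by rewrite /w hev_add; case: iM => -> _ _ _. Qed.
Let w_scale a t : w (LScale a t) = a *: w t.
Proof. by rewrite /w hev_scale; case: iM => _ -> _ _. Qed.
Let w_nil t : w t [::] = 0. Proof. exact: ncp_nil. Qed.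

(** The action of words through [ad] is a representation, so a bracket of letters acts as the [ad]
    of that bracket; the condition on c removes the second term of [dynM]. *)
Let dyn_w t c : c [::] = 0 -> D (w t * c) = [l: ev t, D c].
Proof.
elim: t c => [x||t ht u hu|a t ht|t ht u hu] c c0.
- rewrite /w hev_gen i_gen /D dynM c0 qscale0 addr0 act_letter //.
  by move=> y; apply: nilop_ad.
- by rewrite /w hev_zero (clie0 iM') mul0r lbr0 /D dyn0.
- by rewrite w_add mulrDl hev_add lbrDl -ht // -hu //; apply: dynD.
- rewrite w_scale ncsMZl hev_scale lbrZl -ht //; exact: dynZ.
- rewrite w_br mulrBl -!mulrA /D dynB -/D ht; last by rewrite ncsM_nil c0 mulr0.
  rewrite hu // hu; last by rewrite ncsM_nil c0 mulr0.
  by rewrite ht // hev_br lbr_leibnizl.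
Qed.

(* Dynkin-Specht-Wever: D multiplies brackets of degree n by n. *)
Let dyn_ev t : fil (ldeg t).+1 (D (w t) - ev t *+ ldeg t).
Proof.
elim: t => [x||t ht u hu|a t ht|t ht u hu] /=; try exact: fil_1.
  rewrite /w hev_gen i_gen mulr1n /D dyn_letter subrr; exact: fil_0.
rewrite w_br /D dynB -/D !dyn_w // hev_br.
set m := ldeg t; set n := ldeg u.
have -> : [l: ev t, D (w u)] - [l: ev u, D (w t)] - [l: ev t, ev u] *+ (m + n) =
   [l: ev t, D (w u) - ev u *+ n] + [l: D (w t) - ev t *+ m, ev u].
  rewrite lbrBr lbrBl -!qscale_nat lbr_qscaler lbr_qscalel natrD qscaleDl.
  rewrite (lbrC (ev u)); zmod.
apply: fil_D; first by rewrite -addnS; apply: fil_lbr => //; apply: fil_hev.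
by rewrite -addSn; apply: fil_lbr => //; apply: fil_hev.
Qed.

(** Let u in F^{n+1} be killed by i, with leading part d. Then D(w d) lies in F^{n+2} because w d
    does, and it is congruent to (n + 1) d; dividing by n + 1 gives u in F^{n+2}, and separatedness
    concludes. *)
Lemma free_embedding_injective : injective i.
Proof.
have i0 u : i u = 0 -> u = 0.
  move=> iu; apply: fil_sep => n; apply: (@fil_le _ _ _ n.+1) => //.
  elim: n => [|n IH]; first exact: fil_1.
  have [d dn hd] := hat_approx IH (leqnSn n.+1).
  have Dd : fil n.+2 (D (w d)).
    have -> : w d = ncp_val (i (ev d - u)) by rewrite (clieB iM') iu subr0.
    apply: fil_dyn; apply/ncp_filE; apply: (fil_hat_morph iM').
    by apply: fil_subC.
  have hd' : fil n.+2 (D (w d) - ev d *+ n.+1).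
    elim: dn {hd Dd} => [|t v _ ht _ hv|a t _ ht|t].
    - by rewrite /w hev_zero (clie0 iM') /D dyn0 mul0rn subrr; apply: fil_0.
    - rewrite w_add /D dynD -/D hev_add mulrnDl opprD addrACA; exact: fil_D.
    - rewrite w_scale /D dynZ -/D hev_scale scalerMnr -[qscale _ _]/(_ *: _) -scalerBr.
      exact: fil_Z.
    rewrite leq_eqVlt => /orP[/eqP-> //|tn]; last apply: fil_B.
    - apply: (@fil_le _ _ _ (ldeg t)) => //; apply: fil_dyn; apply/ncp_filE.
      exact: (fil_hev_morph iM').
    - rewrite -qscale_nat; apply/fil_qscale.
      by apply: (@fil_le _ _ _ (ldeg t)) => //; apply: fil_hev.
  have : fil n.+2 (ev d *+ n.+1).
    have -> : ev d *+ n.+1 = D (w d) - (D (w d) - ev d *+ n.+1) by rewrite subKr.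
    exact: fil_B.
  by move/fil_natmul; apply: fil_sub_congr.
move=> u v iuv; apply/eqP; rewrite -subr_eq0; apply/eqP/i0.
by rewrite (clieB iM') iuv subrr.
Qed.
End FreeEmbedding.

Section NexpConj.
Variable X : Type.

Lemma nexp_inj (a b : ncp X) : nexp (ncp_val a) = nexp (ncp_val b) -> a = b.
Proof.
move=> h; apply: ncp_inj; rewrite -[LHS]mulr1 -[RHS]mulr1.
apply: (oser_exp_inj (nilop_mul (ncp_nil a)) (nilop_mul (ncp_nil b))) => y.
by rewrite -!nser_mul ?ncp_nil // -/(nexp _) h.
Qed.

Lemma nexp_Ad (a b : ncp X) :
  nexp (ncp_val (Ad a b)) = nexp (ncp_val a) * nexp (ncp_val b) * nexp (- ncp_val a).
Proof.
set g := nexp (ncp_val a); set h := nexp (- ncp_val a).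
have gh : g * h = 1 by apply/nexpN/ncp_nil.
have hg : h * g = 1 by apply/nexpNK/ncp_nil.
have e : ncp_val (Ad a b) = g * ncp_val b * h.
  by rewrite -(val_Ad a b) -mulrA gh mulr1.
have -> : g * nexp (ncp_val b) * h =
  oser exp_coef (fun m => ncp_val (Ad a b) * m) (g * 1 * h).
  apply: (lsum_morph_oser (f := fun m => g * m * h)); try exact/nilop_mul/ncp_nil.
  - by move=> x y; rewrite mulrDr mulrDl.
  - by move=> q x; rewrite !ncs_qscale ncsMZr ncsMZl.
  - move=> n; exists n => x hx; apply/fil_ncsMr.
    by rewrite -[n]add0n; apply: ncs_filM.
  - by move=> m; rewrite e -!mulrA (mulrA h) hg mul1r.
by rewrite mulr1 gh.
Qed.
Opaque nexp bch.

Lemma ncp_bchA (a b c : ncp X) : bch a (bch b c) = bch (bch a b) c.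
Proof.
apply: nexp_inj; apply: etrans (nexp_bch a (bch b c)) _.
apply: etrans (congr1 (fun u => nexp (ncp_val a) * u) (nexp_bch b c)) _.
apply: etrans (mulrA _ _ _) _.
apply: etrans (congr1 (fun u => u * nexp (ncp_val c)) (esym (nexp_bch a b))) _.
exact: esym (nexp_bch (bch a b) c).
Qed.

Lemma ncp_bch_conj (a b : ncp X) : bch (bch a b) (- a) = Ad a b.
Proof.
apply: nexp_inj; rewrite (nexp_bch (bch a b) (- a)) (nexp_bch a b) (nexp_Ad a b).
by rewrite ncp_valN.
Qed.
End NexpConj.

(** * Group laws of exp(L) *)

Section GroupLaws.
Variables (k : qalgType) (L : clieType k).
Implicit Types x y z : L.

Let F := hat (@no_rel rat 'I_3).

(** A group law involves at most three elements. It is checked in power series, pulled back to the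
    free Lie algebra over [rat] on three generators, and evaluated in L by [free3_lift]. *)
Lemma free3_embedding : exists2 i : F -> ncp 'I_3, clie_morph idfun i & injective i.
Proof.
have [|i [iM ig]] := @hat_lift rat rat 'I_3 (@no_rel rat 'I_3) idfun (ncp 'I_3)
   (fun j => letterp j); first by move=> t [].
by exists i => //; apply: free_embedding_injective ig.
Qed.

Lemma free3_lift x y z : exists f : F -> L,
  [/\ clie_morph (@ofQ k) f, f (hgen _ 0) = x, f (hgen _ 1) = y & f (hgen _ 2%:R) = z].
Proof.
have [|f [fM fg]] := @hat_lift rat k 'I_3 (@no_rel rat 'I_3) (@ofQ k) L
  (fun i => if i == 0 then x else if i == 1 then y else z); first by move=> t [].
by exists f; split; rewrite ?fg.
Qed.

Lemma emulA x y z : x \*e (y \*e z) = x \*e y \*e z.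
Proof.
have [f [fM <- <- <-]] := free3_lift x y z; have [i iM iI] := free3_embedding.
have iM' : clie_morph (GRing.RMorphism.sort (idfun : {rmorphism rat -> rat})) i := iM.
rewrite /emul -!(clie_bch fM); congr f; apply: iI; rewrite !(clie_bch iM').
exact: ncp_bchA.
Qed.

Lemma emul_conj x y : x \*e y \*e (- x) = Ad x y.
Proof.
have [f [fM <- <- _]] := free3_lift x y 0; have [i iM iI] := free3_embedding.
have iM' : clie_morph (GRing.RMorphism.sort (idfun : {rmorphism rat -> rat})) i := iM.
rewrite /emul -(clieN fM) -!(clie_bch fM) -(clie_Ad fM); congr f; apply: iI.
rewrite !(clie_bch iM') (clieN iM') (clie_Ad iM').
exact: ncp_bch_conj.
Qed.

Lemma bch_term1 x y : bch_term x y 1 = x + y.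
Proof.
have c1 b : logexpexp_coef [:: b] = 1.
  rewrite /logexpexp_coef big_nat1 expr0 divr1 mul1r /= !big_ord_recr big_ord0 /=.
  by case: b; rewrite /expexp_coef /= ?mul0r ?mulr0 ?add0r ?addr0 invr1 mulr1.
rewrite /bch_term invr1 qscale1.
rewrite (@sum_tuple_cons _ _ _ (fun w => qscale (logexpexp_coef w)
   (rbracket [seq if b then x else y | b : bool <- w]))).
rewrite big_bool.
rewrite !(@sum_tuple0 _ _ (fun w => qscale (logexpexp_coef (_ :: w))
   (rbracket [seq if b then x else y | b : bool <- _ :: w]))).
by rewrite !c1 !qscale1.
Qed.

Lemma bch_term0 x y : bch_term x y 0 = 0.
Proof. by rewrite /bch_term invr0 qscale0. Qed.

Lemma emul_mod2 x y : fil 2 (x \*e y - (x + y)).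
Proof.
have := lsumP (fil_bch_term x y) (leqnn 2).
by rewrite /emul bchE big_ord_recr big_ord1 /= bch_term0 add0r bch_term1.
Qed.

Lemma emul_comm x y : [l: x, y] = 0 -> x \*e y = x + y.
Proof.
move=> xy; have yx : [l: y, x] = 0 by rewrite lbrC xy oppr0.
rewrite /emul bchE; apply: lsum_unique => [n|n]; first exact: fil_bch_term.
have r2 (s : seq bool) : rbracket [seq if b then x else y | b : bool <- s] = 0 \/ (size s <= 1)%N.
  elim: s => [|a [|b [|c s]] IH]; rewrite ?lbr0r; [by right|by right| |].
    by left; case: a {IH}; case: b => /=; rewrite ?lbrxx.
  by case: IH => // h; left; move: h => /= ->; rewrite lbr0r.
have big m : bch_term x y m.+2 = 0.
  rewrite /bch_term big1 ?qscaler0 // => w _.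
  by case: (r2 w) => [->|]; rewrite ?qscaler0 // size_tuple.
case: n => [|[|n]]; try by apply: fil_any.
have -> : \sum_(i < n.+2) bch_term x y i = x + y.
  rewrite big_ord_recl big_ord_recl [bch_term x y ord0]bch_term0 bch_term1 add0r.
  by rewrite big1 ?addr0 // => i _; apply: big.
by rewrite subrr; apply: fil_0.
Qed.

Lemma emulx0 x : x \*e 0 = x.
Proof. by rewrite emul_comm ?lbr0r ?addr0. Qed.
Lemma emul0x x : 0 \*e x = x.
Proof. by rewrite emul_comm ?lbr0 ?add0r. Qed.
Lemma emulxN x : x \*e (- x) = 0.
Proof. by rewrite emul_comm ?subrr // lbrNr lbrxx oppr0. Qed.
Lemma emulNx x : (- x) \*e x = 0.
Proof. by rewrite emul_comm ?addNr // lbrNl lbrxx oppr0. Qed.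
Lemma emulK x y : x \*e y \*e (- y) = x.
Proof. by rewrite -emulA emulxN emulx0. Qed.
Lemma emulNK x y : x \*e (- y) \*e y = x.
Proof. by rewrite -emulA emulNx emulx0. Qed.
Lemma emulNKl x y : - x \*e (x \*e y) = y.
Proof. by rewrite emulA emulNx emul0x. Qed.
Lemma emul_lcan x : injective (fun y => x \*e y).
Proof. by move=> y z h; rewrite -(emulNKl x y) h emulNKl. Qed.
Lemma emul_rcan x : injective (fun y => y \*e x).
Proof. by move=> y z h; rewrite -(emulK y x) h emulK. Qed.
Lemma emulN x y : - (x \*e y) = (- y) \*e (- x).
Proof. by apply: (@emul_lcan (x \*e y)); rewrite emulxN emulA emulK emulxN. Qed.

Lemma Ad_mul x y z : Ad (x \*e y) z = Ad x (Ad y z).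
Proof. by rewrite -!emul_conj emulN !emulA. Qed.
Lemma Ad0l x : Ad 0 x = x.
Proof. by rewrite -emul_conj oppr0 emulx0 emul0x. Qed.
Lemma AdK x y : Ad x (Ad (- x) y) = y.
Proof. by rewrite -Ad_mul emulxN Ad0l. Qed.
Lemma AdNK x y : Ad (- x) (Ad x y) = y.
Proof. by rewrite -Ad_mul emulNx Ad0l. Qed.
Lemma AdDr x y z : Ad x (y + z) = Ad x y + Ad x z.
Proof. exact: (oserDr (nilop_ad x) exp_coef). Qed.
Lemma Ad0 x : Ad x 0 = 0. Proof. exact: (oser0 (nilop_ad x) exp_coef). Qed.
Lemma AdN x y : Ad x (- y) = - Ad x y. Proof. exact: (oserN (nilop_ad x) exp_coef). Qed.
Lemma AdB x y z : Ad x (y - z) = Ad x y - Ad x z. Proof. exact: (oserB (nilop_ad x) exp_coef). Qed.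
Lemma AdZ x (a : k) y : Ad x (a *: y) = a *: Ad x y.
Proof.
have it n : iter n (ad x) (a *: y) = a *: iter n (ad x) y.
  by elim: n => //= n ->; rewrite /ad lbrZr.
rewrite !AdE /oser; symmetry; rewrite (lsum_morph (f := fun z => a *: z)).
- by congr lsum; apply/funext => n; rewrite it /qscale !scalerA mulrC.
- exact: scalerDr.
- by move=> n; exists n => z; apply: fil_Z.
- exact/oser_fil/nilop_ad.
- by move=> n; apply/fil_Z/oser_fil/nilop_ad.
Qed.
Lemma Ad_emul x y z : Ad x (y \*e z) = Ad x y \*e Ad x z.
Proof. by rewrite -!emul_conj !emulA emulNK. Qed.
Lemma fil_Ad n x y : fil n y -> fil n (Ad x y).
Proof. exact: (fil_oser (nilop_ad x) exp_coef). Qed.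

Lemma Ad_fix x y : [l: x, y] = 0 -> Ad x y = y.
Proof.
move=> xy; rewrite AdE oser_exp; last exact: nilop_ad.
rewrite (oser_comm _ _ (nilop_ad x) (nilop_ad x)) // [ad x y]xy.
by rewrite (oser0 (nilop_ad x)) addr0.
Qed.
Lemma Ad_fix_lbr x y : Ad x y = y -> [l: x, y] = 0.
Proof. exact: (oser_exp_fix (nilop_ad x)). Qed.
Lemma emul_comm_lbr x y : x \*e y = y \*e x -> [l: x, y] = 0.
Proof. by move=> xy; apply: Ad_fix_lbr; rewrite -emul_conj xy emulK. Qed.
Lemma emul_Ad x y : x \*e y = Ad x y \*e x.
Proof. by rewrite -emul_conj emulNK. Qed.

(** Apply [oser_exp_conj] to the operator [ad y]: its iterated commutators with [ad x] are the [ad]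
    of the ad(x)^n(y). *)
Lemma Ad_lbr x y z : Ad x [l: y, z] = [l: Ad x y, Ad x z].
Proof.
pose Y n (b : L) := [l: iter n (ad x) y, b].
have nx := nilop_ad x.
have YS n b : Y n.+1 b = ad x (Y n b) - Y n (ad x b).
  by rewrite /Y /= /ad lbr_leibniz addrK.
have Yf n b : fil n b -> fil n (Y 0%N b).
  by move=> h; apply: (@fil_le _ _ _ n.+1) => //; apply: fil_lbrr.
have := oser_exp_conj nx (Ad x z) (lbrDr _) (fun q b => lbr_qscaler q _ b) Yf YS.
have -> : oser exp_coef (fun b => - ad x b) (Ad x z) = z.
  rewrite -[RHS](AdNK x z); congr oser; apply/funext => b.
  by rewrite /ad lbrNl.
rewrite /Y /= -[oser _ _ _]/(Ad x _) => ->; symmetry.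
have fY n : fil n (qscale (exp_coef n) (iter n (ad x) y)) by apply: oser_fil.
have -> : (fun n => qscale (exp_coef n) [l: iter n (ad x) y, Ad x z]) =
    (fun n => [l: qscale (exp_coef n) (iter n (ad x) y), Ad x z]).
  by apply/funext => n; rewrite lbr_qscalel.
apply: (@lsum_morph _ _ _ _ (fun b => [l: b, Ad x z])) => //.
- by move=> a b; apply: lbrDl.
- move=> n; exists n => b h; apply: (@fil_le _ _ _ n.+1) => //; exact: fil_lbrl.
- move=> n; apply: (@fil_le _ _ _ n.+1) => //; exact: fil_lbrl.
Qed.
End GroupLaws.

Lemma clie_comp (k1 k2 k3 : qalgType) (phi : k1 -> k2) (psi : k2 -> k3)
  (L1 : clieType k1) (L2 : clieType k2) (L3 : clieType k3) (f : L1 -> L2) (g : L2 -> L3) :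
  clie_morph phi f -> clie_morph psi g -> clie_morph (psi \o phi) (g \o f).
Proof.
move=> [fD fZ fb fc] [gD gZ gb gc]; split=> [x y|a x|x y|n] /=.
- by rewrite fD gD.
- by rewrite fZ gZ.
- by rewrite fb gb.
- have [m hm] := gc n; have [p hp] := fc m; exists p => x /hp; exact: hm.
Qed.

Lemma clie_id (k : qalgType) (L : clieType k) : clie_morph idfun (@id L).
Proof. by split=> // n; exists n. Qed.

Lemma clie_Ad_morph (k : qalgType) (L : clieType k) (z : L) : clie_morph idfun (Ad z).
Proof.
split=> [x y|a x|x y|n]; [exact: AdDr|exact: AdZ|exact: Ad_lbr|].
by exists n => x; apply: fil_Ad.
Qed.

Lemma hev_rel (k : qalgType) (X : Type) (rel : lterm k X -> Prop) t :
  rel t -> hev rel t = 0.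
Proof. by move=> h; apply/hatP => n; apply: LC_rel. Qed.

(** * Substitution into elements of the free Lie algebra on A and B *)

Section F2.
Variables (k : qalgType).

Lemma f2_hom_unique (k' : qalgType) (phi : {rmorphism k -> k'}) (L : clieType k')
  (f g : f2 k -> L) : clie_morph phi f -> clie_morph phi g ->
  f (fA k) = g (fA k) -> f (fB k) = g (fB k) -> f =1 g.
Proof.
by move=> fM gM hA hB x; rewrite (hat_lift_unique fM gM) // => -[].
Qed.

Section Subst.
Variables (L : clieType k) (a b : L).

Lemma f2_substP : [/\ clie_morph idfun (f2_subst a b), f2_subst a b (fA k) = a &
  f2_subst a b (fB k) = b].
Proof.
have [|f [fM fE]] := @hat_lift k k bool (@no_rel k bool) idfun L
   (fun x => if x then a else b); first by move=> t [].
have := @xgetPex _ (fun=> 0) [set f | [/\ clie_morph idfun f, f (fA k) = a & f (fB k) = b]].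
by apply; exists f; split=> //; apply: fE.
Qed.

Lemma f2_subst_morph : clie_morph idfun (f2_subst a b).
Proof. by case: f2_substP. Qed.
Lemma f2_substA : f2_subst a b (fA k) = a. Proof. by case: f2_substP. Qed.
Lemma f2_substB : f2_subst a b (fB k) = b. Proof. by case: f2_substP. Qed.

Lemma f2_subst_unique (f : f2 k -> L) : clie_morph idfun f ->
  f (fA k) = a -> f (fB k) = b -> f =1 f2_subst a b.
Proof.
move=> fM fa fb; apply: (@f2_hom_unique _ idfun) => //; first exact: f2_subst_morph.
- by rewrite fa f2_substA.
- by rewrite fb f2_substB.
Qed.
End Subst.

Lemma f2_subst_hom (L L' : clieType k) (f : L -> L') a b g : clie_morph idfun f ->
  f (f2_subst a b g) = f2_subst (f a) (f b) g.
Proof.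
move=> fM; apply: (@f2_subst_unique L' (f a) (f b) (f \o f2_subst a b)).
- exact: (clie_comp (f2_subst_morph a b) fM).
- by rewrite /= f2_substA.
- by rewrite /= f2_substB.
Qed.

(** [Ad z] is a Lie morphism fixing a and b, hence it fixes g(a, b); no induction on g is
    required. *)
Lemma f2_subst_comm (L : clieType k) (z a b : L) g :
  [l: z, a] = 0 -> [l: z, b] = 0 -> [l: z, f2_subst a b g] = 0.
Proof.
move=> za zb; apply: Ad_fix_lbr; rewrite (f2_subst_hom _ _ _ (clie_Ad_morph z)).
by rewrite !Ad_fix.
Qed.

Lemma f2_subst_Ad (L : clieType k) (z a b : L) g :
  Ad z (f2_subst a b g) = f2_subst (Ad z a) (Ad z b) g.
Proof. exact/f2_subst_hom/clie_Ad_morph. Qed.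

Lemma f2_mapP (k' : qalgType) (phi : {rmorphism k -> k'}) :
  [/\ clie_morph phi (f2_map phi), f2_map phi (fA k) = fA k' & f2_map phi (fB k) = fB k'].
Proof.
have [|f [fM fE]] := @hat_lift k k' bool (@no_rel k bool) phi (f2 k')
   (fun x => hgen _ x); first by move=> t [].
have := @xgetPex _ (fun=> 0)
  [set f | [/\ clie_morph phi f, f (fA k) = fA k' & f (fB k) = fB k']].
by apply; exists f; split=> //; apply: fE.
Qed.

End F2.

Lemma f2_subst_semi (k k' : qalgType) (phi : {rmorphism k -> k'}) (L : clieType k)
  (L' : clieType k') (f : L -> L') a b g : clie_morph phi f ->
  f (f2_subst a b g) = f2_subst (f a) (f b) (f2_map phi g).
Proof.
move=> fM; have [pM pA pB] := f2_mapP phi.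
apply: (@f2_hom_unique _ _ phi _ (f \o f2_subst a b)
  (f2_subst (f a) (f b) \o f2_map phi)).
- exact: (clie_comp (f2_subst_morph a b) fM).
- exact: (clie_comp pM (f2_subst_morph (f a) (f b))).
- by rewrite /= pA !f2_substA.
- by rewrite /= pB !f2_substB.
Qed.

(** * Infinitesimal braid families and the associator equations *)

Record tn_family (k : qalgType) (L : clieType k) n (u : 'I_n -> 'I_n -> L) : Prop :=
  TnFamily {
    tnf_diag : forall i, u i i = 0;
    tnf_sym : forall i j, u i j = u j i;
    tnf_3 : forall i j l, uniq [:: i; j; l] -> [l: u i j, u i l + u j l] = 0;
    tnf_4 : forall i j l m, uniq [:: i; j; l; m] -> [l: u i j, u l m] = 0
  }.

Section Tn.
Variables (k : qalgType).

Lemma tn_lift (k' : qalgType) (phi : {rmorphism k -> k'}) (L : clieType k') n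
  (u : 'I_n -> 'I_n -> L) : tn_family u ->
  exists f : tn k n -> L, clie_morph phi f /\ forall i j, f (tgen k i j) = u i j.
Proof.
move=> [u0 us u3 u4].
have [|f [fM fE]] := @hat_lift k k' _ (@t_rel k n) phi L (fun p => u p.1 p.2).
  move=> t [i|i j ij|i j l h|i j l m h] /=; [exact: u0| |exact: u3|exact: u4].
  by rewrite rmorphN rmorph1 scaleN1r us subrr.
by exists f; split=> // i j; apply: fE.
Qed.

Lemma tgen_family n : tn_family (@tgen k n).
Proof.
have h t : t_rel t -> hev (@t_rel k n) t = 0 by apply: hev_rel.
have sym i j : tgen k i j = tgen k j i :> tn k n.
  case: (eqVneq i j) => [-> //|ij]; have := h _ (t_rel_sym k ij).
  by rewrite hev_add hev_scale !hev_gen scaleN1r => /eqP; rewrite subr_eq0 => /eqP.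
split=> [i|//|i j l u|i j l m u].
- by have := h _ (t_rel_diag k i).
- by have := h _ (t_rel_3 k u); rewrite hev_br hev_add.
- by have := h _ (t_rel_4 k u); rewrite hev_br.
Qed.

Lemma tn_family_reindex (L : clieType k) m n (u : 'I_n -> 'I_n -> L) (p : 'I_m -> 'I_n) :
  tn_family u -> injective p -> tn_family (fun i j => u (p i) (p j)).
Proof.
move=> [u0 us u3 u4] pI; split=> // [i j l h|i j l q h].
- by apply: u3; rewrite -(map_inj_uniq pI) in h.
- by apply: u4; rewrite -(map_inj_uniq pI) in h.
Qed.

Lemma tn_family_scale (L : clieType k) n (u : 'I_n -> 'I_n -> L) (c : k) :
  tn_family u -> tn_family (fun i j => c *: u i j).
Proof.
move=> [u0 us u3 u4]; split=> [i|i j|i j l h|i j l m h].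
- by rewrite u0 scaler0.
- by rewrite us.
- by rewrite -scalerDr lbrZl lbrZr u3 // !scaler0.
- by rewrite lbrZl lbrZr u4 // !scaler0.
Qed.

Definition disj_blocks (I : seq (seq nat)) n p : Prop :=
  forall (i j : 'I_n) (a : 'I_p), i != j -> in_block I i a -> in_block I j a -> False.

Definition ins_fam (L : clieType k) (I : seq (seq nat)) n p (u : 'I_p -> 'I_p -> L)
  (i j : 'I_n) : L :=
  if i == j then 0 else \sum_(a | in_block I i a) \sum_(b | in_block I j b) u a b.

Lemma tn_family_ins (L : clieType k) I n p (u : 'I_p -> 'I_p -> L) :
  disj_blocks I n p -> tn_family u -> tn_family (@ins_fam L I n p u).
Proof.
move=> dI [u0 us u3 u4].
have neq (i j : 'I_n) (a b : 'I_p) : i != j -> in_block I i a -> in_block I j b -> a != b.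
  by move=> ij ha hb; apply/eqP => ab; case: (dI i j b ij _ hb); rewrite -ab.
have ij3 (T : eqType) (x y z : T) : uniq [:: x; y; z] -> [/\ x != y, x != z & y != z].
  by rewrite /= !inE !negb_or andbT => /andP[/andP[-> ->] ->].
split=> [i|i j|i j l h|i j l m h].
- by rewrite /ins_fam eqxx.
- rewrite /ins_fam eq_sym; case: eqP => // _; rewrite exchange_big.
  by apply: eq_bigr => a _; apply: eq_bigr => b _; rewrite us.
- have [ij il jl] := ij3 _ _ _ _ h.
  rewrite /ins_fam (negPf ij) (negPf il) (negPf jl) lbr_suml big1 // => a ha.
  rewrite lbr_suml big1 // => b hb; rewrite lbrDr !lbr_sumr.
  (* For fixed a and b, the relation for four distinct indices leaves only t_ac + t_bc to be
     bracketed with t_ab. *)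
  rewrite (bigD1 a) //= [X in _ + X + _]big1 ?addr0; last first.
    move=> a' /andP[ha' a'a]; rewrite lbr_sumr big1 // => c hc; apply: u4.
    rewrite /= !inE !negb_or (neq _ _ _ _ ij ha hb) (neq _ _ _ _ il ha hc) eq_sym a'a.
    by rewrite eq_sym (neq _ _ _ _ ij ha' hb) (neq _ _ _ _ jl hb hc) (neq _ _ _ _ il ha' hc).
  rewrite [X in _ + X](bigD1 b) //= [X in _ + (_ + X)]big1 ?addr0; last first.
    move=> b' /andP[hb' b'b]; rewrite lbr_sumr big1 // => c hc; apply: u4.
    rewrite /= !inE !negb_or (neq _ _ _ _ ij ha hb) (neq _ _ _ _ il ha hc).
    rewrite (neq _ _ _ _ ij ha hb') [b == b']eq_sym b'b (neq _ _ _ _ jl hb hc).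
    by rewrite (neq _ _ _ _ jl hb' hc).
  rewrite !lbr_sumr -big_split big1 //= => c hc; rewrite -lbrDr u3 //=.
  by rewrite !inE !negb_or (neq _ _ _ _ ij ha hb) (neq _ _ _ _ il ha hc) (neq _ _ _ _ jl hb hc).
- move: h; rewrite /= !inE !negb_or !andbT.
  move=> /andP[/andP[ij /andP[il im]] /andP[/andP[jl jm] lm]].
  rewrite /ins_fam (negPf ij) (negPf lm) lbr_suml big1 // => a ha.
  rewrite lbr_suml big1 // => b hb; rewrite lbr_sumr big1 // => c hc.
  rewrite lbr_sumr big1 // => d hd; apply: u4.
  rewrite /= !inE !negb_or (neq _ _ _ _ ij ha hb) (neq _ _ _ _ il ha hc).
  rewrite (neq _ _ _ _ im ha hd) (neq _ _ _ _ jl hb hc) (neq _ _ _ _ jm hb hd).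
  by rewrite (neq _ _ _ _ lm hc hd).
Qed.

Lemma tn_insP I n p : disj_blocks I n p ->
  clie_morph idfun (tn_ins p I : tn k n -> tn k p) /\
  forall i j : 'I_n, tn_ins p I (tgen k i j) = ins_fam I (@tgen k p) i j.
Proof.
move=> dI.
have [f [fM fE]] := tn_lift idfun (tn_family_ins dI (tgen_family p)).
have [iM iE] : clie_morph idfun (tn_ins p I : tn k n -> tn k p) /\
    forall i j : 'I_n, i != j -> tn_ins p I (tgen k i j) =
      \sum_(a | in_block I i a) \sum_(b | in_block I j b) tgen k a b.
  apply: (@xgetPex _ (fun=> 0) [set f | clie_morph idfun f /\
    forall i j, i != j -> f (tgen k i j) =
      \sum_(a | in_block I i a) \sum_(b | in_block I j b) tgen k a b]).
  by exists f; split=> // i j /negPf ij; rewrite fE /ins_fam ij.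
split=> // i j; rewrite /ins_fam.
case: eqP => [->|/eqP]; last exact: iE.
by rewrite (tnf_diag (tgen_family _)) (clie0 (phi := idfun) iM).
Qed.

Lemma gt_hom (k' : qalgType) (phi : {rmorphism k -> k'}) (L : clieType k') p
  (f : tn k p -> L) I g : disj_blocks I 3 p -> clie_morph phi f ->
  f (gt p I g) = f2_subst (f (ins_fam I (@tgen k p) (num 2 1) (num 2 2)))
    (f (ins_fam I (@tgen k p) (num 2 2) (num 2 3))) (f2_map phi g).
Proof.
move=> dI fM; have [iM iE] := tn_insP dI.
by rewrite /gt (f2_subst_hom _ _ _ iM) !iE (f2_subst_semi _ _ _ fM).
Qed.

Lemma gtE p I g : disj_blocks I 3 p -> gt p I g =
  f2_subst (ins_fam I (@tgen k p) (num 2 1) (num 2 2))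
    (ins_fam I (@tgen k p) (num 2 2) (num 2 3)) g.
Proof.
by move=> dI; have [iM iE] := tn_insP dI; rewrite /gt (f2_subst_hom _ _ _ iM) !iE.
Qed.
End Tn.

Section Blocks.
Variables (p : nat) (s1 s2 s3 : seq nat).
Local Notation I := [:: s1; s2; s3].
Hypothesis sU : uniq (s1 ++ s2 ++ s3).
Hypothesis sP : all (fun x => 0 < x <= p.+1)%N (s1 ++ s2 ++ s3).

Lemma sum_block (V : nmodType) (s : seq nat) (F : 'I_p.+1 -> V) :
  uniq s -> all (fun x => 0 < x <= p.+1)%N s ->
  \sum_(a : 'I_p.+1 | a.+1 \in s) F a = \sum_(x <- s) F (num p x).
Proof.
move=> uS aS; have numK x : x \in s -> (num p x).+1 = x.
  by move=> /(allP aS) /andP[x0 xp]; rewrite inordK prednK.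
rewrite -(big_map (num p) xpredT F) big_uniq /=.
  apply: eq_bigl => a; apply/idP/mapP => [h|[x xs ->]]; last by rewrite numK.
  by exists a.+1 => //; rewrite /num inord_val.
by rewrite map_inj_in_uniq // => x y /numK xs /numK ys h; rewrite -xs -ys h.
Qed.

Lemma blocks_disj : disj_blocks I 3 p.+1.
Proof.
have [u12 u13 u23] : [/\ forall x, x \in s1 -> x \in s2 -> False,
   forall x, x \in s1 -> x \in s3 -> False & forall x, x \in s2 -> x \in s3 -> False].
  move: sU; rewrite cat_uniq => /and3P[_ /hasPn h1]; rewrite cat_uniq => /and3P[_ /hasPn h2 _].
  split=> x h h'.
  - by have := h1 x; rewrite mem_cat h' h => /(_ isT).
  - by have := h1 x; rewrite mem_cat h' h orbT => /(_ isT).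
  - by have := h2 x h'; rewrite /= h.
move=> [[|[|[|i]]] hi] [[|[|[|j]]] hj] a //; rewrite /in_block /= => _; eauto.
Qed.

Lemma gt_hom_blocks (k k' : qalgType) (phi : {rmorphism k -> k'}) (L : clieType k')
  (u : 'I_p.+1 -> 'I_p.+1 -> L) (f : tn k p.+1 -> L) g :
  clie_morph phi f -> (forall i j, f (tgen k i j) = u i j) ->
  f (gt p.+1 I g) =
    f2_subst (\sum_(x <- s1) \sum_(y <- s2) u (num p x) (num p y))
             (\sum_(x <- s2) \sum_(y <- s3) u (num p x) (num p y)) (f2_map phi g).
Proof.
move=> fM fE; rewrite (gt_hom _ blocks_disj fM).
move: sU sP; rewrite !cat_uniq !all_cat.
move=> /and3P[U1 _ /and3P[U2 _ U3]] /and3P[A1 A2 A3].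
have fins i j : i != j -> f (ins_fam I (@tgen k p.+1) i j) =
  \sum_(a : 'I_p.+1 | in_block I i a) \sum_(b | in_block I j b) u a b.
  move=> /negPf ij; rewrite /ins_fam ij (clie_sum fM); apply: eq_bigr => a _.
  by rewrite (clie_sum fM); apply: eq_bigr => b _; rewrite fE.
have n1 : (num 2 1 : nat) = 0%N by rewrite inordK.
have n2 : (num 2 2 : nat) = 1%N by rewrite inordK.
have n3 : (num 2 3 : nat) = 2%N by rewrite inordK.
have n12 : num 2 1 != num 2 2 by rewrite -val_eqE /= n1 n2.
have n23 : num 2 2 != num 2 3 by rewrite -val_eqE /= n2 n3.
rewrite (fins _ _ _ n12) (fins _ _ _ n23) /in_block n1 n2 n3.
congr (f2_subst _ _ _).
  rewrite (sum_block (fun a => \sum_(b : 'I_p.+1 | b.+1 \in s2) u a b)) //.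
  by apply: eq_bigr => x _; rewrite sum_block.
rewrite (sum_block (fun a => \sum_(b : 'I_p.+1 | b.+1 \in s3) u a b)) //.
by apply: eq_bigr => x _; rewrite sum_block.
Qed.
End Blocks.

Lemma f2_map_id (k : qalgType) (g : f2 k) : f2_map idfun g = g.
Proof.
have [pM pA pB] := f2_mapP (idfun : {rmorphism k -> k}).
exact: (@f2_hom_unique _ _ idfun _ _ id pM (clie_id _)).
Qed.

Section GRTFacts.
Variables (k : qalgType) (g : f2 k).
Hypothesis gG : GRT1 g.

Lemma gt_eval (L : clieType k) p s1 s2 s3 (u : 'I_p.+1 -> 'I_p.+1 -> L)
  (f : tn k p.+1 -> L) :
  uniq (s1 ++ s2 ++ s3) -> all (fun x => 0 < x <= p.+1)%N (s1 ++ s2 ++ s3) ->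
  clie_morph idfun f -> (forall i j, f (tgen k i j) = u i j) ->
  f (gt p.+1 [:: s1; s2; s3] g) =
    f2_subst (\sum_(x <- s1) \sum_(y <- s2) u (num p x) (num p y))
             (\sum_(x <- s2) \sum_(y <- s3) u (num p x) (num p y)) g.
Proof.
move=> sU sP fM fE; have := @gt_hom_blocks p s1 s2 s3 sU sP k k idfun L u f g fM fE.
by rewrite f2_map_id.
Qed.

Section Family.
Variables (L : clieType k).
Local Notation G a b := (f2_subst (a : L) (b : L) g).

Section Triple.
Variables (u v w : L).
Hypotheses (uvw : [l: u, v + w] = 0) (vuw : [l: v, u + w] = 0) (wuv : [l: w, u + v] = 0).

Definition fam3 (i j : 'I_3) : L :=
  match val i, val j with
  | 0%N, 1%N | 1%N, 0%N => u
  | 0%N, 2%N | 2%N, 0%N => v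
  | 1%N, 2%N | 2%N, 1%N => w
  | _, _ => 0
  end.

Lemma fam3_family : tn_family fam3.
Proof.
split.
- by move=> [[|[|[|i]]] hi].
- by move=> [[|[|[|i]]] hi] [[|[|[|j]]] hj].
- move=> [[|[|[|i]]] hi] [[|[|[|j]]] hj] [[|[|[|l]]] hl] //= _; rewrite /fam3 //=;
  by rewrite 1?addrC.
- by move=> [[|[|[|i]]] hi] [[|[|[|j]]] hj] [[|[|[|l]]] hl] [[|[|[|m]]] hm].
Qed.

(** The elements u, v, w play the roles of t_12, t_13, t_23: each commutes with their sum, which is
    a representation of t_3, and the equations on three strands are evaluated in it. *)
Lemma grt_triple :
  [/\ G w u = - G u w, G v u \*e G w v \*e G u w = 0 &
      u + Ad (- G u w) w + Ad (- G u v) v = u + v + w].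
Proof.
have [f [fM fE]] := tn_lift idfun fam3_family.
have [fD fZ fb fc] := fM.
have ev s1 s2 s3 (sU : uniq (s1 ++ s2 ++ s3))
  (sP : all (fun x => 0 < x <= 3)%N (s1 ++ s2 ++ s3)) := gt_eval sU sP fM fE.
have n1 : val (num 2 1) = 0%N by rewrite /= inordK.
have n2 : val (num 2 2) = 1%N by rewrite /= inordK.
have n3 : val (num 2 3) = 2%N by rewrite /= inordK.
have e12 : fam3 (num 2 1) (num 2 2) = u by rewrite /fam3 n1 n2.
have e21 : fam3 (num 2 2) (num 2 1) = u by rewrite /fam3 n1 n2.
have e13 : fam3 (num 2 1) (num 2 3) = v by rewrite /fam3 n1 n3.
have e31 : fam3 (num 2 3) (num 2 1) = v by rewrite /fam3 n1 n3.
have e23 : fam3 (num 2 2) (num 2 3) = w by rewrite /fam3 n2 n3.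
have e32 : fam3 (num 2 3) (num 2 2) = w by rewrite /fam3 n2 n3.
have E := (e12, e21, e13, e31, e23, e32).
have [h1 h2 h3 _] := gG; split.
- have := congr1 f h1; rewrite (clieN fM) !ev // !big_seq1; by rewrite !E.
- have := congr1 f h2; rewrite /emul !(clie_bch fM) !ev // !big_seq1 !E.
  by rewrite /eone (clie0 fM).
- have := congr1 f h3; rewrite !fD !(clie_Ad fM) !(clieN fM) !ev // !big_seq1.
  by rewrite !fE !E.
Qed.
End Triple.

Variable (u : 'I_4 -> 'I_4 -> L).
Hypothesis uF : tn_family u.

Lemma grt_pentagon p q r s : uniq [:: p; q; r; s] ->
  G (u q r) (u r s) \*e G (u p q + u p r) (u q s + u r s) \*e G (u p q) (u q r)
  = G (u p q) (u q r + u q s) \*e G (u p r + u q r) (u r s).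
Proof.
move=> pU; pose m (i : 'I_4) := nth p [:: p; q; r; s] i.
have mI : injective m.
  by move=> i j /eqP; rewrite /m nth_uniq ?ltn_ord // => /eqP; apply: val_inj.
have [f [fM fE]] := tn_lift idfun (tn_family_reindex uF mI).
have ev s1 s2 s3 (sU : uniq (s1 ++ s2 ++ s3))
  (sP : all (fun x => 0 < x <= 4)%N (s1 ++ s2 ++ s3)) := gt_eval sU sP fM fE.
have n1 : m (num 3 1) = p by rewrite /m inordK.
have n2 : m (num 3 2) = q by rewrite /m inordK.
have n3 : m (num 3 3) = r by rewrite /m inordK.
have n4 : m (num 3 4) = s by rewrite /m inordK.
have [_ _ _ h] := gG; have := congr1 f h.
by rewrite /emul !(clie_bch fM) !ev // !(big_cons, big_nil) /= !addr0 n1 n2 n3 n4.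
Qed.

End Family.
End GRTFacts.

(** * The linear part of an associator *)

(* k as an abelian complete Lie algebra concentrated in degree 1. *)
Definition abk (k : qalgType) : Type := k.

Section Abelian.
Variable k : qalgType.

HB.instance Definition _ := GRing.Lmodule.copy (abk k) k^o.

Definition abk_fil n (x : abk k) : Prop := (1 < n)%N -> x = 0.
Definition abk_br (x y : abk k) : abk k := 0.

Fact abk_brDl x y z : abk_br (x + y) z = abk_br x z + abk_br y z.
Proof. by rewrite /abk_br addr0. Qed.
Fact abk_brDr x y z : abk_br x (y + z) = abk_br x y + abk_br x z.
Proof. by rewrite /abk_br addr0. Qed.
Fact abk_brZl (a : k) x y : abk_br (a *: x) y = a *: abk_br x y.
Proof. by rewrite /abk_br scaler0. Qed.
Fact abk_brZr (a : k) x y : abk_br x (a *: y) = a *: abk_br x y.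
Proof. by rewrite /abk_br scaler0. Qed.
Fact abk_brxx x : abk_br x x = 0. Proof. by []. Qed.
Fact abk_jacobi x y z :
  abk_br x (abk_br y z) + abk_br y (abk_br z x) + abk_br z (abk_br x y) = 0.
Proof. by rewrite /abk_br !addr0. Qed.
Fact abk_fil1 x : abk_fil 1 x. Proof. by []. Qed.
Fact abk_fil0 n : abk_fil n 0. Proof. by []. Qed.
Fact abk_filD n x y : abk_fil n x -> abk_fil n y -> abk_fil n (x + y).
Proof. by move=> hx hy n1; rewrite hx // hy // addr0. Qed.
Fact abk_filZ n (a : k) x : abk_fil n x -> abk_fil n (a *: x).
Proof. by move=> hx n1; rewrite hx // scaler0. Qed.
Fact abk_fil_le m n x : (m <= n)%N -> abk_fil n x -> abk_fil m x.
Proof. by move=> mn hx m1; apply/hx/(leq_trans m1). Qed.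
Fact abk_fil_br m n x y : abk_fil m x -> abk_fil n y -> abk_fil (m + n)%N (abk_br x y).
Proof. by []. Qed.
Fact abk_fil_sep x : (forall n, abk_fil n x) -> x = 0.
Proof. by move=> /(_ 2%N); apply. Qed.
Fact abk_complete (s : nat -> abk k) : (forall n, abk_fil n (s n.+1 - s n)) ->
  exists x, forall n, abk_fil n (x - s n).
Proof.
move=> h; exists (s 2%N) => -[|[|n]] // _.
elim: n => [|n IH]; first by rewrite subrr.
by have := h n.+2 isT => /eqP; rewrite subr_eq0 => /eqP ->.
Qed.
HB.instance Definition _ := Lmodule_isCompleteLie.Build k (abk k)
  abk_brDl abk_brDr abk_brZl abk_brZr abk_brxx abk_jacobi
  abk_fil1 abk_fil0 abk_filD abk_filZ abk_fil_le abk_fil_br abk_fil_sep abk_complete.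

Lemma abk_fil2 (x : abk k) : fil 2 x -> x = 0. Proof. by move=> /(_ isT). Qed.

Lemma abk_family n (u : 'I_n -> 'I_n -> abk k) :
  (forall i, u i i = 0) -> (forall i j, u i j = u j i) -> tn_family u.
Proof. by move=> u0 us; split. Qed.

Definition coef_A : f2 k -> abk k := f2_subst (1 : abk k) 0.
Definition coef_B : f2 k -> abk k := f2_subst (0 : abk k) 1.

Lemma coefA_morph : clie_morph idfun coef_A. Proof. exact: f2_subst_morph. Qed.
Lemma coefB_morph : clie_morph idfun coef_B. Proof. exact: f2_subst_morph. Qed.

(** Modulo F^2 an element is a combination of generators, since brackets and remainders lie in
    F^2. *)
Lemma hat_mod2 (X : Type) (rel : lterm k X -> Prop) (f h : hat rel -> hat rel) :
  {morph f : x y / x + y} -> (forall a x, f (a *: x) = a *: f x) ->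
  (forall n x, fil n x -> fil n (f x)) ->
  {morph h : x y / x + y} -> (forall a x, h (a *: x) = a *: h x) ->
  (forall n x, fil n x -> fil n (h x)) ->
  (forall x, f (hgen rel x) = h (hgen rel x)) ->
  forall x, fil 2 (f x - h x).
Proof.
move=> fD fZ ff hD hZ hf fh x.
have [d _ hd] := hat_approx (fil_1 x) (isT : (1 <= 2)%N).
have fT (g : hat rel -> hat rel) y z : {morph g : x y / x + y} ->
    (forall n x, fil n x -> fil n (g x)) -> fil 2 (y - z) -> fil 2 (g y - g z).
  move=> gD gf yz; have -> : g y - g z = g (y - z); last exact: gf.
  by apply/eqP; rewrite subr_eq -gD subrK.
apply: fil_tri (fT f _ _ fD ff hd) _; apply: fil_tri _ (fT h _ _ hD hf (fil_subC hd)).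
have g0 (g : hat rel -> hat rel) : {morph g : x y / x + y} -> g 0 = 0.
  by move=> gD; apply: (addrI (g 0)); rewrite -gD !addr0.
elim: (d) => [y||t ht u hu|a t ht|t ht u hu].
- by rewrite hev_gen fh subrr; apply: fil_0.
- by rewrite hev_zero (g0 f fD) (g0 h hD) subrr; apply: fil_0.
- by rewrite hev_add fD hD opprD addrACA; apply: fil_D.
- by rewrite hev_scale fZ hZ -scalerBr; apply: fil_Z.
- have f2t : fil 2 (hev rel (LBr t u)).
    by rewrite hev_br; apply: (@fil_lbr _ _ 1 1); apply: fil_1.
  by apply: fil_B; [apply: ff|apply: hf].
Qed.

Lemma f2_linear_part g : fil 2 (g - ((coef_A g : k) *: fA k + (coef_B g : k) *: fB k)).
Proof.
have [AD AZ _ _] := coefA_morph; have [BD BZ _ _] := coefB_morph.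
apply: (@hat_mod2 _ _ id (fun g => (coef_A g : k) *: fA k + (coef_B g : k) *: fB k)) => //.
- by move=> x y; rewrite AD BD !scalerDl addrACA.
- by move=> a x; rewrite AZ BZ scalerDr !scalerA.
- move=> [|[|n]] x hx; try exact: fil_any.
  have h1 : coef_A x = 0.
    by apply: abk_fil2; apply: (fil_hat_morph (phi := idfun) coefA_morph); apply: fil_le hx.
  have h2 : coef_B x = 0.
    by apply: abk_fil2; apply: (fil_hat_morph (phi := idfun) coefB_morph); apply: fil_le hx.
  by rewrite h1 h2 !scale0r addr0; apply: fil_0.
- move=> [].
    rewrite -[hgen _ _]/(fA k) /coef_A /coef_B !f2_substA; by rewrite scale1r scale0r addr0.
  rewrite -[hgen _ _]/(fB k) /coef_A /coef_B !f2_substB; by rewrite scale1r scale0r add0r.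
Qed.

Section NoLinear.
Variable g : f2 k.
Hypothesis gG : GRT1 g.

(** The rank one representation of t_4 in which t_ab is 1 and the other generators are 0, with
    strands numbered from 0. *)
Let sg (i j : 'I_4) (a b : nat) : abk k :=
  if ((i == a :> nat) && (j == b :> nat)) || ((i == b :> nat) && (j == a :> nat)) then 1 else 0.

Lemma sg_family a b : a != b -> tn_family (fun i j => sg i j a b).
Proof.
move=> ab; apply: abk_family => [i|i j]; rewrite /sg.
  by case: eqP => [->|_]; rewrite ?(negPf ab) //= andbF.
by rewrite orbC andbC [X in _ || X]andbC.
Qed.

Lemma emul_abk (x y : abk k) : x \*e y = x + y.
Proof. exact: emul_comm. Qed.

Let f00 : f2_subst (0 : abk k) 0 g = 0.
Proof.
rewrite -(@f2_subst_unique _ _ _ _ (fun=> 0)) //.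
split=> // [x y|a x|n]; [by rewrite addr0|by rewrite scaler0|].
by exists n => x _; apply: fil_0.
Qed.

Let p (i : nat) (hi : (i < 4)%N) : 'I_4 := Ordinal hi.

(** If only the generator of the first two strands survives, the pentagon reads 2 A = A for the
    coefficient A of g; the last two strands give 2 B = B in the same way. *)
Lemma grt_coef_A : coef_A g = 0.
Proof.
have := grt_pentagon gG (sg_family (isT : (0%N != 1%N)%N))
  (isT : uniq [:: p (isT : (0 < 4)%N); p (isT : (1 < 4)%N); p (isT : (2 < 4)%N); p (isT : (3 < 4)%N)]).
rewrite /sg /= !emul_abk ?addr0 ?add0r ?f00 ?add0r ?addr0 -/(coef_A g).
by move/eqP; rewrite -subr_eq0 addrK => /eqP.
Qed.

Lemma grt_coef_B : coef_B g = 0.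
Proof.
have := grt_pentagon gG (sg_family (isT : (2%N != 3%N)%N))
  (isT : uniq [:: p (isT : (0 < 4)%N); p (isT : (1 < 4)%N); p (isT : (2 < 4)%N); p (isT : (3 < 4)%N)]).
rewrite /sg /= !emul_abk ?addr0 ?add0r ?f00 ?add0r ?addr0 -/(coef_B g).
by move/eqP; rewrite -subr_eq0 addrK => /eqP.
Qed.

Lemma grt_fil2 : fil 2 g.
Proof.
have := f2_linear_part g; rewrite grt_coef_A grt_coef_B !scale0r addr0 subr0.
by [].
Qed.

Lemma grt_subst_fil2 (L : clieType k) (a b : L) : fil 2 (f2_subst a b g).
Proof. exact: (fil_hat_morph (phi := idfun) (f2_subst_morph a b) grt_fil2). Qed.

(* g has no linear term, so g(a, b) only sees a and b up to central elements. *)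
Lemma grt_shift (L : clieType k) (a b z w : L) :
  [l: z, a] = 0 -> [l: z, b] = 0 -> [l: w, a] = 0 -> [l: w, b] = 0 -> [l: z, w] = 0 ->
  f2_subst (a + z) (b + w) g = f2_subst a b g.
Proof.
move=> za zb wa wb zw; have [AD AZ _ Ac] := coefA_morph; have [BD BZ _ Bc] := coefB_morph.
have [sD sZ sb sc] := f2_subst_morph a b.
(* Adding the linear part in z and w to the substitution again gives a Lie morphism, because z and w
   commute with its image and with each other; at g the added part vanishes. *)
rewrite -(@f2_subst_unique _ _ (a + z) (b + w)
  (fun x => f2_subst a b x + ((coef_A x : k) *: z + (coef_B x : k) *: w))).
- by rewrite grt_coef_A grt_coef_B !scale0r !addr0.
- split=> [x y|c x|x y|n].
  + by rewrite sD AD BD !scalerDl !addrA; zmod.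
  + by rewrite sZ AZ BZ !scalerDr !scalerA.
  + have Ab : coef_A [l: x, y] = 0 by case: coefA_morph => _ _ -> _.
    have Bb : coef_B [l: x, y] = 0 by case: coefB_morph => _ _ -> _.
    rewrite Ab Bb !scale0r !addr0 sb.
    have zs u : [l: z, f2_subst a b u] = 0 by apply: f2_subst_comm.
    have ws u : [l: w, f2_subst a b u] = 0 by apply: f2_subst_comm.
    have sz u : [l: f2_subst a b u, z] = 0 by rewrite lbrC zs oppr0.
    have sw u : [l: f2_subst a b u, w] = 0 by rewrite lbrC ws oppr0.
    have wz : [l: w, z] = 0 by rewrite lbrC zw oppr0.
    rewrite !(lbrDl, lbrDr) !(lbrZl, lbrZr) zs ws sz sw zw wz !lbrxx.
    by rewrite !scaler0 !addr0.
  + have [m1 h1] := sc n; have [m2 h2] := Ac 2%N; have [m3 h3] := Bc 2%N.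
    exists (maxn m1 (maxn m2 m3)) => x hx; apply: fil_D.
      by apply: h1; apply: fil_le hx; rewrite leq_max leqnn.
    have -> : coef_A x = 0.
      by apply: abk_fil2; apply: h2; apply: fil_le hx; rewrite !leq_max leqnn orbT.
    have -> : coef_B x = 0.
      by apply: abk_fil2; apply: h3; apply: fil_le hx; rewrite !leq_max leqnn !orbT.
    by rewrite !scale0r addr0; apply: fil_0.
- by rewrite /coef_A /coef_B !f2_substA scale1r scale0r addr0.
- by rewrite /coef_A /coef_B !f2_substB scale1r scale0r add0r.
Qed.
End NoLinear.
End Abelian.

(** * Stability of GRT_1 under base change and scaling *)

Section Transfer.
Variables (k k' : qalgType) (phi : {rmorphism k -> k'}) (g : f2 k) (g' : f2 k').
Variables (e e' : k').
Hypothesis e'e : e' * e = 1.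
Variable S : forall p, tn k p -> tn k' p.
Hypothesis SM : forall p, clie_morph phi (@S p).
Hypothesis SE : forall p i j, S (@tgen k p i j) = e *: tgen k' i j.
Hypothesis Sg : forall p I, disj_blocks I 3 p -> S (gt p I g) = gt p I g'.

(** Used with e = 1 for base change and with e = c^{-1} for the action of c. Only the third equation
    contains the t_ij outside of g; it is linear in them, so the unit e factors out. *)
Lemma GRT1_transfer : GRT1 g -> GRT1 g'.
Proof.
move=> [h1 h2 h3 h4].
have [SD _ _ _] := SM 3; have [SD4 _ _ _] := SM 4.
have Sg3 s1 s2 s3 : uniq (s1 ++ s2 ++ s3) ->
    all (fun x => 0 < x <= 3)%N (s1 ++ s2 ++ s3) ->
    gt 3 [:: s1; s2; s3] g' = S (gt 3 [:: s1; s2; s3] g).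
  by move=> sU sP; rewrite Sg //; apply: blocks_disj.
have Sg4 s1 s2 s3 : uniq (s1 ++ s2 ++ s3) ->
    all (fun x => 0 < x <= 4)%N (s1 ++ s2 ++ s3) ->
    gt 4 [:: s1; s2; s3] g' = S (gt 4 [:: s1; s2; s3] g).
  by move=> sU sP; rewrite Sg //; apply: blocks_disj.
have tS p i j : tgen k' i j = e' *: S (@tgen k p i j).
  by rewrite SE scalerA e'e scale1r.
split.
- by rewrite !Sg3 // h1 (clieN (SM 3)).
- by rewrite !Sg3 // /emul -!(clie_bch (SM 3)) -/(emul _ _) -/(emul _ _) h2 (clie0 (SM 3)).
- rewrite !Sg3 // /tt_ /einv !tS !AdZ -!scalerDr; congr (_ *: _).
  by rewrite -!(clieN (SM 3)) -!(clie_Ad (SM 3)) -!SD; congr S.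
- by rewrite !Sg4 // /emul -!(clie_bch (SM 4)) -/(emul _ _) -/(emul _ _) h4.
Qed.
End Transfer.

Lemma GRT1_map (k k' : qalgType) (phi : {rmorphism k -> k'}) (g : f2 k) :
  GRT1 g -> GRT1 (f2_map phi g).
Proof.
have ex p := cid (tn_lift phi (tgen_family k' p)).
pose S p := projT1 (ex p).
have SM p : clie_morph phi (S p) by rewrite /S; case: (ex p) => f [].
have SE p i j : S p (tgen k i j) = tgen k' i j by rewrite /S; case: (ex p) => f [].
apply: (@GRT1_transfer _ _ phi _ _ 1 1 (mulr1 1) S SM) => [p i j|p I dI].
  by rewrite scale1r.
have Sins i j : S p (ins_fam I (@tgen k p) i j) = ins_fam I (@tgen k' p) i j.
  rewrite /ins_fam; case: ifP => _; first exact: clie0 (SM p).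
  rewrite (clie_sum (SM p)); apply: eq_bigr => a _; rewrite (clie_sum (SM p)).
  by apply: eq_bigr => b _.
by rewrite (gt_hom _ dI (SM p)) gtE // !Sins.
Qed.

Lemma GRT1_actP (k : qalgType) (c : kunit k) (g : f2 k) : GRT1 g -> GRT1 (GRT1_act c g).
Proof.
have ex p := cid (tn_lift idfun (tn_family_scale (uinv c) (tgen_family k p))).
pose S p := projT1 (ex p).
have SM p : clie_morph idfun (S p) by rewrite /S; case: (ex p) => f [].
have SE p i j : S p (tgen k i j) = uinv c *: tgen k i j by rewrite /S; case: (ex p) => f [].
apply: (@GRT1_transfer _ _ idfun _ _ _ _ (uvalK c) S SM SE) => p I dI.
have Sins i j : S p (ins_fam I (@tgen k p) i j) = uinv c *: ins_fam I (@tgen k p) i j.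
  have SM' : clie_morph (GRing.RMorphism.sort (idfun : {rmorphism k -> k})) (S p) := SM p.
  rewrite /ins_fam; case: ifP => _; first by rewrite scaler0; apply: clie0 SM'.
  rewrite (clie_sum SM') scaler_sumr; apply: eq_bigr => a _.
  by rewrite (clie_sum SM') scaler_sumr; apply: eq_bigr => b _.
have [_ sZ _ _] := f2_subst_morph (ins_fam I (@tgen k p) (num 2 1) (num 2 2))
  (ins_fam I (@tgen k p) (num 2 2) (num 2 3)).
rewrite (gt_hom (phi := idfun) _ dI (SM p)) f2_map_id gtE // !Sins.
rewrite /GRT1_act (f2_subst_hom _ _ _ (f2_subst_morph _ _)).
by rewrite !sZ f2_substA f2_substB.
Qed.

(** * A quadratic identity for the Bernoulli series *)

Section Series.
Variables (R : comNzRingType) (c : {rmorphism rat -> R}).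
Implicit Types (u v : R) (s t : nat -> rat).

(* s(u T) modulo T^N *)
Definition ser N s u : {poly R} := \poly_(i < N) (c (s i) * u ^+ i).

Lemma coef_ser N s u i : (i < N)%N -> (ser N s u)`_i = c (s i) * u ^+ i.
Proof. by move=> iN; rewrite coef_poly iN. Qed.

Lemma coef_serM N s t u v n : (n < N)%N -> (ser N s u * ser N t v)`_n =
  \sum_(i < n.+1) c (s i * t (n - i)%N) * (u ^+ i * v ^+ (n - i)).
Proof.
move=> nN; rewrite coefM; apply: eq_bigr => i _.
have iN : (i < N)%N by apply: leq_ltn_trans nN; rewrite -ltnS.
have niN : (n - i < N)%N by apply: leq_ltn_trans nN; apply: leq_subr.
by rewrite !coef_ser // rmorphM /= mulrACA.
Qed.

Lemma serM N s t u : peq N (ser N s u * ser N t u) (ser N (cauchy s t) u).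
Proof.
move=> n nN; rewrite coef_serM // coef_ser // rmorph_sum mulr_suml.
apply: eq_bigr => i _; rewrite -exprD subnKC //; exact: (leq_ord i).
Qed.

Lemma ser_exp_add N u v :
  peq N (ser N exp_coef u * ser N exp_coef v) (ser N exp_coef (u + v)).
Proof.
move=> n nN; rewrite coef_serM // coef_ser // [u + v]addrC exprDn mulr_sumr.
apply: eq_bigr => i _; have ni := leq_ord i.
have eC : exp_coef i * exp_coef (n - i)%N = exp_coef n * 'C(n, i)%:R.
  have C0 : ('C(n, i)%:R : rat) != 0 by rewrite Num.Theory.pnatr_eq0 -lt0n bin_gt0.
  by rewrite /exp_coef -(bin_fact ni) !natrM !invfM mulrAC mulVf ?mul1r.
by rewrite eC rmorphM rmorph_nat -mulrA mulr_natl [v ^+ _ * _]mulrC.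
Qed.

Lemma ser_exp0 N : peq N (ser N exp_coef 0) 1.
Proof.
move=> n nN; rewrite coef_ser // coef1.
by case: n {nN} => [|n]; rewrite ?exp_coef0 ?rmorph1 ?expr0 ?mulr1 // expr0n mulr0.
Qed.

Lemma ser_exp N u : peq N.+1 (ser N.+1 exp_coef u) (1 + u%:P * 'X * ser N.+1 eps_coef u).
Proof.
move=> [|n] nN; rewrite coefD coef1 -mulrA coefCM mulrC coefXM.
  by rewrite coef_ser // exp_coef0 rmorph1 mul1r mul0r addr0.
rewrite add0r /= coef_ser // coef_ser; last exact: ltnW.
by rewrite exprSr mulrA.
Qed.

Lemma ser_bern N u : peq N.+1 (ser N.+1 bern_coef u) (1 + u%:P * 'X * ser N.+1 bernT_coef u).
Proof.
move=> [|n] nN; rewrite coefD coef1 -mulrA coefCM mulrC coefXM.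
  by rewrite coef_ser // [bern_coef 0]/(1 : rat) rmorph1 mul1r mul0r addr0.
rewrite add0r /= coef_ser // coef_ser; last exact: ltnW.
by rewrite exprSr mulrA.
Qed.

Lemma ser_bern_eps N u : peq N (ser N bern_coef u * ser N eps_coef u) 1.
Proof.
move=> n nN; rewrite (serM _ _ _ nN) bern_eps coef_ser // coef1.
by case: n {nN} => [|n]; rewrite ?rmorph1 ?mul1r // rmorph0 mul0r.
Qed.
End Series.

Section BernParity.
Local Notation sr := (ser (idfun : {rmorphism rat -> rat})).

(** This is b(-s) = b(s) + s, which follows from e^s e^{-s} = 1. *)
Lemma bern_parity n : (-1) ^+ n * bern_coef n = bern_coef n + (n == 1%N)%:R.
Proof.
pose N := n.+1.
pose E := sr N.+1 exp_coef 1; pose E' := sr N.+1 exp_coef (-1).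
pose e := sr N.+1 eps_coef 1; pose e' := sr N.+1 eps_coef (-1).
pose F := sr N.+1 bern_coef 1; pose F' := sr N.+1 bern_coef (-1).
have EE : peq N.+1 (E * E') 1.
  by move=> i iN; rewrite (ser_exp_add _ _ _ iN) subrr; apply: ser_exp0.
have hE : peq N.+1 E (1 + 'X * e).
  by have := @ser_exp _ (idfun : {rmorphism rat -> rat}) N 1; rewrite mul1r.
have hE' : peq N.+1 E' (1 - 'X * e').
  by have := @ser_exp _ (idfun : {rmorphism rat -> rat}) N (-1); rewrite polyCN mulN1r mulNr.
have Fe : peq N.+1 (F * e) 1 by apply: ser_bern_eps.
have Fe' : peq N.+1 (F' * e') 1 by apply: ser_bern_eps.
have le (p q : {poly rat}) : peq N.+1 p q -> peq N p q by move=> h i iN; apply/h/ltnW.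
(* Dividing by X costs one order of precision, hence N in place of N + 1. *)
have ee : peq N e (e' * E).
  have h : peq N.+1 ('X * e) ('X * (e' * E)).
    have -> : 'X * (e' * E) = E - (1 - 'X * e') * E by ring.
    move=> i iN; rewrite coefB -(peqM hE' (@peq_refl _ _ E) iN) [E' * E]mulrC.
    by rewrite (EE i iN) (hE i iN) coefD addrC addKr.
  by move=> i iN; have := h i.+1 iN; rewrite !(mulrC 'X) !coefMX.
have FF : peq N F' (F + 'X).
  apply: (@peq_trans _ _ (F' * (F * e))).
    by rewrite -{1}[F']mulr1; apply: peqM => //; apply/peq_sym/le.
  apply: (@peq_trans _ _ (F' * (F * (e' * E)))); first by do 2!apply: peqM => //.
  have -> : F' * (F * (e' * E)) = (F' * e') * (F * E) by ring.
  apply: (@peq_trans _ _ (1 * (F * (1 + 'X * e)))).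
    by apply: peqM; [apply: le|apply: peqM => //; apply: le].
  have -> : 1 * (F * (1 + 'X * e)) = F + 'X * (F * e) by ring.
  apply: peqD => //; rewrite -[X in peq _ _ X]mulr1; apply: peqM => //; exact: le.
have := FF n (leqnn _); rewrite coefD coefX !coef_ser //= expr1n mulr1 => <-.
exact: mulrC.
Qed.
End BernParity.

Lemma bernT_parity n : (-1) ^+ n * bernT_coef n = - bernT_coef n - (n == 0%N)%:R.
Proof.
have := bern_parity n.+1; rewrite exprS mulN1r mulNr => h.
by rewrite -opprD -h opprK.
Qed.

(** The divided difference (u^n - v^n)/(u - v), written without division so that it makes sense on
    operators. *)
Fixpoint dd (R : comNzRingType) (u v : R) (n : nat) : R :=
  if n is m.+1 then u * dd u v m + v ^+ m else 0.

Lemma ddE (R : comNzRingType) (u v : R) n : (u - v) * dd u v n = u ^+ n - v ^+ n.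
Proof.
elim: n => [|n IH] /=; first by rewrite mulr0 !expr0 subrr.
by rewrite mulrDr mulrCA IH !exprS; ring.
Qed.

Section BernIdentity.
Variables (R : idomainType) (c : {rmorphism rat -> R}) (a g : R).
Hypotheses (a0 : a != 0) (g0 : g != 0) (s0 : a + g != 0).
Let s := a + g.
Let h n : R := c (bernT_coef n).

(** With h(u) = (b(u) - 1)/u and h[u, v] = (h(u) - h(v))/(u - v), this is the part of degree n of -
    h[g, s] - h[a, s] - h[a, -g] + h(s) h(-g) + h(a) h(g) - h(a) h(s). *)
Definition bern_quad n : R :=
  - h n.+1 * (dd g s n.+1 + dd a s n.+1 + dd a (- g) n.+1) +
  \sum_(i < n.+1) c (bernT_coef i * bernT_coef (n - i)%N) *
    (s ^+ i * (- g) ^+ (n - i) + a ^+ i * g ^+ (n - i) - a ^+ i * s ^+ (n - i)).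

(** In terms of b it is the formula (a + g) b(a) b(g) = b(a + g) (a g + g b(a) + a b(g)). Multiplied
    by the inverses of the three values of b, this becomes e^{a+g} - 1 = (e^a - 1)(e^g - 1) + (e^a -
    1) + (e^g - 1). *)
Lemma bern_quad_eq0 n : bern_quad n = 0.
Proof.
pose N := n.+3.
pose H u := ser c N.+1 bernT_coef u; pose F u := ser c N.+1 bern_coef u.
pose e u := ser c N.+1 eps_coef u; pose E u := ser c N.+1 exp_coef u.
have hF u : peq N.+1 (F u) (1 + u%:P * 'X * H u) by apply: ser_bern.
have hE u : peq N.+1 (E u) (1 + u%:P * 'X * e u) by apply: ser_exp.
have Fe u : peq N.+1 (F u * e u) 1 by apply: ser_bern_eps.
have Es : peq N.+1 (E s) (E a * E g) by apply/peq_sym/ser_exp_add.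
have HN : peq N.+1 (H (- g)) (- 1 - H g).
  move=> i iN; rewrite coefB coefN coef1 !coef_ser // exprNn mulrA.
  have -> : c (bernT_coef i) * (-1) ^+ i = - c (bernT_coef i) - (i == 0%N)%:R.
    rewrite -[(-1) ^+ i](rmorph_sign c) -rmorphM /= mulrC bernT_parity rmorphB rmorphN.
    by rewrite rmorph_nat.
  by rewrite mulrBl mulNr addrC; case: i {iN} => [|i]; rewrite ?expr0 ?mulr1 // mul0r.
(* The coefficient of P in degree n + 1 is a g s times [bern_quad n]: the denominators of the
   divided differences are g - s = - a, a - s = - g and a + g = s. *)
pose P := - (g * s)%:P * (H s - H g) - (a * s)%:P * (H s - H a)
  - (a * g)%:P * (H a - H (- g))
  + (a * g * s)%:P * 'X * (H s * H (- g) + H a * H g - H a * H s).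
have P0 : peq N.+1 ('X ^+ 2 * P) 0.
  pose A := a%:P : {poly R}; pose C := g%:P : {poly R}; pose S := s%:P : {poly R}.
  have SE : S = A + C by rewrite /S /s polyCD.
  pose P' := - (C * S) * (H s - H g) - (A * S) * (H s - H a)
    - (A * C) * (H a + 1 + H g)
    + (A * C * S) * 'X * (H s * (- 1 - H g) + H a * H g - H a * H s).
  pose f u := 1 + u%:P * 'X * H u.
  pose W := S * f a * f g - f s * (A * C * 'X + C * f a + A * f g).
  apply: (@peq_trans _ _ ('X ^+ 2 * P')).
    apply: peqM => //; rewrite /P /P' !polyCM -/A -/C -/S.
    apply: peqD; last by apply: peqM => //; apply: peqD => //; apply: peqD => //; apply: peqM.
    apply: peqD => //; apply: peqN; apply: peqM => //.
    rewrite -addrA; apply: peqD => //; have -> : 1 + H g = - (- 1 - H g) by ring.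
    exact: peqN.
  (* In P' the parity of h has replaced H(-g) by - 1 - H(g), and W is the difference of the two
     sides of the formula for b. *)
  have -> : 'X ^+ 2 * P' = 'X * W by rewrite /P' /W /f -/A -/C -/S SE; ring.
  have hf u : peq N.+1 (f u) (F u) by apply/peq_sym/hF.
  apply: (@peq_trans _ _ ('X * W * ((F a * e a) * (F g * e g) * (F s * e s)))).
    have h3 : peq N.+1 (1 * 1 * 1) ((F a * e a) * (F g * e g) * (F s * e s)).
      by apply: peqM; [apply: peqM|]; apply/peq_sym.
    rewrite !mulr1 in h3.
    by rewrite -{1}['X * W]mulr1; apply: peqM.
  pose Z := S * 'X * e s - ((A * 'X * e a) * (C * 'X * e g) + C * 'X * e g + A * 'X * e a).
  apply: (@peq_trans _ _ (F a * F g * F s * Z)).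
    pose W' := S * F a * F g - F s * (A * C * 'X + C * F a + A * F g).
    apply: (@peq_trans _ _ ('X * W' * ((F a * e a) * (F g * e g) * (F s * e s)))).
      apply: peqM => //; apply: peqM => //; apply: peqD.
        by apply: peqM => //; apply: peqM.
      apply: peqN; apply: peqM => //; apply: peqD; last by apply: peqM.
      by apply: peqD => //; apply: peqM.
    have -> : 'X * W' * ((F a * e a) * (F g * e g) * (F s * e s)) =
      F a * F g * F s * (S * 'X * e s * ((F a * e a) * (F g * e g)) -
       (F s * e s) * (A * C * 'X * 'X * e a * e g + C * 'X * e g * (F a * e a) +
          A * 'X * e a * (F g * e g))) by rewrite /W'; ring.
    apply: peqM => //; rewrite /Z; apply: peqD.
      rewrite -[X in peq _ _ X]mulr1; apply: peqM => //.
      have h2 : peq N.+1 ((F a * e a) * (F g * e g)) (1 * 1) by apply: peqM.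
      by rewrite mulr1 in h2.
    apply: peqN; rewrite -[X in peq _ _ X]mul1r; apply: peqM => //.
    apply: peqD; last by rewrite -[X in peq _ _ X]mulr1; apply: peqM.
    apply: peqD; last by rewrite -[X in peq _ _ X]mulr1; apply: peqM.
    by have -> : A * C * 'X * 'X * e a * e g = A * 'X * e a * (C * 'X * e g) by ring.
  have -> : 0 = F a * F g * F s * 0 :> {poly R} by rewrite mulr0.
  apply: peqM => //; apply: (@peq_trans _ _ (E s - E a * E g)).
    apply: peq_sym; apply: (@peq_trans _ _ ((1 + S * 'X * e s) -
      (1 + A * 'X * e a) * (1 + C * 'X * e g))).
      by apply: peqD => //; apply: peqN; apply: peqM.
    have -> : 1 + S * 'X * e s - (1 + A * 'X * e a) * (1 + C * 'X * e g) = Z by rewrite /Z; ring.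
    by [].
  have -> : 0 = E a * E g - E a * E g by rewrite subrr.
  by apply: peqD.
have := P0 n.+3 (leqnn _); rewrite coef0 mulrC coefMXn /= subSS subSS subn0.
have nN : (n.+1 < N.+1)%N by rewrite /N !ltnS; apply: leqW.
have nN' : (n < N.+1)%N by apply: ltnW.
have hX (Q : {poly R}) : ((a * g * s)%:P * 'X * Q)`_n.+1 = a * g * s * Q`_n.
  by rewrite -mulrA coefCM ['X * Q]mulrC coefMX.
rewrite /P coefD hX !mulNr !(coefD, coefN, coefCM) /H !coef_serM // !coef_ser //.
rewrite -/(h n.+1) => hP; apply/eqP.
have agse : a * g * s != 0 by rewrite !mulf_neq0.
rewrite -(mulrI_eq0 _ (mulfI agse)); apply/eqP; rewrite -[RHS]hP /bern_quad mulrDr.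
have d1 := ddE g s n.+1; have d2 := ddE a s n.+1; have d3 := ddE a (- g) n.+1.
have gs : g - s = - a by rewrite /s; ring.
have as_ : a - s = - g by rewrite /s; ring.
rewrite gs in d1; rewrite as_ in d2; rewrite opprK -/s in d3.
congr (_ + _); last first.
  congr (_ * _); rewrite -sumrN -!big_split; apply: eq_bigr => i _ /=; ring.
have -> : a * g * s * (- h n.+1 * (dd g s n.+1 + dd a s n.+1 + dd a (- g) n.+1)) =
    h n.+1 * (g * s * (- a * dd g s n.+1) + a * s * (- g * dd a s n.+1)
      - a * g * (s * dd a (- g) n.+1)) by ring.
rewrite d1 d2 d3; ring.
Qed.
End BernIdentity.

(** * Brackets of series and polynomials in commuting adjoint operators *)

Section LbrSeries.
Variables (k : qalgType) (L : clieType k).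
Implicit Types (x y z : L).

Lemma lbr_lsumr y (f : nat -> L) : (forall n, fil n (f n)) ->
  [l: y, lsum f] = lsum (fun n => [l: y, f n]).
Proof.
have h n z : fil n z -> fil n [l: y, z].
  by move=> hz; apply: (@fil_le _ _ _ n.+1) => //; apply: fil_lbrr.
move=> hf; apply: (@lsum_morph _ _ _ _ (fun z => [l: y, z])) => //.
- by move=> u v; apply: lbrDr.
- by move=> n; exists n => z; apply: h.
- by move=> n; apply: h.
Qed.

Lemma lbr_lsuml y (f : nat -> L) : (forall n, fil n (f n)) ->
  [l: lsum f, y] = lsum (fun n => [l: f n, y]).
Proof.
move=> hf; rewrite lbrC lbr_lsumr // -lsumN; last first.
  by move=> n; apply: (@fil_le _ _ _ n.+1) => //; apply: fil_lbrr.
by congr lsum; apply/funext => n; rewrite -lbrC.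
Qed.

Lemma lbr_oserr s (D : L -> L) y z : nilop D ->
  [l: y, oser s D z] = lsum (fun n => qscale (s n) [l: y, iter n D z]).
Proof.
move=> nD; rewrite lbr_lsumr; last exact: oser_fil.
by congr lsum; apply/funext => n; rewrite lbr_qscaler.
Qed.

Lemma lbr_oser2 s t (D E : L -> L) y z : nilop D -> nilop E ->
  [l: oser s D y, oser t E z] = lsum (fun n => \sum_(i < n.+1)
    qscale (s i * t (n - i)%N) [l: iter i D y, iter (n - i) E z]).
Proof.
move=> nD nE; pose a i j : L := qscale (s i * t j) [l: iter i D y, iter j E z].
have fi (D' : L -> L) n u : nilop D' -> fil n (iter n D' u).
  by move=> nD'; apply: fil_le (nilop_iter nD' n (fil_1 u)); apply: leq_addr.
rewrite -(lsum2 (a := a)); last first.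
  by move=> i j; apply/fil_qscale; apply: fil_lbr; apply: fi.
rewrite lbr_lsuml; last exact: oser_fil.
congr lsum; apply/funext => i; rewrite lbr_qscalel lbr_oserr // lsum_qscale.
  by congr lsum; apply/funext => j; rewrite qscaleA.
move=> n; apply/fil_qscale; apply: (@fil_le _ _ _ n.+1) => //.
by apply: fil_lbrr; apply: fi.
Qed.

Lemma lsum_recl0 (f : nat -> L) : f 0%N = 0 -> (forall n, fil n (f n)) ->
  lsum f = lsum (fun n => f n.+1).
Proof.
by move=> f0 hf; rewrite lsum_recl // ?f0 ?add0r // => n; apply: (@fil_le _ _ _ n.+1).
Qed.

Lemma iter_ad_comm x z n y : [l: x, z] = 0 ->
  iter n (ad x) (ad z y) = ad z (iter n (ad x) y).
Proof.
move=> xz; elim: n => //= n ->; rewrite /ad lbr_leibniz xz lbr0 add0r //.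
Qed.

Lemma iter_ad_lbrr x y z n : [l: x, y] = 0 ->
  iter n (ad x) [l: y, z] = [l: y, iter n (ad x) z].
Proof. by move=> xy; elim: n => //= n ->; rewrite /ad lbr_leibniz xy lbr0 add0r. Qed.

Lemma iter_ad_lbrl x y z n : [l: x, z] = 0 ->
  iter n (ad x) [l: y, z] = [l: iter n (ad x) y, z].
Proof. by move=> xz; elim: n => //= n ->; rewrite /ad lbr_leibniz xz lbr0r addr0. Qed.

Lemma iter_ad_zero x n : iter n (ad x) 0 = 0.
Proof. by elim: n => //= n ->; apply: lbr0r. Qed.

End LbrSeries.

Section PolyAd.
Variables (k : qalgType) (L : clieType k) (x z : L).
Hypothesis xz : [l: x, z] = 0.
Let R := {poly {poly rat}}.
Let cst : {rmorphism rat -> R} := (polyC \o polyC : {rmorphism rat -> R}).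

Let actz : {poly rat} -> L -> L := pact (@qscale k L) (ad z).
(** The outer variable acts as [ad x] and the inner one as [ad z]. Identities obtained by
    cancellation in the domain of polynomials thus hold for operators, which may be zero
    divisors. *)
Definition pad : R -> L -> L := pact actz (ad x).

Let zD : {morph ad z : u v / u + v}. Proof. by move=> u v; apply: lbrDr. Qed.
Let xD : {morph ad x : u v / u + v}. Proof. by move=> u v; apply: lbrDr. Qed.
Let zq (q : rat) y : ad z (qscale q y) = qscale q (ad z y). Proof. exact: lbr_qscaler. Qed.
Let qA (p q : rat) (y : L) : qscale (p * q) y = qscale p (qscale q y).
Proof. by rewrite qscaleA. Qed.

Let actzDl p q y : actz (p + q) y = actz p y + actz q y.
Proof. exact: pactDl (@qscaleDl k L) _ _ _. Qed.
Let actzDr p y y' : actz p (y + y') = actz p y + actz p y'.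
Proof. exact: (pactDr (@qscaleDr k L) zD). Qed.
Let actzM p q y : actz (p * q) y = actz p (actz q y).
Proof. exact: (pactM (@qscaleDl k L) (@qscaleDr k L) qA zD zq). Qed.
Let actz1 y : actz 1 y = y.
Proof. by rewrite /actz (pact1 _ (@qscaleDl k L) (@qscale1 k L)). Qed.
Let x_actz p y : ad x (actz p y) = actz p (ad x y).
Proof.
rewrite /actz /pact {1}/ad lbr_sumr; apply: eq_bigr => i _.
by rewrite lbr_qscaler -[ [l: x, _] ]/(ad x _) iter_ad_comm // lbrC xz oppr0.
Qed.

Lemma padD p q y : pad (p + q) y = pad p y + pad q y.
Proof. exact: (pactDl _ actzDl). Qed.
Lemma padM p q y : pad (p * q) y = pad p (pad q y).
Proof. exact: (pactM actzDl actzDr actzM xD x_actz). Qed.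
Lemma pad1 y : pad 1 y = y.
Proof. by rewrite /pad (pact1 _ actzDl actz1). Qed.
Lemma pad0 y : pad 0 y = 0.
Proof. by rewrite /pad /pact size_poly0 big_ord0. Qed.
Lemma padN p y : pad (- p) y = - pad p y.
Proof. by apply/eqP; rewrite -subr_eq0 opprK -padD addNr pad0. Qed.
Lemma pad_cst q y : pad (cst q) y = qscale q y.
Proof.
rewrite /pad -[cst q]/((q%:P)%:P) (pactC _ actzDl) /actz.
exact: (pactC _ (@qscaleDl k L)).
Qed.
Lemma pad_x y : pad 'X y = [l: x, y].
Proof. exact: (pactX (ad x) actzDl actz1 y). Qed.
Lemma pad_z y : pad ('X%:P) y = [l: z, y].
Proof. by rewrite /pad (pactC _ actzDl); apply: (pactX (ad z) (@qscaleDl k L) (@qscale1 k L) y). Qed.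
Lemma pad_sum I (r : seq I) (P : pred I) (F : I -> R) y :
  pad (\sum_(i <- r | P i) F i) y = \sum_(i <- r | P i) pad (F i) y.
Proof. by apply: (big_morph (fun p => pad p y)) => [p q|]; [apply: padD|apply: pad0]. Qed.
Lemma padX p u n y : (forall y, pad p y = [l: u, y]) -> pad (p ^+ n) y = iter n (ad u) y.
Proof.
move=> h; elim: n => [|n IH]; first by rewrite expr0 pad1.
by rewrite exprS padM IH h.
Qed.
End PolyAd.

Section AdSeries.
Variables (k : qalgType) (L : clieType k).
Implicit Types (x y z t : L).

Lemma lbr_swap x y : [l: x, y] = 0 -> [l: y, x] = 0.
Proof. by move=> xy; rewrite lbrC xy oppr0. Qed.

Lemma lbr_oser_ad c x y z : [l: x, z] = 0 ->
  [l: z, oser c (ad x) y] = oser c (ad x) [l: z, y].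
Proof.
move=> xz; apply: (@oser_comm _ _ (ad x) (ad z)); try exact: nilop_ad.
by move=> w; rewrite /ad lbr_leibniz (lbr_swap xz) lbr0 add0r.
Qed.

Lemma lbr_oser_self c x y : [l: x, oser c (ad x) y] = oser c (ad x) [l: x, y].
Proof. by rewrite lbr_oser_ad // lbrxx. Qed.

Lemma lbr_oser_eq0 c x y z : [l: z, x] = 0 -> [l: z, y] = 0 ->
  [l: z, oser c (ad x) y] = 0.
Proof.
by move=> zx zy; rewrite lbr_oser_ad ?zy ?(lbr_swap zx) // oser0 //; exact: nilop_ad.
Qed.

(** As [ad x] and [ad y] commute, their agreement on t propagates to all iterates. *)
Lemma oser_ad_agree c x y t : [l: x, y] = 0 -> [l: x, t] = [l: y, t] ->
  oser c (ad x) t = oser c (ad y) t.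
Proof.
move=> xy xyt; congr lsum; apply/funext => n; congr qscale.
elim: n => // n IH; rewrite iterS IH iterSr [ad y t]/ad -xyt.
by rewrite iter_ad_lbrr // lbr_swap.
Qed.

Lemma oser_adN_agree c x y t : [l: x, y] = 0 -> [l: x + y, t] = 0 ->
  oser c (ad (- x)) t = oser c (ad y) t.
Proof.
move=> xy xyt; apply: oser_ad_agree; first by rewrite lbrNl xy oppr0.
by apply/eqP; rewrite -subr_eq0 lbrNl -opprD -lbrDl xyt oppr0.
Qed.

(** On t the operator [ad y] acts as - [ad x], so this is h(s) + h(-s) = -1 for the series h of
    [bernT_coef]. *)
Lemma bernT_adN x y t : [l: x, y] = 0 -> [l: x + y, t] = 0 ->
  oser bernT_coef (ad x) t + oser bernT_coef (ad y) t = - t.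
Proof.
move=> xy xyt; rewrite -(oser_adN_agree _ xy xyt).
have nx := nilop_ad x.
have -> : ad (- x) = (fun z => - ad x z) by apply/funext => z; apply: lbrNl.
rewrite (oser_opp nx) (_ : (fun n => _) = (fun n => -1 * bernT_coef n + -1 * (n == 0%N)%:R)).
  rewrite oserDl //.
  have oserZ q c : oser (fun n => q * c n) (ad x) t = qscale q (oser c (ad x) t).
    rewrite /oser lsum_qscale; last exact: oser_fil.
    by congr lsum; apply/funext => n; rewrite qscaleA.
  rewrite !oserZ !qscaleNl !qscale1 oser_delta //; zmod.
by apply/funext => n; rewrite bernT_parity !mulN1r.
Qed.

Lemma oser_bern_ad x y : oser bern_coef (ad x) y = y + oser bernT_coef (ad x) [l: x, y].
Proof. by rewrite oser_bern ?[ad x _]lbr_oser_self //; exact: nilop_ad. Qed.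

Lemma Ad_eps x y : Ad x y = y + [l: x, oser eps_coef (ad x) y].
Proof. by rewrite AdE oser_exp //; exact: nilop_ad. Qed.

End AdSeries.

(** * The brackets of the series b(ad x_i)(y_i) *)

Section EllipticRelation.
Variables (k : qalgType) (L : clieType k) (x1 x3 y1 y3 t12 t13 t23 : L).
Hypotheses (x13 : [l: x1, x3] = 0).
Hypotheses (x1y3 : [l: x1, y3] = t13) (x3y1 : [l: x3, y1] = t13).
Hypotheses (x1y1 : [l: x1, y1] = - (t12 + t13)) (x3y3 : [l: x3, y3] = - (t13 + t23)).
Hypotheses (xt13 : [l: x1 + x3, t13] = 0) (x3t12 : [l: x3, t12] = 0) (x1t23 : [l: x1, t23] = 0).
Hypotheses (y1t23 : [l: y1, t23] = 0) (y3t12 : [l: y3, t12] = 0) (yt13 : [l: y1 + y3, t13] = 0).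

Let R := {poly {poly rat}}.
Let cst : {rmorphism rat -> R} := (polyC \o polyC : {rmorphism rat -> R}).
Let a : R := 'X.
Let g : R := 'X%:P.
Let s : R := a + g.
Let nu : L := [l: t12, t23].
Local Notation P := (pad x1 x3).
Local Notation A := (ad x1).
Local Notation C := (ad x3).

Let x31 : [l: x3, x1] = 0. Proof. by rewrite lbrC x13 oppr0. Qed.
Let Pa y : P a y = [l: x1, y]. Proof. exact: pad_x. Qed.
Let Pg y : P g y = [l: x3, y]. Proof. exact: pad_z. Qed.
Let Png y : P (- g) y = [l: - x3, y]. Proof. by rewrite padN Pg lbrNl. Qed.
Let Ps y : P s y = [l: x1 + x3, y]. Proof. by rewrite padD Pa Pg lbrDl. Qed.
Let Pan n y : P (a ^+ n) y = iter n A y. Proof. exact: padX Pa. Qed.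
Let Pgn n y : P (g ^+ n) y = iter n C y. Proof. exact: padX Pg. Qed.
Let Pngn n y : P ((- g) ^+ n) y = iter n (ad (- x3)) y. Proof. exact: padX Png. Qed.
Let Psn n y : P (s ^+ n) y = iter n (ad (x1 + x3)) y. Proof. exact: padX Ps. Qed.

Let t13t23 : [l: t13, t23] = - nu.
Proof.
have := lbr_leibniz x1 y1 t23; rewrite y1t23 lbr0r x1t23 lbr0r addr0 x1y1 lbrNl lbrDl.
move/eqP; rewrite eq_sym oppr_eq0 addrC addr_eq0 => /eqP ->.
by [].
Qed.

Let t12t13 : [l: t12, t13] = - nu.
Proof.
have := lbr_leibniz x3 y3 t12; rewrite y3t12 lbr0r x3t12 lbr0r addr0 x3y3 lbrNl lbrDl.
move/eqP; rewrite eq_sym oppr_eq0 addr_eq0 => /eqP h.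
by rewrite lbrC h opprK lbrC.
Qed.

Let iter_eq (D E : L -> L) y n : (forall m, D (iter m E y) = E (iter m E y)) ->
  iter n D y = iter n E y.
Proof. by move=> h; elim: n => //= n ->. Qed.

Let xm13 : [l: x1, - x3] = 0. Proof. by rewrite lbrNr x13 oppr0. Qed.
Let x3s : [l: x3, x1 + x3] = 0. Proof. by rewrite lbrDr x31 lbrxx addr0. Qed.
Let x1s : [l: x1, x1 + x3] = 0. Proof. by rewrite lbrDr x13 lbrxx addr0. Qed.

Let At13 n : iter n A t13 = iter n (ad (- x3)) t13.
Proof.
apply: iter_eq => m; rewrite -[LHS]iter_ad_comm; last by rewrite lbrNl x31 oppr0.
rewrite -[RHS]iterS iterSr; congr iter.
by rewrite /ad lbrNl; apply/eqP; rewrite -addr_eq0 -lbrDl xt13.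
Qed.

Let Ct13 n : iter n C t13 = iter n (ad (- x1)) t13.
Proof.
apply: iter_eq => m; rewrite -[LHS]iter_ad_comm; last by rewrite lbrNl x13 oppr0.
rewrite -[RHS]iterS iterSr; congr iter.
by rewrite /ad lbrNl; apply/eqP; rewrite -addr_eq0 addrC -lbrDl xt13.
Qed.

Let st23 n : iter n (ad (x1 + x3)) t23 = iter n C t23.
Proof.
apply: iter_eq => m; rewrite {1}/ad lbrDl.
by rewrite -[ [l: x1, _] ]iter_ad_comm // [ad x1 _]x1t23 iter_ad_zero add0r.
Qed.

Let st12 n : iter n (ad (x1 + x3)) t12 = iter n A t12.
Proof.
apply: iter_eq => m; rewrite {1}/ad lbrDl.
by rewrite -[ [l: x3, _] ]iter_ad_comm // [ad x3 _]x3t12 iter_ad_zero addr0.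
Qed.

Let Ct12 n : [l: x3, iter n A t12] = 0.
Proof. by rewrite -[LHS]iter_ad_comm // [ad x3 _]x3t12 iter_ad_zero. Qed.
Let At23 n : [l: x1, iter n C t23] = 0.
Proof. by rewrite -[LHS]iter_ad_comm // [ad x1 _]x1t23 iter_ad_zero. Qed.

Let t13_Ct23 n : [l: t13, iter n C t23] = - P (s ^+ n) nu.
Proof.
rewrite -st23 -iter_ad_lbrr // t13t23 Psn.
elim: n => //= n ->; exact: lbrNr.
Qed.

Let At12_t13 n : [l: iter n A t12, t13] = - P (s ^+ n) nu.
Proof.
rewrite -st12 -iter_ad_lbrl // t12t13 Psn.
elim: n => //= n ->; exact: lbrNr.
Qed.

(** On t13 the operator [ad x1] acts as - [ad x3], and this one kills the left entry, so it can be
    taken out of the bracket. *)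
Let At12_At13 m n : [l: iter m A t12, iter n A t13] = - P (s ^+ m * (- g) ^+ n) nu.
Proof.
rewrite At13 -iter_ad_lbrr; last by rewrite lbrNl Ct12 oppr0.
rewrite At12_t13 mulrC padM // Pngn.
by elim: n => //= n ->; rewrite /ad lbrNr.
Qed.

Let At12_Ct23 m n : [l: iter m A t12, iter n C t23] = P (a ^+ m * g ^+ n) nu.
Proof.
rewrite -iter_ad_lbrr // -iter_ad_lbrl // mulrC padM // Pgn Pan.
by [].
Qed.

Let At13_Ct23 m n : [l: iter m A t13, iter n C t23] = - P (a ^+ m * s ^+ n) nu.
Proof.
rewrite -iter_ad_lbrl // t13_Ct23 padM // Pan.
by elim: m => //= m ->; rewrite /ad lbrNr.
Qed.

(** Moving y1 past one [ad x3] leaves a bracket with t13, equal to a power of s applied to nu up to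
    sign; these add up to a divided difference. *)
Let y1_Ct23 n : [l: y1, iter n C t23] = P (dd g s n) nu.
Proof.
elim: n => [|n IH] /=; first by rewrite pad0.
rewrite {1}/ad lbr_leibniz (lbrC y1 x3) x3y1 lbrNl t13_Ct23 opprK IH.
by rewrite padD padM // Pg addrC.
Qed.

Let At12_y3 n : [l: iter n A t12, y3] = P (dd a s n) nu.
Proof.
elim: n => [|n IH] /=; first by rewrite pad0 lbrC y3t12 oppr0.
rewrite {1}/ad lbr_leibnizl IH x1y3 At12_t13 opprK.
by rewrite padD padM // Pa.
Qed.

Let y_At13 n : [l: y1 + y3, iter n A t13] = - P (dd a (- g) n) nu.
Proof.
have x1y : [l: x1, y1 + y3] = - t12 by rewrite lbrDr x1y1 x1y3 opprD subrK.
elim: n => [|n IH] /=; first by rewrite pad0 oppr0.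
rewrite {1}/ad lbr_leibniz (lbrC _ x1) x1y opprK IH.
have -> : [l: t12, iter n A t13] = - P ((- g) ^+ n) nu.
  by have := At12_At13 0 n; rewrite expr0 mul1r.
by rewrite padD padM // Pa lbrNr opprD addrC.
Qed.

Let h := bernT_coef.

Let Ch13 : oser h C t13 = - oser h A t13 - t13.
Proof. by rewrite -(bernT_adN x13 xt13) addrA addNr add0r. Qed.

(** Since b(s) = 1 + s h(s), the entries are y1 - h(ad x1)(t12 + t13) and y3 + h(ad x1)(t13) - h(ad
    x3)(t23). What the expanded bracket contains besides [y1, y3] is the sum over n of [bern_quad n]
    applied to nu. *)
Lemma elliptic_relation :
  [l: oser bern_coef A y1, oser bern_coef C y3 - t13] = [l: y1, y3].
Proof.
have nA := nilop_ad x1; have nC := nilop_ad x3.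
have -> : oser bern_coef A y1 = y1 - (oser h A t12 + oser h A t13).
  by rewrite (oser_bern nA) (oser_comm _ _ nA nA) // [A y1]x1y1 oserN // oserDr.
have -> : oser bern_coef C y3 - t13 = y3 + oser h A t13 - oser h C t23.
  rewrite (oser_bern nC) (oser_comm _ _ nC nC) // [C y3]x3y3 oserN // oserDr // Ch13.
  zmod.
have fi (D : L -> L) n u : nilop D -> fil n (iter n D u).
  by move=> nD; apply: fil_le (nilop_iter nD n (fil_1 u)); apply: leq_addr.
have fb n y u : fil n u -> fil n [l: y, u].
  by move=> hu; apply: (@fil_le _ _ _ n.+1) => //; apply: fil_lbrr.
have fb' n y u : fil n u -> fil n [l: u, y].
  by move=> hu; apply: (@fil_le _ _ _ n.+1) => //; apply: fil_lbrl.
pose q1 n := qscale (h n.+1) (P (dd g s n.+1) nu).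
pose q2 n := qscale (h n.+1) (P (dd a s n.+1) nu).
pose q3 n := qscale (h n.+1) (P (dd a (- g) n.+1) nu).
pose d (F : nat -> nat -> R) n : L :=
  \sum_(i < n.+1) qscale (h i * h (n - i)%N) (P (F i (n - i)%N) nu).
have fq n y u m : fil n (iter n (ad y) u) -> fil n [l: m, iter n (ad y) u] by exact: fb.
have f1 n : fil n (q1 n).
  apply/fil_qscale; rewrite -y1_Ct23; apply: (@fil_le _ _ _ n.+1) => //.
  by apply/fb/fi.
have f2 n : fil n (q2 n).
  apply/fil_qscale; rewrite -At12_y3; apply: (@fil_le _ _ _ n.+1) => //.
  by apply/fb'/fi.
have f3 n : fil n (q3 n).
  apply/fil_qscale; rewrite -[P _ _]opprK -y_At13; apply/fil_N.
  by apply: (@fil_le _ _ _ n.+1) => //; apply/fb/fi.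
have f4 n : fil n (d (fun i j => s ^+ i * (- g) ^+ j) n).
  apply: fil_sum => i _; apply/fil_qscale.
  rewrite -[P _ _]opprK -At12_At13; apply/fil_N.
  by have := fil_lbr _ _ _ _ (fi A i t12 nA) (fi A (n - i)%N t13 nA); rewrite subnKC ?leq_ord.
have f5 n : fil n (d (fun i j => a ^+ i * g ^+ j) n).
  apply: fil_sum => i _; apply/fil_qscale; rewrite -At12_Ct23.
  by have := fil_lbr _ _ _ _ (fi A i t12 nA) (fi C (n - i)%N t23 nC); rewrite subnKC ?leq_ord.
have f6 n : fil n (d (fun i j => a ^+ i * s ^+ j) n).
  apply: fil_sum => i _; apply/fil_qscale.
  rewrite -[P _ _]opprK -At13_Ct23; apply/fil_N.
  by have := fil_lbr _ _ _ _ (fi A i t13 nA) (fi C (n - i)%N t23 nC); rewrite subnKC ?leq_ord.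
have e1 : [l: y1, oser h C t23] = lsum q1.
  rewrite lbr_oserr // lsum_recl0; first by congr lsum; apply/funext => n; rewrite y1_Ct23.
    by rewrite y1_Ct23 pad0 qscaler0.
  by move=> n; apply/fil_qscale/fb/fi.
have e2 : [l: oser h A t12, y3] = lsum q2.
  rewrite lbrC lbr_oserr // lsum_recl0; last 2 first.
  - by rewrite lbrC At12_y3 pad0 oppr0 qscaler0.
  - by move=> n; apply/fil_qscale/fb/fi.
  rewrite -lsumN; last by move=> n; apply/fil_qscale/(@fil_le _ _ _ n.+1)/fb/fi.
  by congr lsum; apply/funext => n; rewrite -qscaleNr -lbrC At12_y3.
have e3 : [l: y1 + y3, oser h A t13] = - lsum q3.
  rewrite lbr_oserr // lsum_recl0; last 2 first.
  - by rewrite y_At13 pad0 oppr0 qscaler0.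
  - by move=> n; apply/fil_qscale/fb/fi.
  by rewrite -lsumN //; congr lsum; apply/funext => n; rewrite y_At13 qscaleNr.
have e4 : [l: oser h A t12, oser h A t13] = - lsum (d (fun i j => s ^+ i * (- g) ^+ j)).
  rewrite lbr_oser2 // -lsumN //; congr lsum; apply/funext => n; rewrite -sumrN.
  by apply: eq_bigr => i _; rewrite At12_At13 qscaleNr.
have e5 : [l: oser h A t12, oser h C t23] = lsum (d (fun i j => a ^+ i * g ^+ j)).
  rewrite lbr_oser2 //; congr lsum; apply/funext => n.
  by apply: eq_bigr => i _; rewrite At12_Ct23.
have e6 : [l: oser h A t13, oser h C t23] = - lsum (d (fun i j => a ^+ i * s ^+ j)).
  rewrite lbr_oser2 // -lsumN //; congr lsum; apply/funext => n; rewrite -sumrN.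
  by apply: eq_bigr => i _; rewrite At13_Ct23 qscaleNr.
rewrite !(lbrDl, lbrDr, lbrNl, lbrNr) e1 e2 e4 e5 e6 lbrxx.
rewrite (lbrC (oser h A t13) y3).
have -> : [l: y1, oser h A t13] = - lsum q3 - [l: y3, oser h A t13] by rewrite -e3 lbrDl addrK.
have dE F n : d F n =
    P (\sum_(i < n.+1) cst (h i * h (n - i)%N) * F i (n - i)%N) nu.
  by rewrite pad_sum; apply: eq_bigr => i _; rewrite padM // pad_cst.
have Z n : - q1 n - q2 n - q3 n + d (fun i j => s ^+ i * (- g) ^+ j) n
    + d (fun i j => a ^+ i * g ^+ j) n - d (fun i j => a ^+ i * s ^+ j) n = 0.
  have a0 : a != 0 by rewrite /a polyX_eq0.
  have g0 : g != 0 by rewrite /g polyC_eq0 polyX_eq0.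
  have s0 : a + g != 0.
    apply/eqP => /(congr1 (fun p : R => p`_1)); rewrite coefD coefX coefC coef0 addr0.
    by move/eqP; rewrite oner_eq0.
  rewrite /q1 /q2 /q3 -!(pad_cst x1 x3) -!padM // !dE -!padN -!padD.
  apply: etrans (pad0 x1 x3 nu); apply: (congr1 (fun p => P p nu)).
  apply: etrans (bern_quad_eq0 cst a0 g0 s0 n); rewrite /bern_quad -/s.
  have -> : \sum_(i < n.+1) cst (bernT_coef i * bernT_coef (n - i)%N) *
      (s ^+ i * (- g) ^+ (n - i) + a ^+ i * g ^+ (n - i) - a ^+ i * s ^+ (n - i)) =
    \sum_(i < n.+1) cst (h i * h (n - i)%N) * (s ^+ i * (- g) ^+ (n - i)) +
    \sum_(i < n.+1) cst (h i * h (n - i)%N) * (a ^+ i * g ^+ (n - i)) -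
    \sum_(i < n.+1) cst (h i * h (n - i)%N) * (a ^+ i * s ^+ (n - i)).
    rewrite -sumrN -!big_split; apply: eq_bigr => i _ /=.
    by rewrite mulrBr mulrDr.
  have RR (c d1 d2 d3 S4 S5 S6 : R) :
    - (c * d1) - c * d2 - c * d3 + S4 + S5 - S6 = - c * (d1 + d2 + d3) + (S4 + S5 - S6).
    by ring.
  by rewrite -RR.
have QQ : - lsum q1 - lsum q2 - lsum q3 + lsum (d (fun i j => s ^+ i * (- g) ^+ j))
   + lsum (d (fun i j => a ^+ i * g ^+ j)) - lsum (d (fun i j => a ^+ i * s ^+ j)) = 0.
  rewrite -!lsumN // -!lsumD //; try by move=> n; repeat (apply: fil_D || apply: fil_N).
  rewrite (_ : (fun n => _) = fun=> 0); last by apply/funext => n; apply: Z.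
  by apply: lsum_unique => n; rewrite ?big1 ?subr0 //; apply: fil_0.
have sumE (Y B q1' q2' q3' e4' e5' e6' : L) :
    Y + (- q3' - B) - q1' - (q2' - e4' - e5' + (- B + 0 - - e6')) =
    Y + (- q1' - q2' - q3' + e4' + e5' - e6') by zmod.
by rewrite sumE QQ addr0.
Qed.
End EllipticRelation.

(** * The relations of t_{1,3} *)

Section EllipticFamily.
Variables (k : qalgType) (L : clieType k).

Definition perm3 (i j l : nat) := perm_eq [:: i; j; l] [:: 1; 2; 3]%N.

(* The relations of t_{1,3}. *)
Record ell3 (x y : nat -> L) (t : nat -> nat -> L) : Prop := Ell3 {
  ell_xx i j l : perm3 i j l -> [l: x i, x j] = 0;
  ell_yy i j l : perm3 i j l -> [l: y i, y j] = 0;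
  ell_xy i j l : perm3 i j l -> [l: x i, y j] = t i j;
  ell_t i j l : perm3 i j l -> t i j = t j i;
  ell_xt i j l : perm3 i j l -> [l: x l, t i j] = 0;
  ell_yt i j l : perm3 i j l -> [l: y l, t i j] = 0;
  ell_sx i j l : perm3 i j l -> x i + x j + x l = 0;
  ell_sy i j l : perm3 i j l -> y i + y j + y l = 0
}.

(* The relations of t_{1,3} in terms of x_i and t_{0i} = - b(ad x_i)(y_i),
   b(s) = s / (e^s - 1). *)
Record ell3b (x u : nat -> L) (t : nat -> nat -> L) : Prop := Ell3b {
  ellb_xx i j l : perm3 i j l -> [l: x i, x j] = 0;
  ellb_sx i j l : perm3 i j l -> x i + x j + x l = 0;
  ellb_t i j l : perm3 i j l -> t i j = t j i;
  ellb_xt i j l : perm3 i j l -> [l: x l, t i j] = 0;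
  ellb_ut i j l : perm3 i j l -> [l: u l, t i j] = 0;
  ellb_Ad i j l : perm3 i j l -> Ad (- x i) (u j) = u j + t i j;
  ellb_uu i j l : perm3 i j l -> [l: u i, u j + t i j] = 0;
  ellb_su i j l : perm3 i j l -> u i + u j + u l + t i j + t i l + t j l = 0
}.

Lemma perm3_sym i j l : perm3 i j l -> perm3 j i l.
Proof. by apply: perm_trans; apply/permP => a /=; rewrite addnCA. Qed.
Lemma perm3_rot i j l : perm3 i j l -> perm3 j l i.
Proof. by apply: perm_trans; apply/permP => a /=; lia. Qed.
Lemma perm3_swap i j l : perm3 i j l -> perm3 i l j.
Proof. by move=> /perm3_rot/perm3_rot/perm3_sym. Qed.

Lemma ell_xx_self x y t i j l : ell3 x y t -> perm3 i j l ->
  [l: x i, y i] = - (t i j + t i l).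
Proof.
move=> E h; have -> : y i = (y i + y j + y l) - y j - y l by zmod.
rewrite (ell_sy E h) !lbrDr !lbrNr lbr0r (ell_xy E h) (ell_xy E (perm3_swap h)); zmod.
Qed.

(** For the relation on [Ad (- x i)]: [x_i, y_j] = t_ij, and on t_ij the operator - [ad (x i)] acts
    as [ad (x j)], so the series (e^s - 1)/s meets its inverse b. The sum relation is h(s) + h(-s) =
    -1 for each pair of strands. *)
Lemma ell3_b x y t : ell3 x y t -> ell3b x (fun i => - oser bern_coef (ad (x i)) (y i)) t.
Proof.
move=> E; have sum_t i j l : perm3 i j l -> [l: x i + x j, t i j] = 0.
  move=> h; have -> : x i + x j = - x l.
    by apply/eqP; rewrite -subr_eq0 opprK (ell_sx E h).
  by rewrite lbrNl (ell_xt E h) oppr0.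
split=> i j l h; have [h1 h2 h3] := And3 (perm3_sym h) (perm3_rot h) (perm3_swap h).
- exact: (ell_xx E h).
- exact: (ell_sx E h).
- exact: (ell_t E h).
- exact: (ell_xt E h).
- rewrite lbrNl lbrC lbr_oser_eq0 ?oppr0 //; apply: lbr_swap.
    exact: (ell_xt E h).
  exact: (ell_yt E h).
- have xij : [l: - x i, x j] = 0 by rewrite lbrNl (ell_xx E h) oppr0.
  have xx : [l: x i, x j] = 0 := ell_xx E h.
  have nx (z : L) := nilop_ad z.
  rewrite Ad_eps lbr_oser_self lbrNr lbr_oser_ad ?(lbr_swap xij) //.
  rewrite lbrNl (ell_xy E h) !oserN // opprK -(oser_adN_agree _ xx (sum_t _ _ _ h)).
  by rewrite oser_eps_bern.
- have -> : [l: - oser bern_coef (ad (x i)) (y i), - oser bern_coef (ad (x j)) (y j) + t i j]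
      = [l: oser bern_coef (ad (x i)) (y i), oser bern_coef (ad (x j)) (y j) - t i j].
    by rewrite !(lbrDr, lbrNr, lbrNl); zmod.
  rewrite (@elliptic_relation _ _ (x i) (x j) (y i) (y j) (t i l) (t i j) (t j l)).
  - exact: (ell_yy E h).
  - exact: (ell_xx E h).
  - exact: (ell_xy E h).
  - by rewrite (ell_xy E h1) (ell_t E h1).
  - by rewrite (ell_xx_self E h) addrC.
  - by rewrite (ell_xx_self E h1) (ell_t E h1).
  - exact: (sum_t _ _ _ h).
  - exact: (ell_xt E h3).
  - exact: (ell_xt E h2).
  - exact: (ell_yt E h2).
  - exact: (ell_yt E h3).
  - have -> : y i + y j = - y l by apply/eqP; rewrite -subr_eq0 opprK (ell_sy E h).
    by rewrite lbrNl (ell_yt E h) oppr0.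
have bE i' j' l' : perm3 i' j' l' -> - oser bern_coef (ad (x i')) (y i') =
    - y i' + oser bernT_coef (ad (x i')) (t i' j') + oser bernT_coef (ad (x i')) (t i' l').
  move=> h'; have nx := nilop_ad (x i').
  by rewrite oser_bern_ad (ell_xx_self E h') oserN // oserDr //; zmod.
have p i' j' l' : perm3 i' j' l' ->
    oser bernT_coef (ad (x i')) (t i' j') + oser bernT_coef (ad (x j')) (t j' i') = - t i' j'.
  move=> h'; rewrite -(ell_t E h'); apply: bernT_adN (sum_t _ _ _ h').
  exact: (ell_xx E h').
rewrite (bE _ _ _ h) (bE _ _ _ h1) (bE l i j); last by apply/perm3_rot.
have := ell_sy E h; have := p _ _ _ h; have := p _ _ _ h2; have := p _ _ _ h3.
move: (oser _ _ (t i j)) (oser _ _ (t j i)) (oser _ _ (t i l)) (oser _ _ (t l i)).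
move: (oser _ _ (t j l)) (oser _ _ (t l j)) => a b c d e f H1 H2 H3 H4.
have -> : y i = - y j - y l by apply/eqP; rewrite -subr_eq0 -[X in _ == X]H4; apply/eqP; zmod.
have -> : t i j = - (c + d) by rewrite H3 opprK.
have -> : t i l = - (e + f) by rewrite H1 opprK.
have -> : t j l = - (a + b) by rewrite H2 opprK.
zmod.
Qed.

(** The converse passage, by the inverse series. [elliptic_relation] is now read from right to left,
    once its hypotheses on the new y_i are established. *)
Lemma ell3b_ell x u t : ell3b x u t -> ell3 x (fun i => - oser eps_coef (ad (x i)) (u i)) t.
Proof.
move=> E; set y := fun i => _.
have nx i := nilop_ad (x i).
have sum_x i j l : perm3 i j l -> x i + x j = - x l.
  by move=> h; apply/eqP; rewrite -subr_eq0 opprK (ellb_sx E h).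
have sum_t i j l : perm3 i j l -> [l: x i + x j, t i j] = 0.
  by move=> h; rewrite (sum_x _ _ _ h) lbrNl (ellb_xt E h) oppr0.
have yt i j l : perm3 i j l -> [l: y l, t i j] = 0.
  move=> h; rewrite lbrNl lbrC lbr_oser_eq0 ?oppr0 //; apply: lbr_swap.
    exact: (ellb_xt E h).
  exact: (ellb_ut E h).
have xy i j l : perm3 i j l -> [l: x i, y j] = t i j.
  move=> h; have xx := ellb_xx E h; have xx' := lbr_swap xx.
  have nN := nilop_ad (- x i).
  have xij : [l: - x i, x j] = 0 by rewrite lbrNl xx oppr0.
  have He : oser eps_coef (ad (- x i)) [l: - x i, u j] = t i j.
    apply: (addrI (u j)); rewrite -lbr_oser_self -Ad_eps; exact: (ellb_Ad E h).
  have Hb : [l: x i, u j] = - oser bern_coef (ad (x j)) (t i j).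
    rewrite -(oser_adN_agree _ xx (sum_t _ _ _ h)) -He oser_bern_eps // lbrNl opprK //.
  by rewrite lbrNr lbr_oser_ad // Hb oserN // opprK oser_eps_bern.
have xyi i j l : perm3 i j l -> [l: x i, y i] = - (t i j + t i l).
  move=> h; have := Ad_eps (x i) (u i).
  (* By the sum relation u_i is - (u_j + t_ij) - (u_l + t_il) - t_jl; [Ad (x i)] brings the first
     two parentheses back to u_j and u_l and fixes t_jl. *)
  have -> : Ad (x i) (u i) = u i + (t i j + t i l).
    have e : u i = - (u j + t i j) - (u l + t i l) - t j l.
      by apply/eqP; rewrite -subr_eq0 -[X in _ == X](ellb_su E h); apply/eqP; zmod.
    rewrite {1}e -(ellb_Ad E h) -(ellb_Ad E (perm3_swap h)) !AdB AdN !AdK.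
    rewrite (Ad_fix (ellb_xt E (perm3_rot h))) e; zmod.
  by move/addrI => ->; rewrite -lbrNr.
have bE i j l : perm3 i j l ->
    u i = - y i + oser bernT_coef (ad (x i)) (t i j) + oser bernT_coef (ad (x i)) (t i l).
  move=> h; have -> : u i = - oser bern_coef (ad (x i)) (y i).
    by rewrite oserN // opprK oser_bern_eps.
  by rewrite oser_bern_ad (xyi _ _ _ h) oserN // oserDr //; zmod.
have sy i j l : perm3 i j l -> y i + y j + y l = 0.
  move=> h.
  have p i' j' l' : perm3 i' j' l' ->
      oser bernT_coef (ad (x i')) (t i' j') + oser bernT_coef (ad (x j')) (t j' i') = - t i' j'.
    move=> h'; rewrite -(ellb_t E h'); apply: bernT_adN (sum_t _ _ _ h').
    exact: (ellb_xx E h').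
  have [h1 h2 h3] := And3 (perm3_sym h) (perm3_rot h) (perm3_swap h).
  have := ellb_su E h; rewrite (bE _ _ _ h) (bE _ _ _ h1) (bE l i j); last by apply/perm3_rot.
  have := p _ _ _ h; have := p _ _ _ h2; have := p _ _ _ h3.
  move: (oser _ _ (t i j)) (oser _ _ (t j i)) (oser _ _ (t i l)) (oser _ _ (t l i)).
  move: (oser _ _ (t j l)) (oser _ _ (t l j)) => a b c d e f H1 H2 H3 H4.
  apply: oppr_inj; rewrite oppr0 -[RHS]H4.
  have -> : t i j = - (c + d) by rewrite H3 opprK.
  have -> : t i l = - (e + f) by rewrite H1 opprK.
  have -> : t j l = - (a + b) by rewrite H2 opprK.
  zmod.
split=> //; try by move=> i j l h; first [exact: (ellb_xx E h) | exact: (ellb_t E h)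
  | exact: (ellb_xt E h) | exact: (ellb_sx E h)].
move=> i j l h; have [h1 h2 h3] := And3 (perm3_sym h) (perm3_rot h) (perm3_swap h).
rewrite -(@elliptic_relation _ _ (x i) (x j) (y i) (y j) (t i l) (t i j) (t j l)).
- have bu m : oser bern_coef (ad (x m)) (y m) = - u m by rewrite oserN // oser_bern_eps.
  by rewrite !bu -opprD lbrNl lbrNr opprK (ellb_uu E h).
- exact: (ellb_xx E h).
- exact: (xy _ _ _ h).
- by rewrite (xy _ _ _ h1) (ellb_t E h1).
- by rewrite (xyi _ _ _ h) addrC.
- by rewrite (xyi _ _ _ h1) (ellb_t E h1).
- exact: (sum_t _ _ _ h).
- exact: (ellb_xt E h3).
- exact: (ellb_xt E h2).
- exact: (yt _ _ _ h2).
- exact: (yt _ _ _ h3).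
- have -> : y i + y j = - y l by apply/eqP; rewrite -subr_eq0 opprK (sy _ _ _ h).
  by rewrite lbrNl (yt _ _ _ h) oppr0.
Qed.

End EllipticFamily.

(** * Twisting by an associator *)

Section Twist.
Variables (k : qalgType) (g : f2 k).
Hypothesis gG : GRT1 g.
Variables (L : clieType k) (x t0 : nat -> L) (t : nat -> nat -> L).
Hypothesis E : ell3b x t0 t.
Local Notation G a b := (f2_subst (a : L) (b : L) g).

Lemma perm3_ind (P : nat -> nat -> nat -> Prop) :
  P 1 2 3 -> P 1 3 2 -> P 2 1 3 -> P 2 3 1 -> P 3 1 2 -> P 3 2 1 ->
  forall i j l, perm3 i j l -> P i j l.
Proof.
move=> h1 h2 h3 h4 h5 h6 i j l h.
have m a : a \in [:: i; j; l] -> [\/ a = 1%N, a = 2 | a = 3].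
  rewrite (perm_mem h) !inE => /or3P[] /eqP ->; [exact: Or31 | exact: Or32 | exact: Or33].
have u : uniq [:: i; j; l] by rewrite (perm_uniq h).
have [] := m i; rewrite ?inE ?eqxx // => ei; have [] := m j; rewrite ?inE ?eqxx ?orbT // => ej;
have [] := m l; rewrite ?inE ?eqxx ?orbT // => el; by move: u; rewrite ei ej el.
Qed.

Let tau (a b : 'I_4) : L :=
  if val a == val b then 0 else if val a is 0%N then t0 b
  else if val b is 0%N then t0 a else t a b.

Let ut_tt i j l : perm3 i j l -> [l: t i j, t0 i + t0 j] = 0.
Proof.
move=> h; have e1 := ellb_uu E h; have e2 := ellb_uu E (perm3_sym h).
rewrite -(ellb_t E h) in e2.
rewrite lbrDr (lbrC _ (t0 i)) (lbrC _ (t0 j)); move: e1 e2.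
rewrite !lbrDr (lbrC (t0 j) (t0 i)) => e1 e2; have e3 := congr2 +%R e1 e2.
by rewrite addr0 in e3; apply: oppr_inj; rewrite oppr0 -[RHS]e3; zmod.
Qed.

Let tu_uu i j l : perm3 i j l -> [l: t0 i, t i j + t0 j] = 0.
Proof. by move=> h; rewrite addrC (ellb_uu E h). Qed.

Let uu_tu i j l : perm3 i j l -> [l: t0 i, t0 j + t i j] = 0.
Proof. by move=> h; rewrite (ellb_uu E h). Qed.

(** The sum relation expresses t_il + t_jl through t_0l, t_0i + t_0j and t_ij, all of which commute
    with t_ij. *)
Let t_tt i j l : perm3 i j l -> [l: t i j, t i l + t j l] = 0.
Proof.
move=> h; have -> : t i l + t j l = - (t0 l + (t0 i + t0 j) + t i j).
  apply/eqP; rewrite -subr_eq0 -[X in _ == X](ellb_su E h); apply/eqP; zmod.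
rewrite lbrNr !lbrDr lbrxx addr0.
by rewrite (lbr_swap (ellb_ut E h)) add0r -lbrDr (ut_tt h) oppr0.
Qed.

Let tau_family : tn_family tau.
Proof.
split.
- by move=> i; rewrite /tau eqxx.
- move=> [[|[|[|[|i]]]] hi] [[|[|[|[|j]]]] hj] //; rewrite /tau /=;
  first [by [] | (apply: (@ellb_t _ _ _ _ _ E _ _ 1); exact: isT) | (apply: (@ellb_t _ _ _ _ _ E _ _ 2); exact: isT)
    | (apply: (@ellb_t _ _ _ _ _ E _ _ 3); exact: isT)].
- move=> [[|[|[|[|i]]]] hi] [[|[|[|[|j]]]] hj] [[|[|[|[|l]]]] hl] //= _; rewrite /tau /=;
  first [(apply: (@t_tt _ _ _); exact: isT) | (apply: (@ut_tt _ _ 1); exact: isT) | (apply: (@ut_tt _ _ 2); exact: isT)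
    | (apply: (@ut_tt _ _ 3); exact: isT) | (apply: (@tu_uu _ _ 1); exact: isT) | (apply: (@tu_uu _ _ 2); exact: isT)
    | (apply: (@tu_uu _ _ 3); exact: isT) | (apply: (@uu_tu _ _ 1); exact: isT)| (apply: (@uu_tu _ _ 2); exact: isT)
    | (apply: (@uu_tu _ _ 3); exact: isT) ].
- move=> [[|[|[|[|i]]]] hi] [[|[|[|[|j]]]] hj] [[|[|[|[|l]]]] hl] [[|[|[|[|m]]]] hm] //= _;
  rewrite /tau /=; first [(apply: (@ellb_ut _ _ _ _ _ E _ _ _); exact: isT)
    | (apply: lbr_swap; apply: (@ellb_ut _ _ _ _ _ E _ _ _); exact: isT)].
Qed.

(* g^{a,b,c}, g^{0,a,b}, g^{0,ab,c}, g^{0,a,bc} and g^{0a,b,c} *)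
Definition gA a b c : L := G (t a b) (t b c).
Definition gB a b : L := G (t0 a) (t a b).
Definition gC a b c : L := G (t0 a + t0 b) (t a c + t b c).
Definition gD a b c : L := G (t0 a) (t a b + t a c).
Definition gF a b c : L := G (t0 b + t a b) (t b c).

Let pent a b c : perm3 a b c -> gA a b c \*e gC a b c \*e gB a b = gD a b c \*e gF a b c.
Proof.
pose p0 : 'I_4 := @Ordinal 4 0 isT; pose p1 : 'I_4 := @Ordinal 4 1 isT.
pose p2 : 'I_4 := @Ordinal 4 2 isT; pose p3 : 'I_4 := @Ordinal 4 3 isT.
move: a b c; apply: perm3_ind; rewrite /gA /gB /gC /gD /gF.
- exact: (grt_pentagon gG tau_family (isT : uniq [:: p0; p1; p2; p3])).
- exact: (grt_pentagon gG tau_family (isT : uniq [:: p0; p1; p3; p2])).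
- exact: (grt_pentagon gG tau_family (isT : uniq [:: p0; p2; p1; p3])).
- exact: (grt_pentagon gG tau_family (isT : uniq [:: p0; p2; p3; p1])).
- exact: (grt_pentagon gG tau_family (isT : uniq [:: p0; p3; p1; p2])).
- exact: (grt_pentagon gG tau_family (isT : uniq [:: p0; p3; p2; p1])).
Qed.

Let tE := ellb_t E.

Let triple a b c : perm3 a b c ->
  [/\ gA c b a = - gA a b c, gA c a b \*e gA b c a \*e gA a b c = 0 &
    t a b + Ad (gA c b a) (t b c) + Ad (gA c a b) (t a c) = t a b + t a c + t b c].
Proof.
move=> h; have [h1 h2 h3] := And3 (perm3_sym h) (perm3_rot h) (perm3_swap h).
have [ba ca cb] := And3 (tE h) (tE h3) (tE h2).
rewrite /gA -ba -ca -cb.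
have abc : [l: t a b, t a c + t b c] = 0 := t_tt h.
have acb : [l: t a c, t a b + t b c] = 0 by rewrite [t b c]cb; exact: t_tt h3.
have bca : [l: t b c, t a b + t a c] = 0 by rewrite ba ca; exact: t_tt h2.
have [e1 e2 e3] := grt_triple gG abc acb bca.
have [e4 _ _] : [/\ G (t a c) (t a b) = - G (t a b) (t a c), True & True].
  split=> //; have [] := @grt_triple _ _ gG _ (t a b) (t b c) (t a c) => //.
  by rewrite addrC.
by split; [exact: e1 | exact: e2 | rewrite e1 e4].
Qed.

(* e^{x_a} moves the strand a around 0 and so passes g^{0a,b,c} into g^{0,b,c}. *)
Let x_gF a b c : perm3 a b c -> x a \*e gF a b c = gB b c \*e x a.
Proof.
move=> h; rewrite emul_Ad /gF f2_subst_Ad -(ellb_Ad E h) AdK Ad_fix //.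
exact: (ellb_xt E (perm3_rot h)).
Qed.

Let xx_emul i j l : perm3 i j l -> x i \*e x j = - x l.
Proof.
move=> h; rewrite emul_comm ?(ellb_xx E h) //.
by apply/eqP; rewrite -subr_eq0 opprK (ellb_sx E h).
Qed.

Let C_sym a b c : gC a b c = gC b a c.
Proof. by rewrite /gC addrC [t a c + _]addrC. Qed.
Let D_sym a b c : gD a b c = gD a c b.
Proof. by rewrite /gD [t a b + _]addrC. Qed.

(* alpha_g(x_1)^{i,jl} *)
Let base i j l := gC j l i \*e x i \*e - gD i j l.

Let A_inv a b c : perm3 a b c -> gA c b a = - gA a b c.
Proof. by case/triple. Qed.
Let A_cocycle a b c : perm3 a b c -> gA c b a = gA c a b \*e gA b c a.
Proof.
move=> h; have [e1 e2 _] := triple h; apply: (@emul_rcan _ _ (gA a b c)).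
by rewrite /= e2 e1 emulNx.
Qed.

(** The hexagon splits the conjugating factor; the pentagons for (j, l, i) and (i, j, l) rewrite the
    left and right ends, and the factors g^{0,j,l} and g^{0i,j,l} left around x_i cancel by
    [x_gF]. *)
Let frame_base i j l : perm3 i j l -> Ad (gA l j i) (base i j l) =
  gA l i j \*e gD j l i \*e gF j l i \*e x i \*e - gB i j \*e - gC i j l.
Proof.
move=> h; have h1 := perm3_rot h.
have p1 : gA j l i \*e gC j l i = gD j l i \*e gF j l i \*e - gB j l.
  by rewrite -(pent h1) emulK.
have p2 : - gD i j l \*e gA i j l = gF i j l \*e - gB i j \*e - gC i j l.
  have -> : gA i j l = gD i j l \*e gF i j l \*e - gB i j \*e - gC i j l.
    by rewrite -(pent h) !emulK.
  by rewrite -!emulA emulNKl.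
rewrite -emul_conj -(A_inv (perm3_swap (perm3_rot h1))) /base (A_cocycle h).
have -> : gA l i j \*e gA j l i \*e (gC j l i \*e x i \*e - gD i j l) \*e gA i j l =
  gA l i j \*e (gA j l i \*e gC j l i) \*e x i \*e (- gD i j l \*e gA i j l).
  by rewrite !emulA.
have e : - gB j l \*e x i \*e gF i j l = x i by rewrite -emulA x_gF // emulNKl.
by rewrite p1 p2 -[in RHS]e !emulA.
Qed.

(* X_i X_l = X_j^{-1} for the images X of the x's, read in the frame of l. *)
Let frame_mul i j l : perm3 i j l ->
  Ad (gA l j i) (base i j l) \*e base l i j = - Ad (gA l i j) (base j i l).
Proof.
move=> h; have [h1 h2 h3] := And3 (perm3_sym h) (perm3_rot h) (perm3_swap h).
have h4 := perm3_rot h2.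
have p : - gF l i j \*e - gD l i j = - gB l i \*e - gC l i j \*e - gA l i j.
  by rewrite -!emulN (emulA (gA l i j)) (pent h4).
have e1 : - gB i j \*e x l = x l \*e - gF l i j.
  by apply: (@emul_rcan _ _ (gF l i j)); rewrite /= emulNK -emulA x_gF // emulNKl.
have e2 : gF j l i \*e - x j \*e - gB l i = - x j.
  apply: (@emul_lcan _ _ (x j)); rewrite /= !emulA x_gF // -[X in X \*e _]emulA emulxN emulx0.
  by rewrite emulxN.
rewrite (frame_base h) /base; rewrite -AdN !emulN opprK -emul_conj.
have -> : gA l i j \*e gD j l i \*e gF j l i \*e x i \*e - gB i j \*e - gC i j l \*e
    (gC i j l \*e x l \*e - gD l i j) =
    gA l i j \*e gD j l i \*e gF j l i \*e (x i \*e x l) \*e (- gF l i j \*e - gD l i j).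
  by rewrite !emulA emulNK -[in LHS](emulA _ (- gB i j)) e1 !emulA.
rewrite p (xx_emul h3) -[in RHS]e2 (C_sym l) (D_sym j) !emulA //.
Qed.
Let t0_gF a b c : perm3 a b c -> Ad (gF a b c) (t0 a) = t0 a.
Proof.
move=> h; apply/Ad_fix/lbr_swap/f2_subst_comm; first exact: (ellb_uu E h).
exact: (ellb_ut E (perm3_rot h)).
Qed.

Let t_gC a b c : perm3 a b c -> Ad (gC a b c) (t a b) = t a b.
Proof.
move=> h; apply/Ad_fix/lbr_swap/f2_subst_comm; first exact: (ut_tt h).
exact: t_tt.
Qed.

(** The pentagon, in which g^{0a,b,c} disappears because it commutes with t_0a. *)
Let u1 a b c : perm3 a b c -> Ad (gA c b a) (Ad (gD a b c) (t0 a)) =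
  Ad (gC a b c) (Ad (gB a b) (t0 a)).
Proof.
move=> h; have e : - gA a b c \*e gD a b c \*e gF a b c = gC a b c \*e gB a b.
  by rewrite -emulA -(pent h) -!emulA emulNKl.
by rewrite -(Ad_mul (gC a b c)) -e !Ad_mul (t0_gF h) (A_inv h).
Qed.

Let u2 a b c : perm3 a b c -> Ad (gA c b a) (Ad (gD a b c) (t0 a)) =
  Ad (gA c a b) (Ad (gC a c b) (Ad (gB a c) (t0 a))).
Proof.
move=> h; have h3 := perm3_swap h.
by rewrite (A_cocycle h) Ad_mul D_sym (u1 h3).
Qed.

Let u3 a b c : perm3 a b c -> Ad (gD c a b) (t0 c) =
  Ad (gA c a b) (Ad (gC a c b) (Ad (gB c a) (t0 c))).
Proof.
move=> h; have h4 := perm3_rot (perm3_rot h).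
rewrite -(Ad_mul (gC a c b)) -(Ad_mul (gA c a b)) emulA (C_sym a) (pent h4).
by rewrite Ad_mul (t0_gF h4).
Qed.

Let trip0 a b c : perm3 a b c -> let S := t a c + t0 a + t0 c in
  [/\ t a c + Ad (gB c a) (t0 c) + Ad (gB a c) (t0 a) = S,
      Ad (gB a c) S = S & Ad (gB c a) S = S].
Proof.
move=> h S; have h3 := perm3_swap h; have [ba ca] := (tE h, tE h3).
have c1 : [l: t a c, t0 a + t0 c] = 0 := ut_tt h3.
have c2 : [l: t0 a, t a c + t0 c] = 0 := tu_uu h3.
have c3 : [l: t0 c, t a c + t0 a] = 0 by rewrite ca; exact: (tu_uu (perm3_sym h3)).
have [e1 _ e2] := grt_triple gG c1 c2 c3.
have c1' : [l: t a c, t0 c + t0 a] = 0 by rewrite addrC.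
have [e3 _ _] := grt_triple gG c1' c3 c2.
have [S1 S2 S3] : [/\ [l: S, t a c] = 0, [l: S, t0 a] = 0 & [l: S, t0 c] = 0].
  split; apply/lbr_swap.
  - by rewrite /S -addrA lbrDr lbrxx c1 addr0.
  - by rewrite /S addrAC lbrDr c2 lbrxx addr0.
  - by rewrite /S lbrDr c3 lbrxx addr0.
split.
- by rewrite /gB -ca e1 e3 e2.
- by apply/Ad_fix/lbr_swap/f2_subst_comm.
- by apply/Ad_fix/lbr_swap/f2_subst_comm; rewrite // -ca.
Qed.

(** Conjugation by x_c adds t_ac to t_0a and turns g^{0,a,b} into g^{0c,a,b}; the pentagon then
    frees g^{0,c,a}, and the hexagon of [trip0] evaluates its action on t_0a + t_ac. *)
Let frame_Ad a b c : perm3 a b c ->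
  Ad (- base c a b) (Ad (gA c b a) (Ad (gD a b c) (t0 a))) =
  Ad (gA c b a) (Ad (gD a b c) (t0 a)) + Ad (gA c a b) (t a c).
Proof.
move=> h; have h4 := perm3_rot (perm3_rot h); have h3 := perm3_swap h.
have [e1 e2 e3] := trip0 h.
rewrite [in LHS](u1 h) (u2 h) -AdDr /base !emulN opprK !Ad_mul (AdNK (gC a b c)).
have -> : Ad (- x c) (Ad (gB a b) (t0 a)) = Ad (gF c a b) (t0 a + t a c).
  rewrite -(Ad_mul (- x c)); have -> : - x c \*e gB a b = gF c a b \*e - x c.
    by apply: (@emul_rcan _ _ (x c)); rewrite /= emulNK -emulA -(x_gF h4) emulNKl.
  by rewrite Ad_mul (ellb_Ad E (perm3_sym h3)) (tE h3).
rewrite -(Ad_mul (gD c a b)) -(pent h4) !Ad_mul -[in RHS](t_gC h3) -AdDr [in LHS]C_sym.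
congr (Ad _ (Ad _ _)).
have -> : t0 a + t a c = (t a c + t0 a + t0 c) - t0 c by zmod.
by rewrite AdB e3 -e1; zmod.
Qed.

(** Up to a common conjugation the second entry is S minus the first, with S the central sum of
    [trip0]. *)
Let frame_uu a b c : perm3 a b c ->
  [l: Ad (gA c b a) (Ad (gD a b c) (t0 a)),
      Ad (gD c a b) (t0 c) + Ad (gA c a b) (t a c)] = 0.
Proof.
move=> h; have h3 := perm3_swap h; have [e1 e2 e3] := trip0 h.
rewrite (u2 h) (u3 h) -[in X in _ + X](t_gC h3) -!AdDr -!Ad_lbr.
have -> : Ad (gB c a) (t0 c) + t a c = (t a c + t0 a + t0 c) - Ad (gB a c) (t0 a).
  by rewrite -e1; zmod.
rewrite lbrBr lbrxx subr0 -{1}e2 -Ad_lbr.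
have -> : t a c + t0 a + t0 c = t0 a + (t a c + t0 c) by zmod.
by rewrite lbrDr lbrxx (tu_uu h3) addr0 !Ad0.
Qed.

(** Three hexagons are combined: on (a, b, c), on (0, a, c), and on (0, b, ac) with the strands a
    and c merged. *)
Let frame_sum a b c : perm3 a b c ->
  Ad (gA c b a) (Ad (gD a b c) (t0 a)) + Ad (gA c a b) (Ad (gD b a c) (t0 b)) +
  Ad (gD c a b) (t0 c) + t a b + Ad (gA c a b) (t a c) + Ad (gA c b a) (t b c) = 0.
Proof.
move=> h; have [h1 h2 h3] := And3 (perm3_sym h) (perm3_rot h) (perm3_swap h).
have [_ _ e0] := triple h; have [e1 _ _] := trip0 h.
have [ba ca cb] := And3 (tE h) (tE h3) (tE h2).
have su := ellb_su E h.
(* With a and c merged, t_ab + t_cb, t_0b and t_0a + t_0c satisfy the relations of t_3. *)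
have c1 : [l: t a b + t c b, t0 b + (t0 a + t0 c)] = 0.
  have -> : t0 b + (t0 a + t0 c) = - (t a b + t c b) - t a c.
    by apply/eqP; rewrite -subr_eq0 -[X in _ == X]su cb; apply/eqP; zmod.
  by rewrite lbrBr lbrNr lbrxx oppr0 sub0r lbrC opprK t_tt.
have c2 : [l: t0 b, (t a b + t c b) + (t0 a + t0 c)] = 0.
  have -> : (t a b + t c b) + (t0 a + t0 c) = (t a b + t0 a) + (t b c + t0 c).
    by rewrite cb; zmod.
  by rewrite lbrDr (tu_uu h2) ba (tu_uu h1) addr0.
have c3 : [l: t0 a + t0 c, (t a b + t c b) + t0 b] = 0.
  rewrite lbrDl; have -> : t a b + t c b + t0 b = (t a b + t0 b) + t b c.
    by rewrite cb; zmod.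
  rewrite lbrDr (tu_uu h) (ellb_ut E h2) addr0 add0r.
  have -> : t a b + t0 b + t b c = t a b + (t c b + t0 b) by rewrite cb; zmod.
  by rewrite lbrDr (ellb_ut E h) (tu_uu (perm3_sym h2)) addr0.
have [e2 _ e3] := grt_triple gG c1 c2 c3.
have c1' : [l: t a b + t c b, (t0 a + t0 c) + t0 b] = 0 by rewrite [t0 a + _ + _]addrC.
have [e4 _ _] := grt_triple gG c1' c3 c2.
have eD : gD b a c = G (t0 b) (t a b + t c b) by rewrite /gD ba cb.
have e5 : Ad (gC a c b) (t0 a + t0 c) + Ad (gD b a c) (t0 b) = t0 a + t0 b + t0 c.
  apply: (addrI (t a b + t c b)); rewrite eD /gC e4 e2 addrA e3; zmod.
have e6 : Ad (gA c a b) (t a b + t a c + t b c) = t a b + t a c + t b c.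
  apply/Ad_fix/lbr_swap/f2_subst_comm.
    have -> : t a b + t a c + t b c = t c a + (t b c + t a b) by rewrite ca; zmod.
    by rewrite lbrC lbrDr lbrxx add0r [t b c]cb (t_tt (perm3_rot h2)) oppr0.
  have -> : t a b + t a c + t b c = t a b + (t a c + t b c) by zmod.
  by rewrite lbrC lbrDr lbrxx add0r t_tt ?oppr0.
rewrite (u2 h) (u3 h).
set P := Ad (gA c a b); set Q := Ad (gC a c b).
have e7 : t a b + P (t a c) + Ad (gA c b a) (t b c) = P (t a b + t a c + t b c).
  by rewrite /P e6 -e0; zmod.
have PD u v : P (u + v) = P u + P v := AdDr _ u v.
have QD u v : Q (u + v) = Q u + Q v := AdDr _ u v.
have q1 : Q (Ad (gB a c) (t0 a)) + Q (Ad (gB c a) (t0 c)) = Q (t0 a + t0 c).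
  rewrite -QD; congr (Q _); apply: (addrI (t a c)); rewrite [RHS]addrA -e1; zmod.
have P0 : P 0 = 0 := Ad0 _.
rewrite -/Q in e5; clearbody P Q.
move: (Ad _ (t0 a)) (Ad _ (t0 b)) (Ad _ (t0 c)) (Ad _ (t b c)) q1 e5 e7 => p q r s q1 e5 e7.
have <- : P (t0 a + t0 b + t0 c + (t a b + t a c + t b c)) = 0.
  by rewrite -[RHS]P0 -[in RHS]su; congr (P _); zmod.
rewrite [RHS]PD -e5 -e7 [P (_ + q)]PD -q1 PD; zmod.
Qed.

Let frame_t a b c : perm3 a b c -> [l: base c a b, t a b] = 0.
Proof.
move=> h; apply/lbr_swap/Ad_fix_lbr; have [h1 h2 h3] := And3 (perm3_sym h) (perm3_rot h) (perm3_swap h).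
have c1 : [l: t a b, x c] = 0 by apply/lbr_swap/(ellb_xt E h).
have c2 : [l: t a b, t c a + t c b] = 0 by rewrite -(tE h3) -(tE h2) (t_tt h).
have c3 : [l: t a b, gD c a b] = 0.
  by apply: f2_subst_comm c2; apply/lbr_swap/(ellb_ut E h).
have c4 : [l: t a b, gC a b c] = 0 := lbr_swap (Ad_fix_lbr (t_gC h)).
by rewrite /base 2!Ad_emul AdN (Ad_fix c1) (Ad_fix c3) (Ad_fix c4).
Qed.

Let frame_ut a b c : perm3 a b c -> [l: Ad (gD c a b) (t0 c), t a b] = 0.
Proof.
move=> h; have [h1 h2 h3] := And3 (perm3_sym h) (perm3_rot h) (perm3_swap h).
have c2 : [l: t a b, t c a + t c b] = 0 by rewrite -(tE h3) -(tE h2) (t_tt h).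
have c3 : [l: t a b, gD c a b] = 0.
  by apply: f2_subst_comm c2; apply/lbr_swap/(ellb_ut E h).
rewrite -[t a b](Ad_fix (lbr_swap c3)) -Ad_lbr (ellb_ut E h) Ad0 //.
Qed.

(* [U c i] is the image of x_i read in the frame of the strand c; Ad (h c d)
   passes from the frame of d to that of c. *)
Let h (c i : nat) : L := if c == i then 0 else gA c (6 - c - i) i.
(** Some index other than i; the third one is found by subtraction, as 1 + 2 + 3 = 6. By [bsE] and
    [T0E] the choice does not affect the result. *)
Let ot (i : nat) : nat := if i == 1%N then 2%N else 1%N.
Let bs i := base i (ot i) (6 - i - ot i).
Let T0 i := Ad (gD i (ot i) (6 - i - ot i)) (t0 i).
Let U c i := Ad (h c i) (bs i).
Let T c i := Ad (h c i) (T0 i).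
(** In the frame of the remaining strand, t_ij is its own image; the conjugation carries it to the
    frame of c. *)
Let tw c i j := Ad (h c (6 - i - j)) (t i j).

Definition twU := U 3.
Definition twT := T 3.
Definition twt := tw 3.

Let hE a b c : perm3 a b c -> [/\ h c a = gA c b a, h c b = gA c a b & h c c = 0].
Proof. by move: a b c; apply: perm3_ind. Qed.

Let bsE a b c : perm3 a b c -> bs a = base a b c.
Proof. by move: a b c; apply: perm3_ind; rewrite // /bs /base /= C_sym D_sym. Qed.

Let T0E a b c : perm3 a b c -> T0 a = Ad (gD a b c) (t0 a).
Proof. by move: a b c; apply: perm3_ind; rewrite // /T0 D_sym. Qed.

Let third a b c : perm3 a b c -> (6 - a - b)%N = c.
Proof. by move: a b c; apply: perm3_ind. Qed.

(** Changes of frame compose: this is the hexagon when the three frames are distinct, and the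
    inversion relation when a = 3. *)
Let h_cocycle a b c z : perm3 a b c -> Ad (h 3 c) (Ad (h c a) z) = Ad (h 3 a) z.
Proof.
move: a b c; apply: perm3_ind; rewrite /h /= ?Ad0l //.
- by rewrite -Ad_mul -(@A_cocycle 1 2 3).
- by rewrite -Ad_mul -(@A_cocycle 2 1 3).
- by rewrite (@A_inv 3 1 2) // AdK.
- by rewrite (@A_inv 3 2 1) // AdK.
Qed.

Let UE a b c : perm3 a b c ->
  [/\ U c a = Ad (gA c b a) (base a b c), U c b = Ad (gA c a b) (base b a c) &
      U c c = base c a b].
Proof.
move=> p; have [e1 e2 e3] := hE p.
rewrite /U e1 e2 e3 Ad0l (bsE p) (bsE (perm3_sym p)) (bsE (perm3_rot (perm3_rot p))) //.
Qed.

Let TE a b c : perm3 a b c ->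
  [/\ T c a = Ad (gA c b a) (Ad (gD a b c) (t0 a)),
      T c b = Ad (gA c a b) (Ad (gD b a c) (t0 b)) & T c c = Ad (gD c a b) (t0 c)].
Proof.
move=> p; have [e1 e2 e3] := hE p.
rewrite /T e1 e2 e3 Ad0l (T0E p) (T0E (perm3_sym p)) (T0E (perm3_rot (perm3_rot p))) //.
Qed.

Let twE a b c : perm3 a b c ->
  [/\ tw c a b = t a b, tw c a c = Ad (gA c a b) (t a c) &
      tw c b c = Ad (gA c b a) (t b c)].
Proof.
move=> p; have [e1 e2 e3] := hE p.
by rewrite /tw (third p) (third (perm3_swap p)) (third (perm3_rot p)) e1 e2 e3 Ad0l.
Qed.

Let frameU a b c : perm3 a b c ->
  [/\ Ad (h 3 c) (U c a) = U 3 a, Ad (h 3 c) (U c b) = U 3 b & Ad (h 3 c) (U c c) = U 3 c].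
Proof.
move=> p; have [_ _ e] := hE p; have -> : U c c = bs c by rewrite /U e Ad0l.
split=> //.
  exact: (h_cocycle _ p).
exact: (h_cocycle _ (perm3_sym p)).
Qed.

Let frameT a b c : perm3 a b c ->
  [/\ Ad (h 3 c) (T c a) = T 3 a, Ad (h 3 c) (T c b) = T 3 b & Ad (h 3 c) (T c c) = T 3 c].
Proof.
move=> p; have [_ _ e] := hE p; have -> : T c c = T0 c by rewrite /T e Ad0l.
split=> //.
  exact: (h_cocycle _ p).
exact: (h_cocycle _ (perm3_sym p)).
Qed.

Let tw_sym a b c d : perm3 a b c -> tw d a b = tw d b a.
Proof. by move=> p; rewrite /tw (third p) (third (perm3_sym p)) (tE p). Qed.

Let frame_tw a b c : perm3 a b c ->
  [/\ Ad (h 3 c) (tw c a b) = tw 3 a b, Ad (h 3 c) (tw c a c) = tw 3 a c &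
    Ad (h 3 c) (tw c b c) = tw 3 b c].
Proof.
move=> p; have [_ _ e] := hE p.
rewrite /tw (third p) (third (perm3_swap p)) (third (perm3_rot p)) e Ad0l; split=> //.
  exact: (h_cocycle _ (perm3_sym p)).
exact: (h_cocycle _ p).
Qed.

Lemma twU_base : [/\ twU 1 = Ad (- gA 1 2 3) (gC 2 3 1 \*e x 1%N \*e - gD 1 2 3),
  twU 2 = Ad (- gA 2 1 3) (gC 1 3 2 \*e x 2%N \*e - gD 2 1 3) &
  twU 3 = gC 1 2 3 \*e x 3%N \*e - gD 3 1 2].
Proof.
have [e1 e2 e3] := UE (isT : perm3 1 2 3).
by rewrite /twU e1 e2 e3 (@A_inv 1 2 3) // (@A_inv 2 1 3).
Qed.

Lemma twT_base : [/\ twT 1 = Ad (- gA 1 2 3) (Ad (gD 1 2 3) (t0 1%N)),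
  twT 2 = Ad (- gA 2 1 3) (Ad (gD 2 1 3) (t0 2%N)) & twT 3 = Ad (gD 3 1 2) (t0 3%N)].
Proof.
have [e1 e2 e3] := TE (isT : perm3 1 2 3).
by rewrite /twT e1 e2 e3 (@A_inv 1 2 3) // (@A_inv 2 1 3).
Qed.

Lemma twt12 : twt 1 2 = t 1%N 2%N.
Proof. by have [] := twE (isT : perm3 1 2 3). Qed.

(** Each relation is moved to the frame of a suitable strand, where one of the preceding lemmas
    applies, and returns to the frame of 3 by the Lie automorphism [Ad (h 3 c)]. *)
Theorem twist_ell3b : ell3b twU twT twt.
Proof.
rewrite /twU /twT /twt.
have Ad_conj (z u v : L) : Ad (- Ad z u) (Ad z v) = Ad z (Ad (- u) v).
  by rewrite -AdN (clie_Ad (phi := idfun) (clie_Ad_morph z)).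
have mul a b c : perm3 a b c -> U 3 a \*e U 3 c = - U 3 b.
  move=> p; have [<- <- <-] := frameU p; have [-> -> ->] := UE p.
  by rewrite -AdN -Ad_emul (frame_mul p).
have UU a b c : perm3 a b c -> [l: U 3 a, U 3 b] = 0.
  move=> p; apply: emul_comm_lbr; rewrite (mul _ _ _ (perm3_swap p)).
  by rewrite (mul _ _ _ (perm3_rot p)).
split=> a b c p.
- exact: UU p.
- have := mul _ _ _ (perm3_swap p); rewrite (emul_comm (UU _ _ _ p)) => ->.
  by rewrite addNr.
- exact: tw_sym p.
- have [_ _ <-] := frameU p; have [<- _ _] := frame_tw p.
  have [_ _ ->] := UE p; have [-> _ _] := twE p.
  by rewrite -Ad_lbr (frame_t p) Ad0.
- have [_ _ <-] := frameT p; have [<- _ _] := frame_tw p.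
  have [_ _ ->] := TE p; have [-> _ _] := twE p.
  by rewrite -Ad_lbr (frame_ut p) Ad0.
- have p' := perm3_rot p.
  rewrite (tw_sym _ p).
  have [_ _ <-] := frameU p'; have [<- _ _] := frameT p'; have [_ <- _] := frame_tw p'.
  have [_ _ ->] := UE p'; have [-> _ _] := TE p'; have [_ -> _] := twE p'.
  by rewrite -AdDr -(frame_Ad p') Ad_conj.
- have p' := perm3_swap p.
  have [<- _ <-] := frameT p'; have [_ <- _] := frame_tw p'.
  have [-> _ ->] := TE p'; have [_ -> _] := twE p'.
  by rewrite -AdDr -Ad_lbr (frame_uu p') Ad0.
- have [<- <- <-] := frameT p; have [<- <- <-] := frame_tw p.
  have [-> -> ->] := TE p; have [-> -> ->] := twE p.
  by rewrite -!AdDr (frame_sum p) Ad0.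
Qed.

End Twist.

(** * Families satisfying the relations of t_{1,n} *)

Record te_family (k : qalgType) (L : clieType k) n (u : bool -> 'I_n -> L) : Prop :=
  TeFamily {
    tef_sum : forall s, \sum_i u s i = 0;
    tef_comm : forall s i j, i != j -> [l: u s i, u s j] = 0;
    tef_sym : forall i j, i != j -> [l: u true i, u false j] = [l: u true j, u false i];
    tef_3 : forall s i j l, uniq [:: i; j; l] -> [l: u s l, [l: u true i, u false j]] = 0
  }.

Lemma tegen_family (k : qalgType) n : te_family (@tegen k n).
Proof.
have h t : te_rel t -> hev (@te_rel k n) t = 0 by apply: hev_rel.
split.
- move=> s; have := h _ (te_rel_sum k n s).
  by rewrite (big_morph _ (@hev_add _ _ _) (@hev_zero _ _ _)).
- by move=> s i j ij; have := h _ (te_rel_comm k s ij); rewrite hev_br.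
- move=> i j ij; have := h _ (te_rel_sym k ij).
  by rewrite hev_add hev_scale !hev_br scaleN1r => /eqP; rewrite subr_eq0 => /eqP.
- by move=> s i j l ijl; have := h _ (te_rel_3 k s ijl); rewrite !hev_br.
Qed.

Section Te.
Variable k : qalgType.

Lemma te_lift (k' : qalgType) (phi : {rmorphism k -> k'}) (L : clieType k') n
  (u : bool -> 'I_n -> L) : te_family u ->
  exists f : te k n -> L, clie_morph phi f /\ forall s i, f (tegen k s i) = u s i.
Proof.
move=> [u0 uc us u3].
have [|f [fM fE]] := @hat_lift k k' _ (@te_rel k n) phi L (fun p => u p.1 p.2).
  move=> t [s|s i j ij|i j ij|s i j l h] /=; [|exact: uc| |exact: u3].
    rewrite -[RHS](u0 s).
    exact: (big_morph (leval phi (fun p : bool * 'I_n => u p.1 p.2)) (fun _ _ => erefl) erefl).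
  by rewrite rmorphN rmorph1 scaleN1r us ?subrr.
by exists f; split=> // i j; apply: fE.
Qed.

Lemma te_hom_unique (k' : qalgType) (phi : {rmorphism k -> k'}) (L : clieType k') n
  (f g : te k n -> L) : clie_morph phi f -> clie_morph phi g ->
  (forall s i, f (tegen k s i) = g (tegen k s i)) -> f =1 g.
Proof.
by move=> fM gM h x; rewrite (hat_lift_unique fM gM) // => -[i j]; apply: h.
Qed.

Lemma tegen2_opp s : tegen k s (lift ord0 ord0) = - tegen k s ord0 :> te k 2.
Proof.
apply/eqP; rewrite -subr_eq0 opprK addrC; apply/eqP.
by have := tef_sum (tegen_family k 2) s; rewrite !big_ord_recl big_ord0 addr0.
Qed.

Lemma num2_1 : num 1 1 = ord0. Proof. by apply: val_inj; rewrite /= inordK. Qed.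
Lemma num2_2 : num 1 2 = lift ord0 ord0.
Proof. by apply: val_inj; rewrite /= inordK. Qed.

(** For n = 2 the sum relations imply all others, which is why t_{1,2} is free on x_1 and y_1. *)
Lemma te2_family (L : clieType k) (u : bool -> 'I_2 -> L) :
  (forall s, u s (num 1 1) + u s (num 1 2) = 0) -> te_family u.
Proof.
move=> u0; rewrite num2_1 num2_2 in u0.
have uE s : u s (lift ord0 ord0) = - u s ord0.
  by apply/eqP; rewrite -subr_eq0 opprK addrC u0.
have P (Q : 'I_2 -> 'I_2 -> Prop) : Q ord0 (lift ord0 ord0) -> Q (lift ord0 ord0) ord0 ->
    forall i j, i != j -> Q i j.
  move=> h1 h2 i j; case: (unliftP ord0 i) => [i'|] ->; case: (unliftP ord0 j) => [j'|] ->;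
  by rewrite ?(ord1 i') ?(ord1 j') ?eqxx.
split.
- by move=> s; rewrite !big_ord_recl big_ord0 addr0.
- by move=> s; apply: P; rewrite uE ?lbrNl ?lbrNr lbrxx oppr0.
- by apply: P; rewrite !uE lbrNl lbrNr.
- by move=> s [[|[|i]] hi] [[|[|j]] hj] [[|[|l]] hl].
Qed.

Section Te2.
Variables (k' : qalgType) (phi : {rmorphism k -> k'}) (L : clieType k').

Lemma te2_hom_unique (f g : te k 2 -> L) : clie_morph phi f -> clie_morph phi g ->
  f (x_ 1) = g (x_ 1) -> f (y_ 1) = g (y_ 1) -> f =1 g.
Proof.
move=> fM gM hx hy; apply: (te_hom_unique fM gM) => s i.
have h0 : f (tegen k s ord0) = g (tegen k s ord0).
  by move: hx hy; rewrite /x_ /y_ num2_1; case: s.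
case: (unliftP ord0 i) => [i'|] -> //; rewrite (ord1 i').
by rewrite tegen2_opp (clieN fM) (clieN gM) h0.
Qed.
End Te2.

Section Te2Subst.
Variables (L : clieType k) (a b : L).

Lemma te2_substP : [/\ clie_morph idfun (te2_subst a b), te2_subst a b (x_ 1) = a &
  te2_subst a b (y_ 1) = b].
Proof.
have n01 : num 1 2 != num 1 1 by rewrite -val_eqE /= !inordK.
have [|f [fM fE]] := @te_lift _ idfun L 2
  (fun s i => let c := if s then a else b in if i == num 1 1 then c else - c).
  by apply: te2_family => s; rewrite eqxx (negPf n01) subrr.
apply: (@xgetPex _ (fun=> 0) [set f | [/\ clie_morph idfun f, f (x_ 1) = a & f (y_ 1) = b]]).
by exists f; split=> //; rewrite fE eqxx.
Qed.

Lemma te2_subst_morph : clie_morph idfun (te2_subst a b).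
Proof. by case: te2_substP. Qed.
Lemma te2_substx : te2_subst a b (x_ 1) = a. Proof. by case: te2_substP. Qed.
Lemma te2_substy : te2_subst a b (y_ 1) = b. Proof. by case: te2_substP. Qed.

Lemma te2_subst_unique (f : te k 2 -> L) : clie_morph idfun f ->
  f (x_ 1) = a -> f (y_ 1) = b -> f =1 te2_subst a b.
Proof.
move=> fM fa fb; apply: (@te2_hom_unique _ idfun) => //; first exact: te2_subst_morph.
- by rewrite fa te2_substx.
- by rewrite fb te2_substy.
Qed.
End Te2Subst.

Lemma te_mapP (k' : qalgType) (phi : {rmorphism k -> k'}) n :
  clie_morph phi (@te_map k k' phi n) /\
  forall s i, te_map phi (tegen k s i) = tegen k' s i :> te k' n.
Proof.
have [f [fM fE]] := te_lift phi (tegen_family k' n).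
apply: (@xgetPex _ (fun=> 0) [set f | clie_morph phi f /\
    forall s i, f (tegen k s i) = tegen k' s i]).
by exists f.
Qed.

Lemma num3_neq i j l : perm3 i j l -> num 2 i != num 2 j.
Proof. by move: i j l; apply: perm3_ind; rewrite -val_eqE /= !inordK. Qed.

Lemma num3_uniq i j l : perm3 i j l -> uniq [:: num 2 i; num 2 j; num 2 l].
Proof.
move=> h; rewrite /= !inE !negb_or (num3_neq h) (num3_neq (perm3_rot h)).
by rewrite (num3_neq (perm3_swap h)).
Qed.

Lemma sum3 (V : zmodType) (u : 'I_3 -> V) i j l : perm3 i j l ->
  \sum_a u a = u (num 2 i) + u (num 2 j) + u (num 2 l).
Proof.
have -> : \sum_a u a = u (num 2 1) + u (num 2 2) + u (num 2 3).
  rewrite !big_ord_recl big_ord0 addr0 addrA.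
  by congr (u _ + u _ + u _); apply: val_inj; rewrite /= inordK.
move: i j l; apply: perm3_ind; zmod.
Qed.

Lemma te3_ell3 : ell3 (x_ : nat -> te k 3) y_ te_t_.
Proof.
have [t0 tc ts t3] := tegen_family k 3.
split=> i j l h; have [n3 u3] := (num3_neq h, num3_uniq h).
- exact: tc.
- exact: tc.
- by [].
- exact: ts.
- exact: t3.
- exact: t3.
- by rewrite -(t0 true) (sum3 _ h).
- by rewrite -(t0 false) (sum3 _ h).
Qed.

Lemma te3_ins s1 s2 (f := te_ins 3 [:: s1; s2]) :
  uniq (s1 ++ s2) -> perm_eq (s1 ++ s2) [:: 1; 2; 3]%N -> forall u : te k 2,
  f u = te2_subst (\sum_(a <- s1) x_ a) (\sum_(a <- s1) y_ a) u :> te k 3.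
Proof.
move=> U P u.
have sE (g : bool -> 'I_3 -> te k 3) s r : uniq r -> all (fun x => 0 < x <= 3)%N r ->
    \sum_(a : 'I_3 | a.+1 \in r) g s a = \sum_(a <- r) g s (num 2 a).
  by move=> *; apply: sum_block.
have all12 : all (fun x => 0 < x <= 3)%N (s1 ++ s2) by rewrite (perm_all _ P).
move: (U) (all12); rewrite cat_uniq all_cat => /and3P[u1 _ u2] /andP[a1 a2].
have n01 : num 1 2 != num 1 1 by rewrite -val_eqE /= !inordK.
pose v s (i : 'I_2) : te k 3 := \sum_(a | in_block [:: s1; s2] i a) tegen k s a.
have v1 s : v s (num 1 1) = \sum_(a <- s1) tegen k s (num 2 a).
  by rewrite /v /in_block inordK //; apply: sum_block.
have v2 s : v s (num 1 2) = \sum_(a <- s2) tegen k s (num 2 a).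
  by rewrite /v /in_block inordK //; apply: sum_block.
have [|g [gM gE]] := @te_lift _ idfun _ 2 v.
  apply: te2_family => s; rewrite v1 v2 -big_cat (perm_big _ P) /=.
  rewrite !big_cons big_nil addr0 addrA.
  by rewrite -(sum3 (tegen k s) (isT : perm3 1 2 3)) (tef_sum (tegen_family k 3)).
have [fM fE] : clie_morph idfun f /\ forall s i, f (tegen k s i) = v s i.
  apply: (@xgetPex _ (fun=> 0) [set f | clie_morph idfun f /\
    forall s i, f (tegen k s i) = v s i]).
  by exists g.
by apply: te2_subst_unique; rewrite // /x_ /y_ fE v1.
Qed.

Lemma tn_te3P : clie_morph idfun (@tn_te k 3) /\
  forall i j l, perm3 i j l -> tn_te (tt_ i j : tn k 3) = te_t_ i j.
Proof.
have E := te3_ell3; have [t0 tc ts t3] := tegen_family k 3.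
pose u (i j : 'I_3) : te k 3 := if i == j then 0 else [l: tegen k true i, tegen k false j].
have uF : tn_family u.
  split.
  - by move=> i; rewrite /u eqxx.
  - by move=> i j; rewrite /u eq_sym; case: eqVneq => // ij; apply: ts; rewrite eq_sym.
  - move=> i j l h; move: (h); rewrite /= !inE !negb_or andbT => /andP[/andP[ij il] jl].
    rewrite /u (negPf ij) (negPf il) (negPf jl) -lbrDl.
    (* Since x_i + x_j = - x_l, the sum t_il + t_jl is - [x_l, y_l], and t_ij commutes with x_l and
       y_l. *)
    have s0 : tegen k true i + tegen k true j + tegen k true l = 0.
      rewrite -(t0 true) (bigD1 i) //= (bigD1 j) 1?eq_sym //= -addrA; congr (_ + (_ + _)).
      rewrite (bigD1 l) /=; last by rewrite ![l == _]eq_sym il jl.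
      rewrite big1 ?addr0 // => m /andP[/andP[mi mj] ml]; exfalso.
      have : (size [:: m; i; j; l] <= size (enum 'I_3))%N.
        apply: uniq_leq_size; last by move=> z _; rewrite mem_enum.
        by rewrite cons_uniq h !inE !negb_or mi mj ml.
      by rewrite size_enum_ord.
    have -> : tegen k true i + tegen k true j = - tegen k true l.
      by apply/eqP; rewrite -subr_eq0 opprK s0.
    rewrite lbrNl lbrNr lbr_leibniz (lbrC _ (tegen k true l)) (t3 _ _ _ _ h).
    by rewrite oppr0 lbr0 add0r (lbrC _ (tegen k false l)) (t3 _ _ _ _ h) oppr0 lbr0r oppr0.
  - by move=> [[|[|[|i]]] hi] [[|[|[|j]]] hj] [[|[|[|l]]] hl] [[|[|[|m]]] hm].
have [g [gM gE]] := tn_lift idfun uF.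
have [fM fE] : clie_morph idfun (@tn_te k 3) /\ forall i j : 'I_3, i != j ->
      tn_te (tgen k i j) = [l: tegen k true i, tegen k false j].
  apply: (@xgetPex _ (fun=> 0) [set f | clie_morph idfun f /\
    forall i j : 'I_3, i != j -> f (tgen k i j) = [l: tegen k true i, tegen k false j]]).
  by exists g; split=> // i j ij; rewrite gE /u (negPf ij).
by split=> // i j l h; rewrite fE ?(num3_neq h).
Qed.

Lemma geE (g : f2 k) i j l : perm3 i j l ->
  ge [:: [:: i]; [:: j]; [:: l]] g = f2_subst (te_t_ i j) (te_t_ j l) g.
Proof.
move=> h; have [fM fE] := tn_te3P.
have -> : f2_subst (te_t_ i j) (te_t_ j l) g =
    f2_subst (tn_te (tt_ i j : tn k 3)) (tn_te (tt_ j l)) g.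
  by rewrite (fE _ _ _ h) (fE _ _ _ (perm3_rot h)).
rewrite -(f2_subst_hom _ _ _ fM); congr tn_te.
have -> := @gt_eval _ g _ 2 [:: i] [:: j] [:: l] (@tgen k 3) id.
- by rewrite !big_seq1.
- by rewrite (perm_uniq h).
- by rewrite (perm_all _ h).
- exact: clie_id.
- by [].
Qed.

End Te.

(** * The automorphism alpha_g and the section *)

Section Unipotent.
Variables (k : qalgType) (X : Type) (rel : lterm k X -> Prop).
Variable f : hat rel -> hat rel.
Hypothesis fM : clie_morph idfun f.
Hypothesis fgen : forall x, fil 2 (f (hgen rel x) - hgen rel x).

Lemma hat_unip_fil n x : fil n x -> fil n.+1 (f x - x).
Proof.
have [fD fZ fbr fc] := fM; have ff := fil_hat_morph (phi := idfun) fM => hx.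
have [d dn hd] := hat_approx hx (leqnSn n).
have -> : f x - x = f (x - hev rel d) - (x - hev rel d) + (f (hev rel d) - hev rel d).
  by rewrite (clieB fM); zmod.
apply: fil_D; first by apply: fil_B => //; apply: ff.
have tm t : fil (ldeg t).+1 (f (hev rel t) - hev rel t).
  elim: t => [y||t _ u _|a t _|t ht u hu] /=; try exact: fil_1; first exact: fgen.
  rewrite hev_br fbr.
  have -> : [l: f (hev rel t), f (hev rel u)] - [l: hev rel t, hev rel u] =
     [l: f (hev rel t) - hev rel t, f (hev rel u)] + [l: hev rel t, f (hev rel u) - hev rel u].
    by rewrite lbrBl lbrBr; zmod.
  apply: fil_D; last by rewrite -addnS; apply: fil_lbr _ _ _ _ (fil_hev rel t) hu.
  rewrite -addSn; apply: fil_lbr _ _ _ _ ht _.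
  exact: (fil_hev_morph (phi := idfun) fM).
elim: dn => {d hd} [|t u _ ht _ hu|a t _ ht|t ht].
- by rewrite hev_zero (clie0 fM) subrr; apply: fil_0.
- by rewrite hev_add fD opprD addrACA; apply: fil_D.
- by rewrite hev_scale fZ -scalerBr; apply: fil_Z.
- by apply: fil_le (tm t); rewrite ltnS.
Qed.

Lemma hat_unip_aut : clie_aut f.
Proof.
have [fD fZ fbr fc] := fM; split=> //.
(* As f = 1 - N with N raising the filtration, the inverse is the geometric series in N. *)
pose N x := x - f x; pose h := oser (fun=> 1) N.
have nN : nilop N.
  split=> [x y|q x|n x hx]; first by rewrite /N fD opprD addrACA.
    by rewrite /N (clie_qscale (phi := idfun) fM) qscaleBr.
  by rewrite /N -opprB; apply/fil_N/hat_unip_fil.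
have hE u : h u = u + h (N u) by rewrite /h [LHS](oser_recl nN) qscale1.
have fE u : f u = u - N u by rewrite /N; zmod.
have hf : cancel f h.
  by move=> u; rewrite fE /h oserB // -/h [X in X - _]hE addrK.
have fh : cancel h f.
  move=> u; rewrite fE {2}/h (oser_comm (E := N)) // -/h [X in X - _]hE addrK //.
have fI := can_inj hf.
exists h; split=> //; split=> [x y|a x|x y|n].
- exact: oserDr.
- by apply: fI; rewrite fZ !fh.
- by apply: fI; rewrite fbr !fh.
- by exists n => x; apply: fil_oser.
Qed.
End Unipotent.

Lemma oser_scale (k : qalgType) (L : clieType k) c (x y : L) (a : k) :
  oser c (ad x) (a *: y) = a *: oser c (ad x) y.
Proof.
symmetry; apply: (@lsum_morph_oser _ _ (ad x) _ _ (ad x) (fun z => a *: z)) => //.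
- exact: nilop_ad.
- exact: nilop_ad.
- by move=> u v; apply: scalerDr.
- by move=> q u; rewrite /qscale !scalerA mulrC.
- by move=> n; exists n => u; apply: fil_Z.
- by move=> u; rewrite /ad lbrZr.
Qed.

(** * The automorphism of t_{1,2} *)

Section TwoStrands.
Variable k : qalgType.
Local Notation L := (te k 2).
Local Notation x := (x_ 1 : L).
Local Notation y := (y_ 1 : L).
Local Notation t := (te_t_ 1 2 : L).

Lemma te2_x2 : x_ 2 = - x :> L.
Proof. by rewrite /x_ num2_1 num2_2 tegen2_opp. Qed.
Lemma te2_y2 : y_ 2 = - y :> L.
Proof. by rewrite /y_ num2_1 num2_2 tegen2_opp. Qed.

Lemma te2_t12 : t = - [l: x, y].
Proof. by rewrite /te_t_ te2_y2 lbrNr. Qed.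
Lemma te2_t21 : te_t_ 2 1 = t.
Proof. by rewrite te2_t12 /te_t_ te2_x2 lbrNl. Qed.

Lemma t0_1E : t0_ k 1 = - oser bern_coef (ad x) y.
Proof. by rewrite /t0_ ad_bernE. Qed.
Lemma t0_2E : t0_ k 2 = oser bern_coef (ad (- x)) y.
Proof. by rewrite /t0_ ad_bernE te2_x2 te2_y2 oserN ?opprK //; exact: nilop_ad. Qed.

Lemma te2_sum : t0_ k 1 + t0_ k 2 + t = 0.
Proof.
have xN : [l: x, - x] = 0 by rewrite lbrNr lbrxx oppr0.
have xx : [l: x + - x, [l: x, y]] = 0 by rewrite subrr lbr0.
rewrite t0_1E t0_2E te2_t12 !oser_bern_ad lbrNl oserN; last exact: nilop_ad.
apply: oppr_inj; rewrite oppr0 -[RHS](subrr (- [l: x, y])) -{1}(bernT_adN xN xx); zmod.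
Qed.

Lemma te2_yE : y = - oser eps_coef (ad x) (t0_ k 1).
Proof.
rewrite t0_1E oserN; last exact: nilop_ad.
by rewrite opprK oser_eps_bern //; exact: nilop_ad.
Qed.

Lemma te2_Ad : Ad x (t0_ k 1) = - t0_ k 2.
Proof.
rewrite Ad_eps -[oser _ _ _]opprK -te2_yE lbrNr -te2_t12.
by apply/eqP; rewrite -subr_eq0 opprK addrAC te2_sum.
Qed.

(** y_1 is a series in [ad x_1] applied to t_01, by [te2_yE]. *)
Lemma te2_hom_unique_t (k' : qalgType) (phi : {rmorphism k -> k'}) (M : clieType k')
  (f h : L -> M) : clie_morph phi f -> clie_morph phi h ->
  f x = h x -> f (t0_ k 1) = h (t0_ k 1) -> f =1 h.
Proof.
move=> fM hM fx ft; apply: (te2_hom_unique fM hM) => //.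
by rewrite te2_yE (clieN fM) (clieN hM) (clie_oser fM) (clie_oser hM) fx ft.
Qed.

Section Alpha.
Variable g : f2 k.

Definition alphaX : L := g021 g \*e x \*e - g012 g.
Definition alphaT : L := Ad (g012 g) (t0_ k 1).
(** The value at y_1 is the one forced by t_01 being sent to [alphaT]. *)
Definition alpha : L -> L := te2_subst alphaX (- oser eps_coef (ad alphaX) alphaT).

Lemma alpha_morph : clie_morph idfun alpha. Proof. exact: te2_subst_morph. Qed.
Lemma alpha_x : alpha x = alphaX. Proof. exact: te2_substx. Qed.
Lemma alpha_y : alpha y = - oser eps_coef (ad alphaX) alphaT. Proof. exact: te2_substy. Qed.
Lemma alpha_t01 : alpha (t0_ k 1) = alphaT.
Proof.
have n := nilop_ad alphaX.
rewrite t0_1E (clieN alpha_morph) (clie_oser alpha_morph) alpha_x alpha_y.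
by rewrite oserN // opprK oser_bern_eps.
Qed.
(** Since t_02 = - Ad(e^{x_1})(t_01), the two occurrences of g^{0,1,2} cancel. *)
Lemma alpha_t02 : alpha (t0_ k 2) = Ad (g021 g) (t0_ k 2).
Proof.
rewrite -[t0_ k 2]opprK -te2_Ad (clieN alpha_morph) (clie_Ad alpha_morph).
by rewrite alpha_x alpha_t01 /alphaX /alphaT !Ad_mul AdNK te2_Ad AdN opprK opprK.
Qed.

Hypothesis gG : GRT1 g.

(** The hexagon for the triple t_12, t_01, t_02, whose sum is 0: it says that the conjugates of t_01
    and t_02 still add up to - t_12. *)
Lemma alpha_t12 : alpha t = t.
Proof.
have c1 : [l: t, t0_ k 1 + t0_ k 2] = 0.
  have -> : t0_ k 1 + t0_ k 2 = (t0_ k 1 + t0_ k 2 + t) - t by zmod.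
  by rewrite te2_sum sub0r lbrNr lbrxx oppr0.
have c2 : [l: t0_ k 1, t + t0_ k 2] = 0.
  have -> : t + t0_ k 2 = (t0_ k 1 + t0_ k 2 + t) - t0_ k 1 by zmod.
  by rewrite te2_sum sub0r lbrNr lbrxx oppr0.
have c3 : [l: t0_ k 2, t + t0_ k 1] = 0.
  have -> : t + t0_ k 1 = (t0_ k 1 + t0_ k 2 + t) - t0_ k 2 by zmod.
  by rewrite te2_sum sub0r lbrNr lbrxx oppr0.
have c1' : [l: t, t0_ k 2 + t0_ k 1] = 0 by rewrite addrC.
have [e1 _ e2] := grt_triple gG c1 c2 c3.
have [e3 _ _] := grt_triple gG c1' c3 c2.
have tE : t = - t0_ k 1 - t0_ k 2.
  by apply/eqP; rewrite -subr_eq0 -[X in _ == X]te2_sum; apply/eqP; zmod.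
rewrite [in LHS]tE (clieB alpha_morph) (clieN alpha_morph) alpha_t01 alpha_t02.
have -> : g021 g = f2_subst (t0_ k 2) t g by rewrite /g021 te2_t21.
rewrite /alphaT /g012 e1 e3.
have e4 : t + t0_ k 1 + t0_ k 2 = 0 by rewrite -[RHS]te2_sum; zmod.
move: e2; rewrite e4; move: (Ad _ (t0_ k 1)) (Ad _ (t0_ k 2)) => p q e2.
have D (a b c : L) : a + b + c = 0 -> - c - b = a.
  by move=> e; apply/eqP; rewrite -subr_eq0 -oppr_eq0 -[X in _ == X]e; apply/eqP; zmod.
exact: D e2.
Qed.

Lemma alphaX_mod2 : fil 2 (alphaX - x).
Proof.
have g1 : fil 2 (g021 g) by apply: grt_subst_fil2.
have g2 : fil 2 (g012 g) by apply: grt_subst_fil2.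
have D (p q a b z : L) : p - z = (p - (q + - b)) + (q - (a + z)) + a - b by zmod.
rewrite (D _ (g021 g \*e x) (g021 g) (g012 g)).
apply: fil_B => //; apply: fil_D => //; apply: fil_D; exact: emul_mod2.
Qed.

Lemma alphaY_mod2 : fil 2 (alpha y - y).
Proof.
have e0 (u v : L) : fil 2 (oser eps_coef (ad u) v - qscale (eps_coef 0) v).
  rewrite (oser_recl (nilop_ad u) eps_coef) addrAC subrr add0r.
  by apply: (fil_oser (nilop_ad u)); apply: fil_lbrr; apply: fil_1.
have hT : fil 2 (alphaT - t0_ k 1).
  by rewrite /alphaT Ad_eps addrAC subrr add0r; apply: fil_lbrl; apply: fil_1.
rewrite alpha_y [X in _ - X]te2_yE.
set a := oser _ _ alphaT; set b := oser _ _ _.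
have -> : - a - - b = (b - qscale (eps_coef 0) (t0_ k 1)) -
   (a - qscale (eps_coef 0) alphaT) - qscale (eps_coef 0) (alphaT - t0_ k 1).
  by rewrite qscaleBr; zmod.
apply: fil_B; last exact: fil_qscale.
by apply: fil_B; apply: e0.
Qed.

Lemma alphaP : is_alpha g alpha.
Proof.
split; [|exact: alpha_x|exact: alpha_t01].
apply: hat_unip_aut; first exact: alpha_morph.
have h0 s : fil 2 (alpha (tegen k s ord0) - tegen k s ord0).
  by rewrite -num2_1; case: s; [rewrite [alpha _]alpha_x; exact: alphaX_mod2|exact: alphaY_mod2].
move=> [s i]; case: (unliftP ord0 i) => [i'|] ->; last exact: h0.
rewrite (ord1 i') -/(tegen k s (lift ord0 ord0)) tegen2_opp.
by rewrite (clieN alpha_morph) -opprD; apply/fil_N/h0.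
Qed.
End Alpha.

Lemma is_alpha_eq g f : is_alpha g f -> f = alpha g.
Proof.
move=> [[fM _] fx ft]; apply/funext; apply: (te2_hom_unique_t fM (alpha_morph g)).
- by rewrite fx alpha_x.
- by rewrite ft alpha_t01.
Qed.

End TwoStrands.

Section EllipticSection.
Variable k : qalgType.

Definition ell_sec (g : f2 k) : ell k := (g, (alpha g (x_ 1), alpha g (y_ 1))).

Section InFrame.
Variable g : f2 k.
Hypothesis gG : GRT1 g.
Local Notation L := (te k 3).

Definition te3_t0 i : L := - oser bern_coef (ad (x_ i)) (y_ i).
Local Notation t0 := te3_t0.
Let E3 : ell3 (x_ : nat -> L) y_ te_t_ := te3_ell3 k.
Let E : ell3b (x_ : nat -> L) t0 te_t_ := ell3_b E3.

(** The morphism f is the insertion on the blocks i and jl. The value at t_02 is found by comparing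
    the sum relations in t_{1,2} and t_{1,3}. *)
Lemma te3_subst_t i j l (f := te2_subst (x_ i : L) (y_ i)) : perm3 i j l ->
  [/\ f (t0_ k 1) = t0 i, f (t0_ k 2) = t0 j + t0 l + te_t_ j l &
      f (te_t_ 1 2) = te_t_ i j + te_t_ i l].
Proof.
move=> h; have fM : clie_morph idfun f := te2_subst_morph _ _; have [fD _ fb _] := fM.
have e1 : f (t0_ k 1) = t0 i.
  by rewrite t0_1E (clieN fM) (clie_oser fM) /f te2_substx te2_substy.
have e2 : f (te_t_ 1 2) = te_t_ i j + te_t_ i l.
  by rewrite te2_t12 (clieN fM) fb /f te2_substx te2_substy (ell_xx_self E3 h) opprK.
split=> //; have := congr1 f (te2_sum k); rewrite !fD e1 e2 (clie0 fM) => e.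
have := ellb_su E h; rewrite -{1}e => e'.
have D (a b c d p q r : L) : a + b + c + p + q + r = a + d + (p + q) -> d = b + c + r.
  by move=> H; apply/eqP; rewrite -subr_eq0 -(subrr (a + d + (p + q))) -{2}H; apply/eqP; zmod.
by apply: (D (t0 i) _ _ _ (te_t_ i j) (te_t_ i l)); rewrite e (ellb_su E h).
Qed.

Lemma te3_subst_alpha i j l (f := te2_subst (x_ i : L) (y_ i)) : perm3 i j l ->
  f (alphaX g) = gC g t0 te_t_ j l i \*e x_ i \*e - gD g t0 te_t_ i j l /\
  f (alphaT g) = Ad (gD g t0 te_t_ i j l) (t0 i).
Proof.
move=> h; have [h1 h2 h3] := And3 (perm3_sym h) (perm3_rot h) (perm3_swap h).
have fM : clie_morph idfun f := te2_subst_morph _ _.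
have [e1 e2 e3] := te3_subst_t h; rewrite -/f in e1 e2 e3.
have eD : f (g012 g) = gD g t0 te_t_ i j l by rewrite (f2_subst_hom _ _ _ fM) e1 e3.
have eC : f (g021 g) = gC g t0 te_t_ j l i.
  rewrite (f2_subst_hom _ _ _ fM) e2 te2_t21 e3 /gC.
  rewrite -(ellb_t E h) -[te_t_ l i](ellb_t E h3) -[X in f2_subst _ X]addr0.
  (* The extra summand t_jl commutes with both arguments t_0j + t_0l and t_ji + t_li. *)
  apply: (grt_shift gG); rewrite ?lbr0 ?lbr0r //.
    have e := ellb_uu E h2; have e' := ellb_uu E (perm3_sym h2).
    rewrite -(ellb_t E h2) in e'; have := congr2 +%R e e'.
    rewrite !lbrDr addrACA (lbrC (t0 j) (t0 l)) addNr add0r addr0.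
    by rewrite (lbrC _ (t0 j)) (lbrC _ (t0 l)) -opprD => ->; rewrite oppr0.
  have -> : te_t_ i j + te_t_ i l = [l: x_ i, y_ j + y_ l] :> L.
    by rewrite lbrDr (ell_xy E3 h) (ell_xy E3 h3).
  have -> : y_ j + y_ l = - y_ i :> L.
    by apply/eqP; rewrite -subr_eq0 opprK (ell_sy E3 h2).
  rewrite lbr_leibniz (lbr_swap (ell_xt E3 h2)) lbr0 add0r lbrNr.
  by rewrite (lbr_swap (ell_yt E3 h2)) oppr0 lbr0r.
split; last by rewrite (clie_Ad fM) eD e1.
by rewrite /alphaX /emul !(clie_bch fM) (clieN fM) eC eD /f te2_substx.
Qed.

(** Up to translation the equations are relations of the twisted family: the two sum relations, the
    commutation of the strands 1 and 3, and [x_1, y_2] = t_12, where t_12 is unchanged by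
    [twt12]. *)
Lemma ell_sec_GRT1ell : GRT1ell (ell_sec g).
Proof.
have E' := ell3b_ell (twist_ell3b gG E).
have [U1 U2 U3] := twU_base gG E; have [T1 T2 T3] := twT_base gG E.
have gA12 : ge [:: [:: 1]; [:: 2]; [:: 3]]%N g = gA g te_t_ 1 2 3 by apply: geE.
have gA21 : ge [:: [:: 2]; [:: 1]; [:: 3]]%N g = gA g te_t_ 2 1 3 by apply: geE.
have ue1 u : ue [:: [:: 1]; [:: 2; 3]]%N u = te2_subst (x_ 1 : L) (y_ 1) u.
  by rewrite /ue te3_ins // !big_seq1.
have ue2 u : ue [:: [:: 2]; [:: 1; 3]]%N u = te2_subst (x_ 2 : L) (y_ 2) u.
  by rewrite /ue te3_ins // !big_seq1.
have ue3 u : ue [:: [:: 3]; [:: 1; 2]]%N u = te2_subst (x_ 3 : L) (y_ 3) u.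
  by rewrite /ue te3_ins // !big_seq1.
have [X1 Y1] := te3_subst_alpha (isT : perm3 1 2 3).
have [X2 Y2] := te3_subst_alpha (isT : perm3 2 1 3).
have [X3 Y3] := te3_subst_alpha (isT : perm3 3 1 2).
rewrite /GRT1ell /ell_sec /= gA12 gA21 !ue1 !ue2 !ue3 /einv !alpha_x !alpha_y.
have m (z a b : L) u v : Ad z (te2_subst a b (- oser eps_coef (ad u) v)) =
    - oser eps_coef (ad (Ad z (te2_subst a b u))) (Ad z (te2_subst a b v)).
  have fM := te2_subst_morph a b; have zM := clie_Ad_morph z.
  by rewrite (clieN fM) (clie_oser fM) AdN (clie_oser zM).
have m' (a b : L) u v : te2_subst a b (- oser eps_coef (ad u) v) =
    - oser eps_coef (ad (te2_subst a b u)) (te2_subst a b v).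
  have fM := te2_subst_morph a b.
  by rewrite (clieN fM) (clie_oser fM).
rewrite !m m' X1 X2 X3 Y1 Y2 Y3 -U1 -U2 -U3 -T1 -T2 -T3.
split=> //.
- split; first exact: (ell_sx E' (isT : perm3 1 2 3)).
  exact: (ell_sy E' (isT : perm3 1 2 3)).
- split; first exact: (ell_xx E' (isT : perm3 1 3 2)).
  exact: (ell_yy E' (isT : perm3 1 3 2)).
- by rewrite (ell_xy E' (isT : perm3 1 2 3)) twt12.
Qed.
End InFrame.

Lemma te2_substE (f : te k 2 -> te k 2) : clie_morph idfun f ->
  te2_subst (f (x_ 1)) (f (y_ 1)) =1 f.
Proof. by move=> fM u; rewrite -(te2_subst_unique fM erefl erefl). Qed.

(** The morphism [alpha g2] conjugates t_01 by g2^{0,1,2} and fixes t_12, which is exactly the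
    substitution in the product of GRT_1. *)
Lemma alpha_g012 (g1 g2 : f2 k) : GRT1 g2 ->
  alpha g2 (g012 g1) = g012 (GRT1_mul g1 g2) \*e - g012 g2.
Proof.
move=> gG; rewrite (f2_subst_hom _ _ _ (alpha_morph g2)) alpha_t01 alpha_t12 //.
have fM := f2_subst_morph (t0_ k 1) (te_t_ 1 2).
rewrite /g012 /GRT1_mul (clie_bch fM) -/(emul _ _) emulK (f2_subst_hom _ _ _ fM).
by rewrite (clie_Ad fM) f2_substA f2_substB.
Qed.

Lemma alpha_g021 (g1 g2 : f2 k) : GRT1 g2 ->
  alpha g2 (g021 g1) = g021 (GRT1_mul g1 g2) \*e - g021 g2.
Proof.
move=> gG; rewrite (f2_subst_hom _ _ _ (alpha_morph g2)) alpha_t02 te2_t21 alpha_t12 //.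
have fM := f2_subst_morph (t0_ k 2) (te_t_ 2 1).
rewrite /g021 /GRT1_mul (clie_bch fM) -/(emul _ _) emulK (f2_subst_hom _ _ _ fM).
by rewrite (clie_Ad fM) f2_substA f2_substB te2_t21.
Qed.

Lemma emul_cancel (M : clieType k) (a b c d z : M) :
  a \*e z \*e - d = a \*e - b \*e (b \*e z \*e - c) \*e - (d \*e - c).
Proof. by rewrite emulN opprK !emulA !emulNK. Qed.

Lemma alpha_mul (g1 g2 : f2 k) : GRT1 g2 -> alpha (GRT1_mul g1 g2) =1 alpha g2 \o alpha g1.
Proof.
move=> gG; have aM := alpha_morph g2.
apply: (te2_hom_unique_t (phi := idfun) (alpha_morph _)).
- exact: (clie_comp (alpha_morph g1) aM).
- rewrite /= !alpha_x {2}/alphaX /emul !(clie_bch aM) (clieN aM) -!/(emul _ _).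
  rewrite (alpha_g012 g1 gG) (alpha_g021 g1 gG) alpha_x /alphaX.
  exact: emul_cancel.
- rewrite /= !alpha_t01 {2}/alphaT (clie_Ad aM) alpha_t01 alpha_g012 // /alphaT.
  by rewrite Ad_mul AdNK.
Qed.

Lemma ell_sec_mul (g1 g2 : f2 k) : GRT1 g2 ->
  ell_sec (GRT1_mul g1 g2) = GRT1ell_mul (ell_sec g1) (ell_sec g2).
Proof.
by move=> gG; rewrite /GRT1ell_mul /ell_sec /= !(te2_substE (alpha_morph g2)) !alpha_mul.
Qed.

(** The scaling d of y_1 multiplies t_01, t_02 and t_12 by c^{-1}, so it carries g to c.g in all
    substitutions; the factor c in front of u_- undoes the scaling of t_01. *)
Lemma ell_sec_act (c : kunit k) g : ell_sec (GRT1_act c g) = GRT1ell_act c (ell_sec g).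
Proof.
rewrite /GRT1ell_act /ell_sec /=; set d := te2_subst _ _.
have dM : clie_morph idfun d := te2_subst_morph _ _.
have [dD dZ db _] := dM; have dx : d (x_ 1) = x_ 1 := te2_substx _ _.
have dy : d (y_ 1) = uinv c *: y_ 1 := te2_substy _ _.
have d1 : d (t0_ k 1) = uinv c *: t0_ k 1.
  by rewrite t0_1E (clieN dM) (clie_oser dM) dx dy oser_scale scalerN.
have d2 : d (t0_ k 2) = uinv c *: t0_ k 2.
  by rewrite t0_2E (clie_oser dM) (clieN dM) dx dy oser_scale.
have d3 : d (te_t_ 1 2) = uinv c *: te_t_ 1 2.
  by rewrite te2_t12 (clieN dM) db dx dy lbrZr scalerN.
have e (a b : te k 2) : d a = uinv c *: a -> d b = uinv c *: b ->
    f2_subst a b (GRT1_act c g) = d (f2_subst a b g).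
  move=> da db'; have fM := f2_subst_morph a b; have [_ fZ _ _] := fM.
  by rewrite (f2_subst_hom _ _ _ dM) (f2_subst_hom _ _ _ fM) !fZ f2_substA f2_substB da db'.
have eX : alphaX (GRT1_act c g) = d (alphaX g).
  rewrite /alphaX /emul !(clie_bch dM) (clieN dM) dx -/(emul _ _).
  by rewrite /g021 /g012 !e // te2_t21.
have eT : alphaT (GRT1_act c g) = uval c *: d (alphaT g).
  by rewrite /alphaT (clie_Ad dM) d1 AdZ scalerA uvalK scale1r /g012 e.
rewrite !alpha_x !alpha_y eX eT oser_scale (clieN dM) (clie_oser dM) scalerN //.
Qed.

Lemma ell_sec_section1 : is_section1 ell_sec.
Proof.
split; first split=> [g|g1 g2 _]; [exact: ell_sec_GRT1ell|exact: ell_sec_mul|].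
move=> g gG; exists (alpha g) => //; split; first exact: alphaP.
by move=> f /is_alpha_eq.
Qed.

Lemma section1_unique s g : is_section1 s -> GRT1 g -> s g = ell_sec g.
Proof. by move=> [_ h] /h [a [aP _] ->]; rewrite (is_alpha_eq aP). Qed.

(** The coefficients are read off by morphisms to the abelian Lie algebra [abk k], which kill
    F^2. *)
Lemma lin_part_unique (u : te k 2) a b a' b' :
  lin_part u a b -> lin_part u a' b' -> a = a' /\ b = b'.
Proof.
have coef (p q a0 b0 : k) : lin_part u a0 b0 ->
    te2_subst (p : abk k) q u = a0 * p + b0 * q.
  move=> h; have fM := te2_subst_morph (p : abk k) q; have [fD fZ _ _] := fM.
  apply/eqP; rewrite -subr_eq0; apply/eqP.
  have := abk_fil2 (fil_hat_morph (phi := idfun) fM h).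
  by rewrite (clieB fM) fD !fZ te2_substx te2_substy.
move=> h h'; split.
- by have := coef 1 0 _ _ h; rewrite (coef 1 0 _ _ h') !mulr1 !mulr0 !addr0.
- by have := coef 0 1 _ _ h; rewrite (coef 0 1 _ _ h') !mulr1 !mulr0 !add0r.
Qed.

Lemma ell_sec_GL2 g : GRT1 g -> GRT1ell_GL2 (ell_sec g) = 1%:M.
Proof.
move=> gG; have lx : lin_part (alpha g (x_ 1)) 1 0.
  by rewrite /lin_part scale1r scale0r addr0 alpha_x; apply: alphaX_mod2.
have ly : lin_part (alpha g (y_ 1)) 0 1.
  by rewrite /lin_part scale1r scale0r add0r; apply: alphaY_mod2.
rewrite /GRT1ell_GL2; case: xgetP => [M _ [/= hx hy]|]; last first.
  by move=> /(_ 1%:M) []; rewrite /= !mxE.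
have [e1 e2] := lin_part_unique hx lx; have [e3 e4] := lin_part_unique hy ly.
have ord2 (i : 'I_2) : i = 0 \/ i = 1.
  by case: i => [[|[|i]] hi] //; [left | right]; apply: val_inj.
by apply/matrixP => i j; rewrite mxE; case: (ord2 i) (ord2 j) => -> [] ->.
Qed.

End EllipticSection.

Lemma ell_sec_map (k k' : qalgType) (phi : {rmorphism k -> k'}) (g : f2 k) :
  ell_sec (f2_map phi g) =
  (f2_map phi g, (te_map phi (ell_sec g).2.1, te_map phi (ell_sec g).2.2)).
Proof.
have [mM mE] := te_mapP phi 2; set m := @te_map k k' phi 2 in mM mE *.
have [_ _ mb _] := mM.
have mx i : m (x_ i) = x_ i := mE _ _; have my i : m (y_ i) = y_ i := mE _ _.
have m1 : m (t0_ k 1) = t0_ k' 1 by rewrite !t0_1E (clieN mM) (clie_oser mM) mx my.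
have m2 : m (t0_ k 2) = t0_ k' 2 by rewrite !t0_2E (clie_oser mM) (clieN mM) mx my.
have m3 i j : m (te_t_ i j) = te_t_ i j by rewrite /te_t_ mb mx my.
have eX : m (alphaX g) = alphaX (f2_map phi g).
  rewrite /alphaX /emul !(clie_bch mM) (clieN mM) mx.
  by rewrite /g021 /g012 !(f2_subst_semi _ _ _ mM) m1 m2 !m3.
have eT : m (alphaT g) = alphaT (f2_map phi g).
  by rewrite /alphaT (clie_Ad mM) m1 /g012 (f2_subst_semi _ _ _ mM) m1 m3.
rewrite /ell_sec /= !alpha_x !alpha_y eX (clieN mM) (clie_oser mM) eX eT //.
Qed.

Theorem proposition4p7 (k : qalgType) :
  exists s : f2 k -> ell k,
    [/\ (* s is the unique group morphism g |-> (g, u_+^g, u_-^g) *)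
        is_section1 s /\
        (forall s' : f2 k -> ell k, is_section1 s' ->
           forall g, GRT1 g -> s' g = s g),
        (* compatibility with the actions of k^* *)
        forall (c : kunit k) g, GRT1 g -> s (GRT1_act c g) = GRT1ell_act c (s g),
        (* the extension to GRT(k) is a group morphism, and a section *)
        group_morphism (@GRT k) (@GRT_mul k) (@GRTell k) (@GRTell_mul k)
          (GRT_ext s) /\
        (forall x, GRT x -> GRTell_GRT (GRT_ext s x) = x),
        (* the square commutes *)
        forall x, GRT x -> GRTell_GL2 (GRT_ext s x) = Gm_GL2 (GRT_Gm x) &
        (* GRT(-) -> GRT_ell(-) is a morphism of functors *)
        forall (k' : qalgType) (phi : {rmorphism k -> k'})
          (s' : f2 k' -> ell k'), is_section1 s' ->
          forall x, GRT x ->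
            GRT_ext s' (GRT_map phi x) = GRTell_map phi (GRT_ext s x)].
Proof.
(* Multiplicativity on the semidirect product combines the two compatibilities; the first one is
   applied to c.g2, which therefore has to lie in GRT_1. *)
have mulP (c : kunit k) (g1 g2 : f2 k) : GRT1 g2 ->
    ell_sec (GRT1_mul g1 (GRT1_act c g2)) =
    GRT1ell_mul (ell_sec g1) (GRT1ell_act c (ell_sec g2)).
  by move=> gG; rewrite (ell_sec_mul g1 (GRT1_actP c gG)) ell_sec_act.
exists (@ell_sec k); split.
- split; first exact: ell_sec_section1.
  by move=> s sP g; apply: section1_unique.
- by move=> c g _; apply: ell_sec_act.
- split; last by case.
  split=> [[g c] gG|[g1 c1] [g2 c2] _ gG]; first exact: ell_sec_GRT1ell.
  by rewrite /GRT_ext /GRTell_mul /= (mulP _ _ _ gG).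
- by move=> [g c] gG; rewrite /GRTell_GL2 /= (ell_sec_GL2 gG) mul1mx.
- move=> k' phi s sP [g c] gG; rewrite /GRT_ext /GRT_map /GRTell_map /=.
  (* An arbitrary section over k' is only known on GRT_1(k'), whence the need for stability under
     base change. *)
  by rewrite (section1_unique sP (GRT1_map phi gG)) ell_sec_map.
Qed.
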